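(* Let $k$ be a field, $q\in k\setminus\{0,1\}$, $I\subset k^\times$ a subset and $n\ge1$. Let $\Gamma=I_q$ be the quiver with vertex set $I$ and with an arrow $i\to qi$ whenever $i,qi\in I$. Let $H_n(\Gamma)$ be the algebra attached to $\Gamma$ in the context and let $kH_n$ be the affine Hecke algebra of $\mathrm{GL}_n$ over $k$ with parameter $q$. There is an equivalence of categories $$kH_n(\Gamma)\text{-}\mathrm{Mod}_0\ \xrightarrow{\ \sim\ }\ \mathcal C_\Gamma,\qquad M\mapsto M,$$ where $X_i$ acts on $1_\nu M$ by $\nu_i(x_i+1)$ and, writing $y_j=x_j+1$, $T_i$ acts on $1_\nu M$ by - $(qy_i-y_{i+1})\tau_i+q$ if $\nu_i=\nu_{i+1}$; - $(q^{-1}y_i-y_{i+1})^{-1}(\tau_i+(1-q)y_{i+1})$ if $\nu_{i+1}=q\nu_i$; - $(\nu_iy_i-\nu_{i+1}y_{i+1})^{-1}\bigl((q\nu_iy_i-\nu_{i+1}y_{i+1})\tau_i+(1-q)\nu_{i+1}y_{i+1}\bigr)$ otherwise.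
   Context: **The algebra $H_n(\Gamma)$.** For $i\neq j$ in $I$ let $d_{ij}$ be the number of arrows $i\to j$ in $\Gamma$ (so $d_{ij}=1$ if $j=qi$ and $d_{ij}=0$ otherwise). Put $P_{ij}(u,v)=(v-u)^{d_{ij}}$ for $i\ne j$, $Q_{ij}(u,v)=P_{ij}(u,v)P_{ji}(v,u)=(-1)^{d_{ij}}(u-v)^{d_{ij}+d_{ji}}$ for $i\neq j$, and $Q_{ii}=0$. Then $kH_n(\Gamma)=H_n(Q)$ over $k$, where, with $L=I^n$, $H_n(Q)$ is the (possibly non-unitary) $k$-algebra generated by $1_\nu$, $x_{i,\nu}$ ($1\le i\le n$), $\tau_{i,\nu}$ ($1\le i\le n-1$), $\nu\in L$, with relations: - $1_\nu1_{\nu'}=\delta_{\nu,\nu'}1_\nu$, $\tau_{i,\nu}=1_{s_i(\nu)}\tau_{i,\nu}1_\nu$, $x_{a,\nu}=1_\nu x_{a,\nu}1_\nu$, $x_{a,\nu}x_{b,\nu}=x_{b,\nu}x_{a,\nu}$; - $\tau_{i,s_i(\nu)}\tau_{i,\nu}=Q_{\nu_i,\nu_{i+1}}(x_{i,\nu},x_{i+1,\nu})$; $\tau_{i,s_j(\nu)}\tau_{j,\nu}=\tau_{j,s_i(\nu)}\tau_{i,\nu}$ if $|i-j|>1$; - $\tau_{i+1,s_is_{i+1}(\nu)}\tau_{i,s_{i+1}(\nu)}\tau_{i+1,\nu}-\tau_{i,s_{i+1}s_i(\nu)}\tau_{i+1,s_i(\nu)}\tau_{i,\nu}$ equals $(x_{i+2,\nu}-x_{i,\nu})^{-1}(Q_{\nu_i,\nu_{i+1}}(x_{i+2,\nu},x_{i+1,\nu})-Q_{\nu_i,\nu_{i+1}}(x_{i,\nu},x_{i+1,\nu}))$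 if $\nu_i=\nu_{i+2}$ and $0$ otherwise; - $\tau_{i,\nu}x_{a,\nu}-x_{s_i(a),s_i(\nu)}\tau_{i,\nu}$ equals $-1_\nu$ if $a=i$ and $\nu_i=\nu_{i+1}$; $1_\nu$ if $a=i+1$ and $\nu_i=\nu_{i+1}$; $0$ otherwise. Here $s_i=(i,i+1)$ acts on $I^n$ by permuting coordinates. The subscript $\nu$ is dropped from $x_{i,\nu}$ and $\tau_{i,\nu}$ when these act on $1_\nu M$. **$kH_n(\Gamma)\text{-}\mathrm{Mod}_0$**: the category of $kH_n(\Gamma)$-modules $M$ such that $M=\bigoplus_\nu1_\nu M$ and, for every $\nu$, the elements $x_{i,\nu}$ ($1\le i\le n$) act locally nilpotently on $1_\nu M$. **Affine Hecke algebra.** $kH_n=k[X_1^{\pm1},\dots,X_n^{\pm1}]\otimes_kH_n^f$ as a $k$-module, both factors being subalgebras, where $H_n^f$ is the $k$-algebra generated by $T_1,\dots,T_{n-1}$ with $T_iT_{i+1}T_i=T_{i+1}T_iT_{i+1}$, $T_iT_j=T_jT_i$ if $|i-j|>1$, $(T_i-q)(T_i+1)=0$; and $T_iX_j=X_jT_i$ if $j-i\ne0,1$, $T_iX_{i+1}-X_iT_i=(q-1)X_{i+1}$. **$\mathcal C_\Gamma$.** For a $kH_n$-module $M$ and $a\in(k^\times)^n$, $M_a$ is the $k[X_1^{\pm1},\dots,X_n^{\pm1}]$-submodule of $M$ of elements with support contained in the closed point of $\mathbb A^n_k$ given by $a$. $\mathcal C_\Gamma$ is the category of $kH_n$-modules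 $M$ such that $M=\bigoplus_{a\in I^n}M_a$.
   Formalization: When ν_{i+1}=qν_i, τ_i carries a minus sign (with the printed sign the quadratic relation of T_i fails), and the formulas describe the component 1_νT_i, with τ_i read as 1_ντ_i, instead of T_i restricted to 1_νM. *)

(* Defs.v *)
From HB Require Import structures.
From mathcomp Require Import all_boot all_order all_algebra perm.
From mathcomp Require Import boolp.
From mathcomp Require Import mpoly.

Set Implicit Arguments.
Unset Strict Implicit.
Unset Printing Implicit Defensive.

Import GRing.Theory.
Local Open Scope ring_scope.
Local Open Scope quotient_scope.

(** * Categories *)

Record category := Category {
  ob :> Type;
  hom : ob -> ob -> Type;
  idm : forall X, hom X X;
  comp : forall X Y Z, hom Y Z -> hom X Y -> hom X Z;
  comp_idl : forall X Y (f : hom X Y), comp (idm Y) f = f;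
  comp_idr : forall X Y (f : hom X Y), comp f (idm X) = f;
  comp_assoc : forall X Y Z W (h : hom Z W) (g : hom Y Z) (f : hom X Y),
    comp h (comp g f) = comp (comp h g) f }.
Arguments idm {c} X.
Arguments comp {c X Y Z} g f : rename.

Record functor (C D : category) := Functor {
  fob :> C -> D;
  fmap : forall X Y : C, hom X Y -> hom (fob X) (fob Y);
  fmap_id : forall X : C, fmap (idm X) = idm (fob X);
  fmap_comp : forall (X Y Z : C) (g : hom Y Z) (f : hom X Y),
    fmap (comp g f) = comp (fmap g) (fmap f) }.
Arguments fmap {C D} F {X Y} f : rename.

Definition id_functor (C : category) : functor C C :=
  @Functor C C id (fun _ _ f => f) (fun _ => erefl) (fun _ _ _ _ _ => erefl).

Lemma comp_functor_id (C D E : category) (G : functor D E) (F : functor C D)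
  (X : C) : fmap G (fmap F (idm X)) = idm (G (F X)).
Proof. by rewrite !fmap_id. Qed.

Lemma comp_functor_comp (C D E : category) (G : functor D E) (F : functor C D)
  (X Y Z : C) (g : hom Y Z) (f : hom X Y) :
  fmap G (fmap F (comp g f)) = comp (fmap G (fmap F g)) (fmap G (fmap F f)).
Proof. by rewrite !fmap_comp. Qed.

Definition comp_functor (C D E : category) (G : functor D E) (F : functor C D) :
    functor C E :=
  @Functor C E (fun X => G (F X)) (fun _ _ f => fmap G (fmap F f))
    (comp_functor_id G F) (comp_functor_comp G F).

Definition naturally_isomorphic (C D : category) (F G : functor C D) : Prop :=
  exists (eta : forall X : C, hom (F X) (G X))
         (eps : forall X : C, hom (G X) (F X)),
    [/\ forall X, comp (eps X) (eta X) = idm (F X),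
        forall X, comp (eta X) (eps X) = idm (G X)
      & forall (X Y : C) (f : hom X Y),
          comp (fmap G f) (eta X) = comp (eta Y) (fmap F f)].

Definition is_equivalence (C D : category) (F : functor C D) : Prop :=
  exists G : functor D C,
    naturally_isomorphic (comp_functor G F) (id_functor C) /\
    naturally_isomorphic (comp_functor F G) (id_functor D).

(** * Possibly non-unitary algebras and their modules *)

Record nualg (k : fieldType) := NUAlg {
  nusort :> lmodType k;
  numul : nusort -> nusort -> nusort;
  numulA : forall a b c, numul a (numul b c) = numul (numul a b) c;
  numulDl : forall a b c, numul (a + b) c = numul a c + numul b c;
  numulDr : forall a b c, numul a (b + c) = numul a b + numul a c;
  numulZl : forall (r : k) a b, numul (r *: a) b = r *: numul a b;
  numulZr : forall (r : k) a b, numul a (r *: b) = r *: numul a b }.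

Record action (k : fieldType) (A : nualg k) (V : lmodType k) := Action {
  act :> A -> V -> V;
  actDl : forall a b v, act (a + b) v = act a v + act b v;
  actZl : forall (r : k) a v, act (r *: a) v = r *: act a v;
  actDr : forall a v w, act a (v + w) = act a v + act a w;
  actZr : forall (r : k) a v, act a (r *: v) = r *: act a v;
  actM : forall a b v, act (numul a b) v = act a (act b v) }.

Record numod (k : fieldType) (A : nualg k) := NUMod {
  space :> lmodType k;
  mact : action A space }.
Arguments mact {k A} M : rename.

Definition equivariant (k : fieldType) (A : nualg k) (V W : lmodType k)
    (aV : action A V) (aW : action A W) (f : V -> W) : Prop :=
  forall a v, f (aV a v) = aW a (f v).

Record modhom (k : fieldType) (A : nualg k) (M N : numod A) := ModHom {
  mhfun :> M -> N;
  mh_linear : linear mhfun;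
  mh_equiv : equivariant (mact M) (mact N) mhfun }.

Lemma modhom_eq (k : fieldType) (A : nualg k) (M N : numod A)
  (f g : modhom M N) : (forall v, f v = g v) -> f = g.
Proof.
case: f g => [f lf ef] [g lg eg] /= /funext fg; case: _ / fg in lg eg *.
by congr ModHom; exact: Prop_irrelevance.
Qed.

Definition modhom_id (k : fieldType) (A : nualg k) (M : numod A) :
    modhom M M :=
  @ModHom k A M M id (fun _ _ _ => erefl) (fun _ _ => erefl).

Lemma modhom_comp_linear (k : fieldType) (A : nualg k) (M N P : numod A)
  (g : modhom N P) (f : modhom M N) : linear (fun v => g (f v)).
Proof. by move=> r u v; rewrite !mh_linear. Qed.

Lemma modhom_comp_equiv (k : fieldType) (A : nualg k) (M N P : numod A)
  (g : modhom N P) (f : modhom M N) :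
  equivariant (mact M) (mact P) (fun v => g (f v)).
Proof. by move=> a v; rewrite !mh_equiv. Qed.

Definition modhom_comp (k : fieldType) (A : nualg k) (M N P : numod A)
    (g : modhom N P) (f : modhom M N) : modhom M P :=
  ModHom (modhom_comp_linear g f) (modhom_comp_equiv g f).

Lemma modhom_comp_idl (k : fieldType) (A : nualg k) (M N : numod A)
  (f : modhom M N) : modhom_comp (modhom_id N) f = f.
Proof. exact: modhom_eq. Qed.

Lemma modhom_comp_idr (k : fieldType) (A : nualg k) (M N : numod A)
  (f : modhom M N) : modhom_comp f (modhom_id M) = f.
Proof. exact: modhom_eq. Qed.

Lemma modhom_compA (k : fieldType) (A : nualg k) (M N P Q : numod A)
  (h : modhom P Q) (g : modhom N P) (f : modhom M N) :
  modhom_comp h (modhom_comp g f) = modhom_comp (modhom_comp h g) f.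
Proof. exact: modhom_eq. Qed.

(* The full subcategory of A-modules satisfying P. *)
Definition modcat (k : fieldType) (A : nualg k) (P : numod A -> Prop) :
    category :=
  @Category {M : numod A | P M}
    (fun M N => modhom (sval M) (sval N))
    (fun M => modhom_id (sval M))
    (fun M N L g f => modhom_comp g f)
    (fun M N f => modhom_comp_idl f)
    (fun M N f => modhom_comp_idr f)
    (fun M N L K h g f => modhom_compA h g f).

(* The data of a functor M |-> M, f |-> f between categories of modules over
   two algebras A and B: it changes the action but neither the underlying
   k-vector spaces nor the underlying maps. *)
Record change_of_action (k : fieldType) (A B : nualg k)
    (P : numod A -> Prop) (P' : numod B -> Prop) := ChangeOfAction {
  new_act : forall M : modcat P, action B (sval M);
  new_act_in : forall M : modcat P, P' (NUMod (new_act M));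
  new_act_hom : forall (M N : modcat P) (f : hom M N),
    equivariant (new_act M) (new_act N) (f : modhom _ _) }.
Arguments new_act {k A B P P'} F M : rename.

Definition same_space_map (k : fieldType) (A B : nualg k)
    (P : numod A -> Prop) (P' : numod B -> Prop)
    (F : change_of_action P P') (M N : modcat P) (f : hom M N) :
    modhom (NUMod (new_act F M)) (NUMod (new_act F N)) :=
  @ModHom k B (NUMod (new_act F M)) (NUMod (new_act F N))
    (mhfun f) (mh_linear f) (new_act_hom F f).

Lemma same_space_map_id (k : fieldType) (A B : nualg k)
  (P : numod A -> Prop) (P' : numod B -> Prop)
  (F : change_of_action P P') (M : modcat P) :
  same_space_map F (idm M) = modhom_id (NUMod (new_act F M)).
Proof. exact: modhom_eq. Qed.

Lemma same_space_map_comp (k : fieldType) (A B : nualg k)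
  (P : numod A -> Prop) (P' : numod B -> Prop)
  (F : change_of_action P P') (M N L : modcat P)
  (g : hom N L) (f : hom M N) :
  same_space_map F (comp g f) =
  modhom_comp (same_space_map F g) (same_space_map F f).
Proof. exact: modhom_eq. Qed.

Definition same_space_functor (k : fieldType) (A B : nualg k)
    (P : numod A -> Prop) (P' : numod B -> Prop)
    (F : change_of_action P P') : functor (modcat P) (modcat P') :=
  @Functor (modcat P) (modcat P')
    (fun M => exist P' (NUMod (new_act F M)) (new_act_in F M))
    (same_space_map F) (same_space_map_id F) (same_space_map_comp F).

(** * Algebras given by generators and relations *)

Inductive nexpr (k G : Type) :=
| NGen of G
| NZero
| NAdd of nexpr k G & nexpr k G
| NScale of k & nexpr k G
| NMul of nexpr k G & nexpr k G.
Arguments NGen {k G} g.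
Arguments NZero {k G}.

Declare Scope nexpr_scope.
Delimit Scope nexpr_scope with nx.
Bind Scope nexpr_scope with nexpr.
Notation "0" := NZero : nexpr_scope.
Notation "x + y" := (NAdd x%nx y%nx) : nexpr_scope.
Notation "x * y" := (NMul x%nx y%nx) : nexpr_scope.
Notation "c *: x" := (NScale c%R x%nx) : nexpr_scope.
Notation "- x" := (NScale (- 1)%R x%nx) : nexpr_scope.
Notation "x - y" := (NAdd x%nx (NScale (- 1)%R y%nx)) : nexpr_scope.

Definition nrel (k G : Type) := nexpr k G -> nexpr k G -> Prop.

Local Open Scope nexpr_scope.

(* The k-algebra congruence generated by R. *)
Inductive ncong (k : fieldType) (G : Type)
    (R : nrel k G) : nrel k G :=
| nc_rel x y : R x y -> ncong R x y
| nc_refl x : ncong R x x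
| nc_sym x y : ncong R x y -> ncong R y x
| nc_trans x y z : ncong R x y -> ncong R y z -> ncong R x z
| nc_add x x' y y' :
    ncong R x x' -> ncong R y y' -> ncong R (x + y) (x' + y')
| nc_scale c x x' : ncong R x x' -> ncong R (c *: x) (c *: x')
| nc_mul x x' y y' :
    ncong R x x' -> ncong R y y' -> ncong R (x * y) (x' * y')
| nc_addA x y z : ncong R (x + (y + z)) (x + y + z)
| nc_addC x y : ncong R (x + y) (y + x)
| nc_add0 x : ncong R (0 + x) x
| nc_addN x : ncong R (- x + x) 0
| nc_scaleA c d x : ncong R (c *: (d *: x)) ((c * d) *: x)
| nc_scale1 x : ncong R (1 *: x) x
| nc_scaleDr c x y : ncong R (c *: (x + y)) (c *: x + c *: y)
| nc_scaleDl c d x : ncong R ((c + d) *: x) (c *: x + d *: x)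
| nc_mulA x y z : ncong R (x * (y * z)) (x * y * z)
| nc_mulDl x y z : ncong R ((x + y) * z) (x * z + y * z)
| nc_mulDr x y z : ncong R (x * (y + z)) (x * y + x * z)
| nc_mulZl c x y : ncong R ((c *: x) * y) (c *: (x * y))
| nc_mulZr c x y : ncong R (x * (c *: y)) (c *: (x * y)).

Local Close Scope nexpr_scope.

HB.instance Definition _ (k G : Type) := gen_eqMixin (nexpr k G).
HB.instance Definition _ (k G : Type) := gen_choiceMixin (nexpr k G).

Definition ncongb (k : fieldType) (G : Type)
    (R : nrel k G) : rel (nexpr k G) :=
  fun x y => `[< ncong R x y >].

Lemma ncongb_equiv (k : fieldType) (G : Type)
  (R : nrel k G) :
  equiv_class_of (ncongb R).
Proof.
split=> [x|x y|y x z].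
- by apply/asboolP; exact: nc_refl.
- by apply/asboolP/asboolP => /nc_sym.
- by move=> /asboolP xy /asboolP yz; apply/asboolP; exact: nc_trans xy yz.
Qed.

Canonical ncongb_equivRel (k : fieldType) (G : Type)
    (R : nrel k G) : equiv_rel (nexpr k G) :=
  EquivRelPack (ncongb_equiv R).

Definition presented (k : fieldType) (G : Type)
    (R : nrel k G) : Type :=
  {eq_quot (ncongb_equivRel R)}.

HB.instance Definition _ (k : fieldType) (G : Type)
    (R : nrel k G) :=
  Choice.on (presented R).

Definition cls (k : fieldType) (G : Type)
    (R : nrel k G) (x : nexpr k G) : presented R :=
  \pi_({eq_quot (ncongb_equivRel R)}) x.

Definition rep (k : fieldType) (G : Type)
    (R : nrel k G) (x : presented R) : nexpr k G :=
  generic_quotient.repr (x : {eq_quot (ncongb_equivRel R)}).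

Lemma repK (k : fieldType) (G : Type)
  (R : nrel k G) (x : presented R) :
  cls R (rep x) = x.
Proof. exact: reprK. Qed.

Lemma clsP (k : fieldType) (G : Type)
  (R : nrel k G) (x y : nexpr k G) :
  cls R x = cls R y <-> ncong R x y.
Proof.
split=> [/eqmodP/asboolP // | xy]; by apply/eqmodP/asboolP.
Qed.

Lemma rep_cls (k : fieldType) (G : Type)
  (R : nrel k G) (x : nexpr k G) :
  ncong R (rep (cls R x)) x.
Proof. by apply/clsP; rewrite repK. Qed.

Definition pzero (k : fieldType) (G : Type) (R : nrel k G) : presented R :=
  cls R 0%nx.
Definition padd (k : fieldType) (G : Type) (R : nrel k G)
    (x y : presented R) : presented R := cls R (rep x + rep y)%nx.
Definition popp (k : fieldType) (G : Type) (R : nrel k G)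
    (x : presented R) : presented R := cls R (- rep x)%nx.
Definition pscale (k : fieldType) (G : Type) (R : nrel k G)
    (c : k) (x : presented R) : presented R := cls R (c *: rep x)%nx.
Definition pmul (k : fieldType) (G : Type) (R : nrel k G)
    (x y : presented R) : presented R := cls R (rep x * rep y)%nx.

Lemma cls_add (k : fieldType) (G : Type) (R : nrel k G) (x y : nexpr k G) :
  padd (cls R x) (cls R y) = cls R (x + y)%nx.
Proof. by apply/clsP; apply: nc_add; exact: rep_cls. Qed.

Lemma cls_opp (k : fieldType) (G : Type) (R : nrel k G) (x : nexpr k G) :
  popp (cls R x) = cls R (- x)%nx.
Proof. by apply/clsP; apply: nc_scale; exact: rep_cls. Qed.

Lemma cls_scale (k : fieldType) (G : Type) (R : nrel k G) c (x : nexpr k G) :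
  pscale c (cls R x) = cls R (c *: x)%nx.
Proof. by apply/clsP; apply: nc_scale; exact: rep_cls. Qed.

Lemma cls_mul (k : fieldType) (G : Type) (R : nrel k G) (x y : nexpr k G) :
  pmul (cls R x) (cls R y) = cls R (x * y)%nx.
Proof. by apply/clsP; apply: nc_mul; exact: rep_cls. Qed.

Lemma paddA (k : fieldType) (G : Type) (R : nrel k G) :
  associative (@padd k G R).
Proof.
move=> x y z; rewrite -[x]repK -[y]repK -[z]repK !cls_add.
by apply/clsP; exact: nc_addA.
Qed.

Lemma paddC (k : fieldType) (G : Type) (R : nrel k G) :
  commutative (@padd k G R).
Proof.
by move=> x y; rewrite -[x]repK -[y]repK !cls_add; apply/clsP; exact: nc_addC.
Qed.

Lemma padd0 (k : fieldType) (G : Type) (R : nrel k G) :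
  left_id (@pzero k G R) (@padd k G R).
Proof. by move=> x; rewrite -[x]repK cls_add; apply/clsP; exact: nc_add0. Qed.

Lemma paddN (k : fieldType) (G : Type) (R : nrel k G) :
  left_inverse (@pzero k G R) (@popp k G R) (@padd k G R).
Proof.
by move=> x; rewrite -[x]repK cls_opp cls_add; apply/clsP; exact: nc_addN.
Qed.

HB.instance Definition _ (k : fieldType) (G : Type) (R : nrel k G) :=
  GRing.isZmodule.Build (presented R)
    (@paddA k G R) (@paddC k G R) (@padd0 k G R) (@paddN k G R).

Lemma pscaleA (k : fieldType) (G : Type) (R : nrel k G) (c d : k)
  (x : presented R) : pscale c (pscale d x) = pscale (c * d) x.
Proof. by rewrite -[x]repK !cls_scale; apply/clsP; exact: nc_scaleA. Qed.

Lemma pscale1 (k : fieldType) (G : Type) (R : nrel k G) :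
  left_id 1 (@pscale k G R).
Proof. by move=> x; rewrite -[x]repK cls_scale; apply/clsP; exact: nc_scale1. Qed.

Lemma pscaleDr (k : fieldType) (G : Type) (R : nrel k G) :
  right_distributive (@pscale k G R) +%R.
Proof.
move=> c x y; rewrite -[x]repK -[y]repK [_ + cls _ _]cls_add !cls_scale.
by rewrite [RHS]cls_add; apply/clsP; exact: nc_scaleDr.
Qed.

Lemma pscaleDl (k : fieldType) (G : Type) (R : nrel k G) (x : presented R) :
  {morph (@pscale k G R)^~ x : c d / c + d}.
Proof.
move=> c d; rewrite -[x]repK !cls_scale [RHS]cls_add.
by apply/clsP; exact: nc_scaleDl.
Qed.

HB.instance Definition _ (k : fieldType) (G : Type) (R : nrel k G) :=
  GRing.Zmodule_isLmodule.Build k (presented R)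
    (@pscaleA k G R) (@pscale1 k G R) (@pscaleDr k G R) (@pscaleDl k G R).

Lemma pmulA (k : fieldType) (G : Type) (R : nrel k G) (x y z : presented R) :
  pmul x (pmul y z) = pmul (pmul x y) z.
Proof.
rewrite -[x]repK -[y]repK -[z]repK !cls_mul.
by apply/clsP; exact: nc_mulA.
Qed.

Lemma pmulDl (k : fieldType) (G : Type) (R : nrel k G) (x y z : presented R) :
  pmul (x + y) z = pmul x z + pmul y z.
Proof.
rewrite -[x]repK -[y]repK -[z]repK [_ + _]cls_add !cls_mul [RHS]cls_add.
by apply/clsP; exact: nc_mulDl.
Qed.

Lemma pmulDr (k : fieldType) (G : Type) (R : nrel k G) (x y z : presented R) :
  pmul x (y + z) = pmul x y + pmul x z.
Proof.
rewrite -[x]repK -[y]repK -[z]repK [cls R (rep y) + _]cls_add !cls_mul.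
by rewrite [RHS]cls_add; apply/clsP; exact: nc_mulDr.
Qed.

Lemma pmulZl (k : fieldType) (G : Type) (R : nrel k G) (c : k)
  (x y : presented R) : pmul (c *: x) y = c *: pmul x y.
Proof.
rewrite -[x]repK -[y]repK [_ *: _]cls_scale !cls_mul [RHS]cls_scale.
by apply/clsP; exact: nc_mulZl.
Qed.

Lemma pmulZr (k : fieldType) (G : Type) (R : nrel k G) (c : k)
  (x y : presented R) : pmul x (c *: y) = c *: pmul x y.
Proof.
rewrite -[x]repK -[y]repK [c *: cls R (rep y)]cls_scale !cls_mul.
by rewrite [RHS]cls_scale; apply/clsP; exact: nc_mulZr.
Qed.

(* The possibly non-unitary k-algebra with generators G and relations R. *)
Definition presented_alg (k : fieldType) (G : Type) (R : nrel k G) : nualg k :=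
  @NUAlg k (presented R) (@pmul k G R) (@pmulA k G R) (@pmulDl k G R)
    (@pmulDr k G R) (@pmulZl k G R) (@pmulZr k G R).

Definition gen (k : fieldType) (G : Type) (R : nrel k G) (g : G) :
    presented_alg R := cls R (NGen g).

(* Unitary algebras: the unit is the extra generator None. *)
Inductive unital_rel (k : fieldType) (G : Type) (R : nrel k (option G)) :
    nrel k (option G) :=
| unital_given x y : R x y -> unital_rel R x y
| unital_l g : unital_rel R (NGen None * NGen g)%nx (NGen g)
| unital_r g : unital_rel R (NGen g * NGen None)%nx (NGen g).

Definition unital_alg (k : fieldType) (G : Type) (R : nrel k (option G)) :
    nualg k := presented_alg (unital_rel R).

Definition one_alg (k : fieldType) (G : Type) (R : nrel k (option G)) :
    unital_alg R := gen (unital_rel R) None.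

Definition ugen (k : fieldType) (G : Type) (R : nrel k (option G)) (g : G) :
    unital_alg R := gen (unital_rel R) (Some g).

Lemma presented_ind (k : fieldType) (G : Type) (R : nrel k G)
  (P : presented_alg R -> Prop) :
  (forall g, P (gen R g)) -> P 0 -> (forall x y, P x -> P y -> P (x + y)) ->
  (forall c x, P x -> P (c *: x)) ->
  (forall x y, P x -> P y -> P (numul x y)) -> forall x, P x.
Proof.
move=> Pg P0 PD PZ PM x; rewrite -[x]repK.
elim: (rep x) => {x} [//|//|x Px y Py|c x Px|x Px y Py].
- by have := PD _ _ Px Py; rewrite [_ + _]cls_add.
- by have := PZ c _ Px; rewrite [_ *: _]cls_scale.
- by have := PM _ _ Px Py; rewrite [numul _ _]cls_mul.
Qed.

Lemma one_algP (k : fieldType) (G : Type) (R : nrel k (option G))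
  (a : unital_alg R) :
  numul (one_alg R) a = a /\ numul a (one_alg R) = a.
Proof.
elim/presented_ind: a => [g||x y [lx rx] [ly ry]|c x [lx rx]|x y [lx _] [_ ry]].
- split; rewrite [LHS]cls_mul; apply/clsP/nc_rel.
  + exact: unital_l.
  + exact: unital_r.
- by rewrite -[0](scale0r (one_alg R)) numulZl numulZr !scale0r.
- by rewrite numulDl numulDr lx rx ly ry.
- by rewrite numulZl numulZr lx rx.
- by rewrite numulA lx -numulA ry.
Qed.

(** * Positions *)

(* For i in {0, ..., n-2}, the positions i and i+1 in {0, ..., n-1}. *)
Definition pos0 (n : nat) (i : 'I_n.-1) : 'I_n := widen_ord (leq_pred n) i.

Lemma pos1_proof (n : nat) (i : 'I_n.-1) : (i.+1 < n)%N.
Proof. by rewrite -ltn_predRL. Qed.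

Definition pos1 (n : nat) (i : 'I_n.-1) : 'I_n := Ordinal (pos1_proof i).

Definition spos (n : nat) (i : 'I_n.-1) (a : 'I_n) : 'I_n :=
  tperm (pos0 i) (pos1 i) a.

Definition sact (n : nat) (V : Type) (i : 'I_n.-1) (nu : {ffun 'I_n -> V}) :
    {ffun 'I_n -> V} := [ffun a => nu (spos i a)].

(** * The algebra H_n(Q) *)

(* P(u,v) is an element of k[u,v], with u and v the variables 0 and 1. *)
Definition eval2 (k : fieldType) (n : nat) (P : {mpoly k[2]})
    (u v : {mpoly k[n]}) : {mpoly k[n]} := P \mPo [tuple u; v].

Inductive klr_gen (n : nat) (V : Type) :=
| KE of {ffun 'I_n -> V}
| KX of 'I_n & {ffun 'I_n -> V}
| KT of 'I_n.-1 & {ffun 'I_n -> V}.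

(* The monomial in the x_{a,nu} with exponents m; it is 1_nu for m = 0. *)
Definition klr_mon (k : fieldType) (n : nat) (V : Type)
    (nu : {ffun 'I_n -> V}) (m : 'X_{1..n}) : nexpr k (klr_gen n V) :=
  foldr (fun a e => iter (m a) (NMul (NGen (KX a nu))) e)
    (NGen (KE nu)) (enum 'I_n).

(* f(x_{1,nu}, ..., x_{n,nu}), in the algebra with unit 1_nu. *)
Definition klr_poly (k : fieldType) (n : nat) (V : Type)
    (nu : {ffun 'I_n -> V}) (f : {mpoly k[n]}) : nexpr k (klr_gen n V) :=
  foldr (fun m e => (f@_m *: klr_mon k nu m + e)%nx) 0%nx (msupp f).


Inductive klr_rel (k : fieldType) (n : nat) (V : choiceType)
    (Q : V -> V -> {mpoly k[2]}) : nrel k (klr_gen n V) :=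
| klr_idem nu nu' :
    klr_rel Q (NGen (KE nu) * NGen (KE nu'))%nx
      (if nu == nu' then NGen (KE nu) else 0%nx)
| klr_tau_idem i nu :
    klr_rel Q (NGen (KT i nu))
      (NGen (KE (sact i nu)) * NGen (KT i nu) * NGen (KE nu))%nx
| klr_x_idem a nu :
    klr_rel Q (NGen (KX a nu)) (NGen (KE nu) * NGen (KX a nu) * NGen (KE nu))%nx
| klr_xx a b nu :
    klr_rel Q (NGen (KX a nu) * NGen (KX b nu))%nx
      (NGen (KX b nu) * NGen (KX a nu))%nx
| klr_tau_sq i (nu : {ffun 'I_n -> V}) :
    klr_rel Q (NGen (KT i (sact i nu)) * NGen (KT i nu))%nx
      (klr_poly nu (eval2 (Q (nu (pos0 i)) (nu (pos1 i)))
                      'X_(pos0 i) 'X_(pos1 i)))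
| klr_tau_far (i j : 'I_n.-1) nu :
    (i.+1 < j)%N || (j.+1 < i)%N ->
    klr_rel Q (NGen (KT i (sact j nu)) * NGen (KT j nu))%nx
      (NGen (KT j (sact i nu)) * NGen (KT i nu))%nx
(* D is the polynomial (x_{i+2}-x_i)^{-1}(Q(x_{i+2},x_{i+1})-Q(x_i,x_{i+1})). *)
| klr_braid (i j : 'I_n.-1) (nu : {ffun 'I_n -> V}) (D : {mpoly k[n]}) :
    j = i.+1 :> nat ->
    ('X_(pos1 j) - 'X_(pos0 i)) * D =
      eval2 (Q (nu (pos0 i)) (nu (pos1 i))) 'X_(pos1 j) 'X_(pos1 i)
      - eval2 (Q (nu (pos0 i)) (nu (pos1 i))) 'X_(pos0 i) 'X_(pos1 i) ->
    klr_rel Q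
      (NGen (KT j (sact i (sact j nu))) * NGen (KT i (sact j nu))
         * NGen (KT j nu)
       - NGen (KT i (sact j (sact i nu))) * NGen (KT j (sact i nu))
           * NGen (KT i nu))%nx
      (if nu (pos0 i) == nu (pos1 j) then klr_poly nu D else 0%nx)
| klr_tau_x i a (nu : {ffun 'I_n -> V}) :
    klr_rel Q
      (NGen (KT i nu) * NGen (KX a nu)
       - NGen (KX (spos i a) (sact i nu)) * NGen (KT i nu))%nx
      (if nu (pos0 i) == nu (pos1 i) then
         if a == pos0 i then (- NGen (KE nu))%nx
         else if a == pos1 i then NGen (KE nu) else 0%nx
       else 0%nx).

Definition klr_alg (k : fieldType) (n : nat) (V : choiceType)
    (Q : V -> V -> {mpoly k[2]}) : nualg k := presented_alg (klr_rel (n := n) Q).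

(** * The quiver Gamma = I_q and the algebra H_n(Gamma) *)

Definition vert (k : fieldType) (I : {pred k}) : Type := {i : k | i \in I}.

HB.instance Definition _ (k : fieldType) (I : {pred k}) := Choice.on (vert I).

(* The number of arrows i -> j, for i != j. *)
Definition arrows (k : fieldType) (q : k) (I : {pred k}) (i j : vert I) : nat :=
  (val j == q * val i).

Definition Ppoly (k : fieldType) (q : k) (I : {pred k}) (i j : vert I) :
    {mpoly k[2]} := ('X_ord_max - 'X_ord0) ^+ arrows q i j.

Definition Qpoly (k : fieldType) (q : k) (I : {pred k}) (i j : vert I) :
    {mpoly k[2]} :=
  if i == j then 0
  else eval2 (Ppoly q i j) 'X_ord0 'X_ord_max
       * eval2 (Ppoly q j i) 'X_ord_max 'X_ord0.

Definition Hgamma (k : fieldType) (q : k) (I : {pred k}) (n : nat) : nualg k :=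
  klr_alg n (@Qpoly k q I).

Definition idem (k : fieldType) (q : k) (I : {pred k}) (n : nat)
    (nu : {ffun 'I_n -> vert I}) : Hgamma q I n :=
  gen (klr_rel (@Qpoly k q I)) (KE nu).

Definition xgen (k : fieldType) (q : k) (I : {pred k}) (n : nat) (a : 'I_n)
    (nu : {ffun 'I_n -> vert I}) : Hgamma q I n :=
  gen (klr_rel (@Qpoly k q I)) (KX a nu).

Definition taugen (k : fieldType) (q : k) (I : {pred k}) (n : nat)
    (i : 'I_n.-1) (nu : {ffun 'I_n -> vert I}) : Hgamma q I n :=
  gen (klr_rel (@Qpoly k q I)) (KT i nu).

(** * The affine Hecke algebra *)

Inductive hecke_gen (n : nat) :=
| HX of 'I_n
| HXinv of 'I_n
| HT of 'I_n.-1.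

Inductive hecke_rel (k : fieldType) (q : k) (n : nat) :
    nrel k (option (hecke_gen n)) :=
| hecke_XV a :
    hecke_rel q (NGen (Some (HX a)) * NGen (Some (HXinv a)))%nx (NGen None)
| hecke_VX a :
    hecke_rel q (NGen (Some (HXinv a)) * NGen (Some (HX a)))%nx (NGen None)
| hecke_XX a b :
    hecke_rel q (NGen (Some (HX a)) * NGen (Some (HX b)))%nx
      (NGen (Some (HX b)) * NGen (Some (HX a)))%nx
| hecke_braid (i j : 'I_n.-1) :
    j = i.+1 :> nat ->
    hecke_rel q
      (NGen (Some (HT i)) * NGen (Some (HT j)) * NGen (Some (HT i)))%nx
      (NGen (Some (HT j)) * NGen (Some (HT i)) * NGen (Some (HT j)))%nx
| hecke_far (i j : 'I_n.-1) :
    (i.+1 < j)%N || (j.+1 < i)%N ->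
    hecke_rel q (NGen (Some (HT i)) * NGen (Some (HT j)))%nx
      (NGen (Some (HT j)) * NGen (Some (HT i)))%nx
| hecke_quad i :
    hecke_rel q
      ((NGen (Some (HT i)) - q *: NGen None)
       * (NGen (Some (HT i)) + NGen None))%nx 0%nx
| hecke_TX_far i a :
    a != pos0 i -> a != pos1 i ->
    hecke_rel q (NGen (Some (HT i)) * NGen (Some (HX a)))%nx
      (NGen (Some (HX a)) * NGen (Some (HT i)))%nx
| hecke_TX i :
    hecke_rel q
      (NGen (Some (HT i)) * NGen (Some (HX (pos1 i)))
       - NGen (Some (HX (pos0 i))) * NGen (Some (HT i)))%nx
      ((q - 1) *: NGen (Some (HX (pos1 i))))%nx.

Definition hecke (k : fieldType) (q : k) (n : nat) : nualg k :=
  unital_alg (@hecke_rel k q n).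

Definition Xgen (k : fieldType) (q : k) (n : nat) (a : 'I_n) : hecke q n :=
  ugen (@hecke_rel k q n) (HX a).

Definition Tgen (k : fieldType) (q : k) (n : nat) (i : 'I_n.-1) : hecke q n :=
  ugen (@hecke_rel k q n) (HT i).

(** * The module categories *)

(* V is the internal direct sum of the family W. *)
Definition direct_sum (k : fieldType) (V : lmodType k) (L : choiceType)
    (W : L -> V -> Prop) : Prop :=
  (forall v : V, exists (s : seq L) (w : L -> V),
     [/\ uniq s, forall l, W l (w l) & v = \sum_(l <- s) w l]) /\
  (forall (s : seq L) (w : L -> V), uniq s -> (forall l, W l (w l)) ->
     \sum_(l <- s) w l = 0 -> forall l, l \in s -> w l = 0).

Definition block (k : fieldType) (q : k) (I : {pred k}) (n : nat)
    (V : lmodType k) (M : action (Hgamma q I n) V)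
    (nu : {ffun 'I_n -> vert I}) (v : V) : Prop :=
  exists w : V, v = M (idem q nu) w.

Definition Mod0_pred (k : fieldType) (q : k) (I : {pred k}) (n : nat)
    (M : numod (Hgamma q I n)) : Prop :=
  direct_sum (block (mact M)) /\
  forall (nu : {ffun 'I_n -> vert I}) (a : 'I_n) (v : M),
    block (mact M) nu v ->
    exists N : nat, iter N (mact M (xgen q a nu)) v = 0.

Definition Mod0 (k : fieldType) (q : k) (I : {pred k}) (n : nat) : category :=
  modcat (@Mod0_pred k q I n).

(* f(X_1, ..., X_n) applied to v, for commuting operators X_1, ..., X_n. *)
Definition poly_act (k : fieldType) (n : nat) (V : lmodType k)
    (X : 'I_n -> V -> V) (f : {mpoly k[n]}) (v : V) : V :=
  \sum_(m <- msupp f)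
    f@_m *: foldr (fun a w => iter (m a) (X a) w) v (enum 'I_n).

Record prime_ideal (R : comNzRingType) (P : R -> Prop) : Prop := PrimeIdeal {
  pi_zero : P 0;
  pi_add : forall a b, P a -> P b -> P (a + b);
  pi_mul : forall a b, P b -> P (a * b);
  pi_proper : ~ P 1;
  pi_prime : forall a b, P (a * b) -> P a \/ P b }.

(* The point P of the affine space Spec k[X_1, ..., X_n] lies in the support of
   v: the image of v in the localization at P is nonzero. *)
Definition in_support (k : fieldType) (n : nat) (V : lmodType k)
    (X : 'I_n -> V -> V) (v : V) (P : {mpoly k[n]} -> Prop) : Prop :=
  prime_ideal P /\ forall s, ~ P s -> poly_act X s v <> 0.

Definition closed_point (k : fieldType) (n : nat) (a : 'I_n -> k)
    (f : {mpoly k[n]}) : Prop := f.@[a] = 0.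

(* The subspace M_a. *)
Definition supported_at (k : fieldType) (q : k) (n : nat) (V : lmodType k)
    (M : action (hecke q n) V) (a : 'I_n -> k) (v : V) : Prop :=
  forall P, in_support (fun i => M (Xgen q i)) v P ->
    forall f, P f <-> closed_point a f.

Definition CGamma_pred (k : fieldType) (q : k) (I : {pred k}) (n : nat)
    (M : numod (hecke q n)) : Prop :=
  (forall v : M, mact M (one_alg (@hecke_rel k q n)) v = v) /\
  direct_sum (fun (a : {ffun 'I_n -> vert I}) =>
    supported_at (mact M) (fun i => val (a i))).

Definition CGamma (k : fieldType) (q : k) (I : {pred k}) (n : nat) : category :=
  modcat (@CGamma_pred k q I n).

(** * The formulas for X_i and T_i *)

(* u = f^{-1}(w), where f is a bijection of the subspace W. *)
Definition is_inverse_image (V : Type) (W : V -> Prop) (f : V -> V)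
    (w u : V) : Prop :=
  [/\ W u, f u = w & forall u', W u' -> f u' = w -> u' = u].

(* y_a = x_a + 1 on 1_nu M. *)
Definition yact (k : fieldType) (q : k) (I : {pred k}) (n : nat)
    (V : lmodType k) (M : action (Hgamma q I n) V)
    (nu : {ffun 'I_n -> vert I}) (a : 'I_n) (v : V) : V :=
  M (xgen q a nu) v + v.

Definition X_formula (k : fieldType) (q : k) (I : {pred k}) (n : nat)
    (V : lmodType k) (M : action (Hgamma q I n) V) (N : action (hecke q n) V) :
    Prop :=
  forall (nu : {ffun 'I_n -> vert I}) (a : 'I_n) (v : V), block M nu v ->
    N (Xgen q a) v = val (nu a) *: yact M nu a v.

(* The formulas determine 1_nu T_i: the functions of y_i and y_{i+1} are
   applied after tau_i, hence on 1_nu M, and tau_i there is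
   1_nu tau_i = tau_{i, s_i(nu)}. In the case nu_{i+1} = q nu_i, tau_i comes
   with the sign that makes (T_i - q)(T_i + 1) = 0 compatible with
   tau_{i, s_i(nu)} tau_{i, nu} = x_{i+1, nu} - x_{i, nu}. *)
Definition T_formula (k : fieldType) (q : k) (I : {pred k}) (n : nat)
    (V : lmodType k) (M : action (Hgamma q I n) V) (N : action (hecke q n) V) :
    Prop :=
  forall (nu : {ffun 'I_n -> vert I}) (i : 'I_n.-1) (v : V),
    let c := val (nu (pos0 i)) in
    let d := val (nu (pos1 i)) in
    let y := yact M nu (pos0 i) in
    let y' := yact M nu (pos1 i) in
    let v_nu := M (idem q nu) v in
    let tau_v := M (taugen q i (sact i nu)) v in
    let Tv_nu := M (idem q nu) (N (Tgen q i) v) in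
    if c == d then
      Tv_nu = q *: y tau_v - y' tau_v + q *: v_nu
    else if d == q * c then
      is_inverse_image (block M nu) (fun u => q^-1 *: y u - y' u)
        (- tau_v + (1 - q) *: y' v_nu) Tv_nu
    else
      is_inverse_image (block M nu) (fun u => c *: y u - d *: y' u)
        ((q * c) *: y tau_v - d *: y' tau_v + ((1 - q) * d) *: y' v_nu) Tv_nu.

(* Main.v *)
From HB Require Import structures.
Require Import Defs.
From mathcomp Require Import all_boot all_order all_algebra.
From mathcomp Require Import fraction perm generic_quotient ssrAC.
From mathcomp Require Import boolp classical_sets ssrcomplements mpoly ring zify.

Set Implicit Arguments.
Unset Strict Implicit.
Unset Printing Implicit Defensive.

Import GRing.Theory.
Local Open Scope ring_scope.

(** The objects of both categories are vector spaces graded by weights [nu] in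
    [I^n]: the weight space is [1_nu M] on one side and the generalized common
    eigenspace [M_nu] of the [X_a] on the other. The rule
    [X_a = nu_a (x_a + 1)] exchanges commuting [X_a] with generalized
    eigenvalue [nu_a <> 0] and commuting locally nilpotent [x_a].

    Let [A] be the ring of functions on [I^n] with values in the local ring at
    the origin of [k[x_1, ..., x_n]]. Since the [x_a] are locally nilpotent,
    [A] acts on every such space: a denominator that does not vanish at the
    origin acts invertibly. All the fractions in the formula for [T_i] lie in
    [A], and the formula reads [T_i = alpha_i tau_i + beta_i], where [alpha_i]
    is invertible in [A] because of the case distinction and [q <> 1]. So
    [tau_i] and [T_i] determine each other, and only the relations are at
    stake.

    The relations of [H_n(Gamma)] between [tau_i] and the [x_a] make [tau_i] a
    twisted derivation over [A] ([weight_twisted]):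
    [tau_i f = s_i(f) tau_i + d_i(f)], where [s_i] permutes weights and
    variables, and [d_i] is a divided difference at the weights fixed by [s_i]
    and zero elsewhere. For any such operators, expanding products of the
    [alpha_i tau_i + beta_i] shows that the quadratic, distant and braid
    relations for the [T_i] differ from the corresponding relations for the
    [tau_i] by an invertible element of [A] ([hecke_op_square],
    [hecke_op_far], [hecke_op_braid]). The coefficients are compared pointwise,
    as rational functions ([quadratic_coef_tau] to [braid_coef_const]). These
    equivalences are used in both directions.

    The direction from the Hecke algebra needs moreover that
    [tau_i = alpha_i^{-1} (T_i - beta_i)] maps the weight space of [nu] to that
    of [s_i nu]. By the commutation relation, [T_i] commutes with
    [X_i + X_{i+1}], [X_i X_{i+1}] and the other [X_a], so it relates the
    weight [nu] at most to [nu] and [s_i nu] ([hecke_T_blocks]); if these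
    differ, the diagonal block of [T_i] is [beta_i] ([hecke_T_diagonal]).

    The definition of the category of Hecke modules speaks of supports. A
    vector is supported at the closed point [a] if and only if it is killed by
    powers of all the [X_i - a_i] ([supported_nilpotent]), which gives the
    weight spaces above. The two constructions change neither spaces nor maps
    and undo each other ([klr_round_trip], [hecke_round_trip]), so the identity
    maps are natural isomorphisms. *)

(** * The rational functions in the formula for T_i *)

Section Coefficients.

Variables (F : fieldType) (q : F).
Implicit Types c d y z : F.

(** The coefficient of [tau_i] in [T_i] on a weight with entries [c] and [d] at
    [i] and [i + 1]; [y] and [z] stand for [x_i + 1] and [x_{i+1} + 1]. *)
Definition alpha (c d y z : F) : F :=
  if c == d then q * y - z
  else if d == q * c then - (q^-1 * y - z)^-1
  else (q * c * y - d * z) / (c * y - d * z).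

(** The term of [T_i] without [tau_i]. *)
Definition beta (c d y z : F) : F :=
  if c == d then q else (1 - q) * d * z / (c * y - d * z).

(** The value of [Q_{cd}] at [x_i], [x_{i+1}]; it depends on [y - z] only. *)
Definition quiverQ (c d y z : F) : F :=
  if c == d then 0 else (z - y) ^+ (d == q * c) * (y - z) ^+ (c == q * d).

(** The operator [d_i] at one weight: [b] says whether [s_i] fixes the weight. *)
Definition divdiff (b : bool) (f' f x : F) : F := if b then (f' - f) / x else 0.

Hypothesis q0 : q != 0.

(** If [d = q c], the numerator [q c y - d z] of the generic formula is
    [d (y - z)]; dropping [- (y - z)] from it leaves this [alpha]. The dropped
    factor is found again in [quiverQ]. *)
Lemma alpha_arrow c d y z : c != 0 -> c != d -> d = q * c ->
  alpha c d y z = - (q * c) / (c * y - d * z).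
Proof.
move=> c0 cd dE; rewrite /alpha (negPf cd) dE eqxx mulNr; congr (- _).
have -> : c * y - q * c * z = q * c * (q^-1 * y - z) by field.
by rewrite invfM mulrA divff ?mul1r ?mulf_neq0.
Qed.

(** The constant term of [(T_i - q) (T_i + 1) = 0] at a weight not fixed by
    [s_i], in view of [tau_i tau_i = Q]. The factors on the left depend on the
    arrows between [c] and [d] while the right-hand side does not; this is what
    keeps the number of cases in [braid_coef_const] small. *)
Lemma alpha_sym_quiverQ c d y z : c != 0 -> d != 0 -> c != d ->
  c * y - d * z != 0 -> d * z - c * y != 0 ->
  alpha c d y z * alpha d c z y * quiverQ c d y z =
  - (beta c d y z - q) * (beta c d y z + 1).
Proof.
move=> c0 d0 cd s0 s0'; have dc : d != c by rewrite eq_sym.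
have [dE|dq] := eqVneq d (q * c); have [cE|cq] := eqVneq c (q * d).
(* Arrows both ways: [d = q c] and [c = q d] force [q^2 = 1], and [q <> 1]
   because [c <> d]. *)
- have q1 : q = -1.
    have E : c = q * (q * c) by rewrite -dE.
    have /eqP : (q - 1) * (q + 1) = 0.
      apply: (mulIf c0); rewrite mul0r.
      have -> : (q - 1) * (q + 1) * c = q * (q * c) - c by ring.
      by rewrite -E subrr.
    rewrite mulf_eq0 subr_eq0 addr_eq0 => /orP[/eqP q1|/eqP //].
    by move: cd; rewrite dE q1 mul1r eqxx.
  rewrite !alpha_arrow // /beta /quiverQ (negPf cd) -cE -dE !eqxx.
  rewrite dE q1 in s0 s0' *.
  by field; rewrite s0.
- rewrite alpha_arrow // /alpha /beta /quiverQ (negPf cd) (negPf dc) (negPf cq).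
  rewrite dE eqxx in s0 s0' *.
  by field; rewrite s0.
- rewrite [alpha d c _ _]alpha_arrow // /alpha /beta /quiverQ (negPf cd) (negPf dq).
  rewrite cE eqxx in s0 s0' *.
  by field; rewrite s0.
- rewrite /alpha /beta /quiverQ (negPf cd) (negPf dc) (negPf dq) (negPf cq).
  by field; rewrite s0.
Qed.

Lemma subr_neq0C (x y : F) : x - y != 0 -> y - x != 0.
Proof. by rewrite -oppr_eq0 opprB. Qed.

Lemma alpha_eq c y z : alpha c c y z = q * y - z.
Proof. by rewrite /alpha eqxx. Qed.

Lemma beta_eq c y z : beta c c y z = q.
Proof. by rewrite /beta eqxx. Qed.

Lemma beta_neq c d y z : c != d ->
  beta c d y z = (1 - q) * d * z / (c * y - d * z).
Proof. by rewrite /beta => /negPf ->. Qed.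

Lemma quiverQ_eq c y z : quiverQ c c y z = 0.
Proof. by rewrite /quiverQ eqxx. Qed.

Lemma alpha_arrowK c d y z : c != d -> d = q * c -> q^-1 * y - z != 0 ->
  (q^-1 * y - z) * alpha c d y z = -1.
Proof. by move=> cd dE s; rewrite /alpha (negPf cd) dE eqxx mulrN divff. Qed.

Lemma beta_arrowK c d y z : c != 0 -> c != d -> d = q * c ->
  q^-1 * y - z != 0 -> (q^-1 * y - z) * beta c d y z = (1 - q) * z.
Proof.
move=> c0 cd dE s; rewrite beta_neq // dE.
have -> : c * y - q * c * z = (q^-1 * y - z) * (q * c) by field.
by move: (q^-1 * y - z) s => s s0; field; rewrite s0 c0 q0.
Qed.

Lemma alpha_genericK c d y z : c != d -> d != q * c -> c * y - d * z != 0 ->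
  (c * y - d * z) * alpha c d y z = q * c * y - d * z.
Proof.
by move=> cd dq s; rewrite /alpha (negPf cd) (negPf dq) mulrC divfK.
Qed.

Lemma betaK c d y z : c != d -> c * y - d * z != 0 ->
  (c * y - d * z) * beta c d y z = (1 - q) * d * z.
Proof. by move=> cd s; rewrite beta_neq // mulrC divfK. Qed.

(** Together with [quadratic_coef_const], the coefficients of [tau_i] and of 1
    in [(T_i - q) (T_i + 1)]. *)
Lemma quadratic_coef_tau c d y z : y - z != 0 ->
  (c != d -> c * y - d * z != 0) ->
  divdiff (c == d) (alpha d c z y) (alpha c d y z) (y - z) +
  (beta d c z y + beta c d y z) - (q - 1) = 0.
Proof.
move=> yz; rewrite /divdiff; have [->|cd] := eqVneq c d => [_|/(_ isT) s].
  by rewrite !alpha_eq !beta_eq; field.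
have s' := subr_neq0C s; have dc : d != c by rewrite eq_sym.
by rewrite !(beta_neq _ _ cd, beta_neq _ _ dc); field; rewrite s s'.
Qed.

Lemma quadratic_coef_const c d y z : c != 0 -> d != 0 ->
  (c != d -> c * y - d * z != 0) ->
  alpha c d y z * divdiff (c == d) (beta d c z y) (beta c d y z) (y - z) +
  beta c d y z * beta c d y z =
  (q - 1) * beta c d y z + q - alpha c d y z * alpha d c z y * quiverQ c d y z.
Proof.
move=> c0 d0; rewrite /divdiff; have [->|cd] := eqVneq c d => [_|/(_ isT) s].
  by rewrite quiverQ_eq !beta_eq subrr mul0r; ring.
by rewrite alpha_sym_quiverQ ?(subr_neq0C s) //; ring.
Qed.

Lemma alpha_beta_commutator c d y z : y - z != 0 ->
  (c != d -> c * y - d * z != 0) ->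
  alpha c d y z * divdiff (c == d) (c * y) (d * z) (y - z) +
  beta c d y z * (d * z - c * y) = (q - 1) * (d * z).
Proof.
move=> yz; rewrite /divdiff; have [->|cd] := eqVneq c d => [_|/(_ isT) s].
  by rewrite alpha_eq beta_eq; field.
by rewrite mulr0 add0r (beta_neq _ _ cd); field.
Qed.

Lemma quiverQC c d y z : quiverQ c d y z = quiverQ d c z y.
Proof. by rewrite /quiverQ eq_sym mulrC. Qed.

(** The coincidences among the three entries of the weight at [i], [i + 1] and
    [i + 2] decide which divided differences vanish. *)
Variant equality_pattern : F -> F -> F -> Prop :=
| PatternCCC c : equality_pattern c c c
| PatternCCD c d of c != d & d != c : equality_pattern c c d
| PatternCDD c d of c != d & d != c : equality_pattern c d d
| PatternCDC c d of c != d & d != c : equality_pattern c d c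
| PatternCDE c d e of c != d & d != c & c != e & e != c & d != e & e != d :
    equality_pattern c d e.

Lemma equality_patternP c1 c2 c3 : equality_pattern c1 c2 c3.
Proof.
have [->|n12] := eqVneq c1 c2.
  have [->|n23] := eqVneq c2 c3; first exact: PatternCCC.
  by apply: PatternCCD; rewrite // eq_sym.
have [<-|n23] := eqVneq c2 c3; first by apply: PatternCDD; rewrite // eq_sym.
have [<-|n13] := eqVneq c1 c3; first by apply: PatternCDC; rewrite // eq_sym.
by apply: PatternCDE; rewrite // eq_sym.
Qed.

Section ThreePositions.

Variables c1 c2 c3 y1 y2 y3 : F.
Hypotheses (c1_neq0 : c1 != 0) (c2_neq0 : c2 != 0) (c3_neq0 : c3 != 0).
Hypotheses (y12 : y1 - y2 != 0) (y13 : y1 - y3 != 0) (y23 : y2 - y3 != 0).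
Hypotheses (s12 : c1 != c2 -> c1 * y1 - c2 * y2 != 0).
Hypotheses (s13 : c1 != c3 -> c1 * y1 - c3 * y3 != 0).
Hypotheses (s23 : c2 != c3 -> c2 * y2 - c3 * y3 != 0).

Local Notation a12 := (alpha c1 c2 y1 y2).
Local Notation a21 := (alpha c2 c1 y2 y1).
Local Notation a13 := (alpha c1 c3 y1 y3).
Local Notation a23 := (alpha c2 c3 y2 y3).
Local Notation a32 := (alpha c3 c2 y3 y2).
Local Notation b12 := (beta c1 c2 y1 y2).
Local Notation b21 := (beta c2 c1 y2 y1).
Local Notation b13 := (beta c1 c3 y1 y3).
Local Notation b23 := (beta c2 c3 y2 y3).
Local Notation b32 := (beta c3 c2 y3 y2).
Local Notation d12 f' f := (divdiff (c1 == c2) f' f (y1 - y2)).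
Local Notation d13 f' f := (divdiff (c1 == c3) f' f (y1 - y3)).
Local Notation d23 f' f := (divdiff (c2 == c3) f' f (y2 - y3)).

(** In the expansion of [T_1 T_2 T_1 - T_2 T_1 T_2] the coefficients of
    [tau_1 tau_2] and [tau_2 tau_1] vanish at sight. Those of [tau_1], [tau_2]
    and 1 are the next three lemmas; with [s1r] standing for [s_1(r)], and so
    on, no permutation is left in them and they are identities in a field. *)
Lemma braid_coef_tau1 (r := a23 * d23 a13 a12 + b23 * a12)
    (s1r := a13 * d13 a23 a21 + b13 * a21)
    (s1w := a13 * d13 b23 b21 + b13 * b21) :
  a12 * d12 s1r r + a12 * s1w + b12 * r =
  a23 * d23 (a13 * b12) (a12 * b13) + b23 * (a12 * b13).
Proof.
rewrite {}/s1w {}/s1r {}/r.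
move: c1_neq0 c2_neq0 c3_neq0 s12 s13 s23.
case: (equality_patternP c1 c2 c3)
  => [c|c d cd dc|c d cd dc|c d cd dc|c d e cd dc ce ec de ed] c0 d0 e0.
- move=> _ _ _; rewrite /divdiff !eqxx !alpha_eq !beta_eq.
  by field; rewrite y12 y13 y23.
- move=> _ /(_ cd) z13 /(_ cd) z23.
  have [z31 z32] := (subr_neq0C z13, subr_neq0C z23).
  rewrite /divdiff eqxx (negPf cd) !alpha_eq !beta_eq !(beta_neq _ _ cd, beta_neq _ _ dc).
  by field; rewrite ?y12 ?z13 ?z23 ?z31 ?z32.
- move=> /(_ cd) z12 /(_ cd) z13 _.
  have [z21 z31] := (subr_neq0C z12, subr_neq0C z13).
  rewrite /divdiff eqxx (negPf cd) !alpha_eq !beta_eq !(beta_neq _ _ cd, beta_neq _ _ dc).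
  by field; rewrite ?y23 ?z12 ?z13 ?z21 ?z31.
- move=> /(_ cd) z12 _ /(_ dc) z23.
  have [z21 z32] := (subr_neq0C z12, subr_neq0C z23).
  rewrite /divdiff eqxx (negPf cd) (negPf dc) !alpha_eq !beta_eq !(beta_neq _ _ cd, beta_neq _ _ dc).
  by field; rewrite ?y13 ?z12 ?z23 ?z21 ?z32.
- move=> /(_ cd) z12 /(_ ce) z13 /(_ de) z23.
  have [[z21 z31] z32] := (subr_neq0C z12, subr_neq0C z13, subr_neq0C z23).
  rewrite /divdiff (negPf cd) (negPf ce) (negPf de).
  rewrite !(beta_neq _ _ cd, beta_neq _ _ dc, beta_neq _ _ ce, beta_neq _ _ de, beta_neq _ _ ed).
  by field; rewrite ?z12 ?z13 ?z23 ?z21 ?z31 ?z32.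
Qed.

Lemma braid_coef_tau2 (r := a12 * d12 a13 a23 + b12 * a23)
    (s2r := a13 * d13 a12 a32 + b13 * a32)
    (s2w := a13 * d13 b12 b32 + b13 * b32) :
  a12 * d12 (a13 * b23) (a23 * b13) + b12 * (a23 * b13) =
  a23 * d23 s2r r + a23 * s2w + b23 * r.
Proof.
rewrite {}/s2w {}/s2r {}/r.
move: c1_neq0 c2_neq0 c3_neq0 s12 s13 s23.
case: (equality_patternP c1 c2 c3)
  => [c|c d cd dc|c d cd dc|c d cd dc|c d e cd dc ce ec de ed] c0 d0 e0.
- move=> _ _ _; rewrite /divdiff !eqxx !alpha_eq !beta_eq.
  by field; rewrite y12 y13 y23.
- move=> _ /(_ cd) z13 /(_ cd) z23.
  have [z31 z32] := (subr_neq0C z13, subr_neq0C z23).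
  rewrite /divdiff eqxx (negPf cd) !alpha_eq !beta_eq !(beta_neq _ _ cd, beta_neq _ _ dc).
  by field; rewrite ?y12 ?z13 ?z23 ?z31 ?z32.
- move=> /(_ cd) z12 /(_ cd) z13 _.
  have [z21 z31] := (subr_neq0C z12, subr_neq0C z13).
  rewrite /divdiff eqxx (negPf cd) !alpha_eq !beta_eq !(beta_neq _ _ cd, beta_neq _ _ dc).
  by field; rewrite ?y23 ?z12 ?z13 ?z21 ?z31.
- move=> /(_ cd) z12 _ /(_ dc) z23.
  have [z21 z32] := (subr_neq0C z12, subr_neq0C z23).
  rewrite /divdiff eqxx (negPf cd) (negPf dc) !alpha_eq !beta_eq !(beta_neq _ _ cd, beta_neq _ _ dc).
  by field; rewrite ?y13 ?z12 ?z23 ?z21 ?z32.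
- move=> /(_ cd) z12 /(_ ce) z13 /(_ de) z23.
  have [[z21 z31] z32] := (subr_neq0C z12, subr_neq0C z13, subr_neq0C z23).
  rewrite /divdiff (negPf cd) (negPf ce) (negPf de).
  rewrite !(beta_neq _ _ cd, beta_neq _ _ dc, beta_neq _ _ ce, beta_neq _ _ de, beta_neq _ _ ed).
  by field; rewrite ?z12 ?z13 ?z23 ?z21 ?z31 ?z32.
Qed.

(* Zero by [alpha_sym_quiverQ]. If the entries of the weight are not all equal,
   the difference of the two sides is a combination of such terms. *)
Local Notation defect c d y z := (alpha c d y z * alpha d c z y * quiverQ c d y z -
  - (beta c d y z - q) * (beta c d y z + 1)).

(** Only here does [quiverQ] occur, by [tau_i tau_i = Q] and by the right-hand
    side of the braid relation for the [tau_i]. *)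
Lemma braid_coef_const (r := a23 * d23 a13 a12 + b23 * a12)
    (w := a23 * d23 b13 b12 + b23 * b12)
    (s1r := a13 * d13 a23 a21 + b13 * a21)
    (s1w := a13 * d13 b23 b21 + b13 * b21)
    (r' := a12 * d12 a13 a23 + b12 * a23)
    (w' := a12 * d12 b13 b23 + b12 * b23)
    (s2r' := a13 * d13 a12 a32 + b13 * a32)
    (s2w' := a13 * d13 b12 b32 + b13 * b32)
    (Q12 := quiverQ c1 c2 y1 y2) (Q23 := quiverQ c2 c3 y2 y3) :
  a12 * s1r * Q12 + a12 * d12 s1w w + b12 * w =
  a23 * s2r' * Q23 + a23 * d23 s2w' w' + b23 * w' +
  a12 * a23 * a13 * divdiff (c1 == c3) (quiverQ c1 c2 y3 y2) Q12 (y3 - y1).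
Proof.
have y31 := subr_neq0C y13.
rewrite {}/s1w {}/s1r {}/s2w' {}/s2r' {}/r {}/w {}/r' {}/w' {}/Q12 {}/Q23.
move: c1_neq0 c2_neq0 c3_neq0 s12 s13 s23.
case: (equality_patternP c1 c2 c3)
  => [c|c d cd dc|c d cd dc|c d cd dc|c d e cd dc ce ec de ed] c0 d0 e0.
- move=> _ _ _; rewrite /divdiff !eqxx !alpha_eq !beta_eq !quiverQ_eq.
  by field; rewrite y12 y13 y23 y31.
- move=> _ /(_ cd) z13 /(_ cd) z23.
  have [z31 z32] := (subr_neq0C z13, subr_neq0C z23).
  have E := alpha_sym_quiverQ c0 e0 cd z23 z32.
  apply/eqP; rewrite -subr_eq0; apply/eqP.
  transitivity (- beta c d y1 y3 * defect c d y2 y3).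
    rewrite quiverQ_eq.
    rewrite /divdiff eqxx (negPf cd) !alpha_eq !beta_eq !(beta_neq _ _ cd, beta_neq _ _ dc).
    by field; rewrite ?y12 ?z13 ?z23 ?z31 ?z32.
  by rewrite E subrr mulr0.
- move=> /(_ cd) z12 /(_ cd) z13 _.
  have [z21 z31] := (subr_neq0C z12, subr_neq0C z13).
  have E := alpha_sym_quiverQ c0 d0 cd z12 z21.
  apply/eqP; rewrite -subr_eq0; apply/eqP.
  transitivity (beta c d y1 y3 * defect c d y1 y2).
    rewrite quiverQ_eq.
    rewrite /divdiff eqxx (negPf cd) !alpha_eq !beta_eq !(beta_neq _ _ cd, beta_neq _ _ dc).
    by field; rewrite ?y23 ?z12 ?z13 ?z21 ?z31.
  by rewrite E subrr mulr0.
- move=> /(_ cd) z12 _ /(_ dc) z23.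
  have [z21 z32] := (subr_neq0C z12, subr_neq0C z23).
  have E := alpha_sym_quiverQ c0 d0 cd z12 z21.
  have E' := alpha_sym_quiverQ d0 c0 dc z23 z32.
  apply/eqP; rewrite -subr_eq0; apply/eqP.
  transitivity ((q - alpha c c y1 y3 / (y1 - y3)) * (defect c d y1 y2 - defect d c y2 y3)).
    rewrite [quiverQ d c _ _]quiverQC.
    rewrite /divdiff eqxx (negPf cd) (negPf dc) !alpha_eq !beta_eq !(beta_neq _ _ cd, beta_neq _ _ dc).
    by field; rewrite ?y13 ?y31 ?z12 ?z23 ?z21 ?z32.
  by rewrite E E' !subrr mulr0.
- move=> /(_ cd) z12 /(_ ce) z13 /(_ de) z23.
  have [[z21 z31] z32] := (subr_neq0C z12, subr_neq0C z13, subr_neq0C z23).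
  have E := alpha_sym_quiverQ c0 d0 cd z12 z21.
  have E' := alpha_sym_quiverQ d0 e0 de z23 z32.
  apply/eqP; rewrite -subr_eq0; apply/eqP.
  transitivity (beta c e y1 y3 * (defect c d y1 y2 - defect d e y2 y3)).
    rewrite /divdiff (negPf cd) (negPf ce) (negPf de).
    rewrite !(beta_neq _ _ cd, beta_neq _ _ dc, beta_neq _ _ ce, beta_neq _ _ de, beta_neq _ _ ed).
    by field; rewrite ?z12 ?z13 ?z23 ?z21 ?z31 ?z32.
  by rewrite E E' !subrr mulr0.
Qed.

End ThreePositions.
End Coefficients.

Section CoefficientsMorphism.

Variables (F G : fieldType) (phi : {rmorphism F -> G}).

Lemma alpha_morph q c d y z :
  phi (alpha q c d y z) = alpha (phi q) (phi c) (phi d) (phi y) (phi z).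
Proof.
rewrite /alpha -[phi q * phi c]rmorphM !(inj_eq (fmorph_inj phi)).
case: ifP => _; first by rewrite rmorphB rmorphM.
case: ifP => _; first by rewrite rmorphN fmorphV rmorphB rmorphM fmorphV.
by rewrite fmorph_div !rmorphB !rmorphM.
Qed.

Lemma beta_morph q c d y z :
  phi (beta q c d y z) = beta (phi q) (phi c) (phi d) (phi y) (phi z).
Proof.
rewrite /beta (inj_eq (fmorph_inj phi)); case: ifP => _ //.
by rewrite fmorph_div !rmorphM !rmorphB rmorph1 !rmorphM.
Qed.

Lemma divdiff_morph b f' f x :
  phi (divdiff b f' f x) = divdiff b (phi f') (phi f) (phi x).
Proof. by case: b; rewrite /divdiff ?rmorph0 // rmorphM rmorphB fmorphV. Qed.

End CoefficientsMorphism.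

(** * Polynomials in commuting operators *)

Lemma mpoly_gen_ind (k : fieldType) (n : nat) (P : {mpoly k[n]} -> Prop) :
  (forall c, P c%:MP) -> (forall a, P 'X_a) ->
  (forall f g, P f -> P g -> P (f + g)) ->
  (forall f g, P f -> P g -> P (f * g)) -> forall f, P f.
Proof.
move=> PC PX PD PM; elim/mpolyind=> [|c m p _ _ Pp]; first exact: (PC 0).
apply: PD => //; rewrite -mul_mpolyC; apply: (PM) => //.
rewrite mpolyXE_id; apply: big_ind => [||a _]; [exact: (PC 1)|exact: PM|].
elim: (m a) => [|j IHj]; first exact: (PC 1).
by rewrite exprS; exact: PM.
Qed.

Lemma linD (k : fieldType) (U V : lmodType k) (f : U -> V) u v :
  linear f -> f (u + v) = f u + f v.
Proof. by move=> fL; have := fL 1 u v; rewrite !scale1r. Qed.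

Lemma lin0 (k : fieldType) (U V : lmodType k) (f : U -> V) : linear f -> f 0 = 0.
Proof. by move=> fL; have := linD 0 0 fL; rewrite addr0 -{1}[f 0]addr0 => /addrI/esym. Qed.

Lemma linZ (k : fieldType) (U V : lmodType k) (f : U -> V) c v :
  linear f -> f (c *: v) = c *: f v.
Proof. by move=> fL; have := fL c v 0; rewrite (lin0 fL) !addr0. Qed.

Section PolynomialAction.

Variables (k : fieldType) (n : nat) (V : lmodType k) (X : 'I_n -> V -> V).
Hypothesis Xlin : forall a, linear (X a).
Hypothesis XC : forall a b v, X a (X b v) = X b (X a v).

Definition mon_on (s : seq 'I_n) (m : 'X_{1..n}) (v : V) : V :=
  foldr (fun a w => iter (m a) (X a) w) v s.

Lemma iter_linear (f : V -> V) j : linear f -> linear (iter j f).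
Proof. by move=> fL c u v; elim: j => //= j ->; rewrite fL. Qed.

Lemma iter_comm (f g : V -> V) j l v : (forall w, f (g w) = g (f w)) ->
  iter j f (iter l g v) = iter l g (iter j f v).
Proof.
move=> fgC; elim: l v => //= l IHl v; rewrite -IHl.
by elim: j {IHl} => //= j ->.
Qed.

Lemma mon_on_linear s m : linear (mon_on s m).
Proof.
move=> c u v; elim: s => //= a s ->; exact: (iter_linear _ (Xlin a)).
Qed.

Lemma iter_mon_on a j s m v :
  iter j (X a) (mon_on s m v) = mon_on s m (iter j (X a) v).
Proof.
by elim: s => //= b s <-; exact: iter_comm (fun w => XC a b w).
Qed.

Lemma mon_onD s m1 m2 v : mon_on s (m1 + m2) v = mon_on s m1 (mon_on s m2 v).
Proof.
elim: s v => //= a s IHs v.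
by rewrite mnmDE iterD IHs [in LHS]iter_mon_on.
Qed.

Lemma mon_onU s a v : uniq s ->
  mon_on s U_(a) v = if a \in s then X a v else v.
Proof.
elim: s => //= b s IHs /andP[bs us]; rewrite IHs // mnm1E inE.
by have [->|] := eqVneq a b; rewrite ?(negPf bs).
Qed.

Let mon := mon_on (enum 'I_n).

Lemma mon_linear m : linear (mon m).
Proof. exact: mon_on_linear. Qed.

Lemma mon0 v : mon 0 v = v.
Proof. by rewrite /mon; elim: (enum 'I_n) => //= a s ->; rewrite mnm0E. Qed.

(** A common bound on degrees makes sums over different supports comparable. *)
Lemma poly_actE d (f : {mpoly k[n]}) v : (msize f <= d)%N ->
  poly_act X f v = \sum_(m : 'X_{1..n < d}) f@_m *: mon m v.
Proof.
move=> fd; pose J : subFinType _ := 'X_{1..n < d}.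
rewrite /poly_act (big_mksub J) ?msupp_uniq //=.
  by rewrite big_rmcond //= => m /memN_msupp_eq0 ->; rewrite scale0r.
by move=> m mf; apply: (leq_trans _ fd); exact: msize_mdeg_lt.
Qed.

Lemma poly_actDl f g v : poly_act X (f + g) v = poly_act X f v + poly_act X g v.
Proof.
pose d := maxn (msize (f + g)) (maxn (msize f) (msize g)).
rewrite !(@poly_actE d) ?leq_max ?leqnn ?orbT // -big_split /=.
by apply: eq_bigr => m _; rewrite mcoeffD scalerDl.
Qed.

Lemma poly_actZl c f v : poly_act X (c *: f) v = c *: poly_act X f v.
Proof.
pose d := maxn (msize (c *: f)) (msize f).
rewrite !(@poly_actE d) ?leq_max ?leqnn ?orbT // scaler_sumr.
by apply: eq_bigr => m _; rewrite mcoeffZ scalerA.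
Qed.

Lemma poly_act_linear f : linear (poly_act X f).
Proof.
move=> c u v; rewrite !(@poly_actE (msize f)) // scaler_sumr -big_split /=.
by apply: eq_bigr => m _; rewrite mon_linear scalerDr !scalerA mulrC.
Qed.

Lemma poly_actDr f u v : poly_act X f (u + v) = poly_act X f u + poly_act X f v.
Proof. by have := poly_act_linear f 1 u v; rewrite !scale1r. Qed.

Lemma poly_act0l v : poly_act X 0 v = 0.
Proof. by rewrite -[0](scale0r 0) poly_actZl scale0r. Qed.

Lemma poly_act0r f : poly_act X f 0 = 0.
Proof. by rewrite -{1}[0]addr0; apply: (addrI (poly_act X f 0)); rewrite -poly_actDr !addr0. Qed.

Lemma poly_actZr f c v : poly_act X f (c *: v) = c *: poly_act X f v.
Proof. by have := poly_act_linear f c v 0; rewrite !addr0 poly_act0r addr0. Qed.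

Lemma poly_actXm m v : poly_act X 'X_[m] v = mon m v.
Proof. by rewrite /poly_act msuppX big_seq1 mcoeffX eqxx scale1r. Qed.

Lemma poly_act1 v : poly_act X 1 v = v.
Proof. by rewrite -mpolyX0 poly_actXm mon0. Qed.

Lemma poly_actC c v : poly_act X c%:MP v = c *: v.
Proof. by rewrite -[c%:MP]mulr1 mul_mpolyC poly_actZl poly_act1. Qed.

Lemma poly_actX a v : poly_act X 'X_a v = X a v.
Proof. by rewrite poly_actXm /mon mon_onU ?enum_uniq // mem_enum. Qed.

Lemma poly_actM f g v : poly_act X (f * g) v = poly_act X f (poly_act X g v).
Proof.
elim/mpolyind: f => [|c m p _ _ IHp]; first by rewrite mul0r !poly_act0l.
rewrite mulrDl !poly_actDl {}IHp -scalerAl !poly_actZl; congr (_ *: _ + _).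
rewrite poly_actXm; elim/mpolyind: g => [|d l p' _ _ IHp].
  by rewrite mulr0 !poly_act0l -poly_actXm poly_act0r.
rewrite mulrDr !poly_actDl {}IHp -scalerAr !poly_actZl -mpolyXD !poly_actXm.
by rewrite mon_linear /mon mon_onD.
Qed.

Lemma poly_actAC f g v :
  poly_act X f (poly_act X g v) = poly_act X g (poly_act X f v).
Proof. by rewrite -!poly_actM mulrC. Qed.

End PolynomialAction.

(** * Rational functions regular at the origin *)

Notation ratfun k n := {fraction {mpoly k[n]}}.
Notation "x %:F" := (tofrac x) : ring_scope.

Section RegularFunctions.

Variables (k : fieldType) (n : nat).
Implicit Types (p : {mpoly k[n]}) (r : ratfun k n).

Definition at0 p : k := p.@[fun=> 0].

(** The local ring at the origin, inside the field of fractions. *)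
Definition regular r : Prop := exists p q, at0 q != 0 /\ r = p%:F / q%:F.

Definition regunit r : Prop :=
  exists p q, [/\ at0 p != 0, at0 q != 0 & r = p%:F / q%:F].

Lemma at0M p q : at0 (p * q) = at0 p * at0 q. Proof. exact: rmorphM. Qed.
Lemma at0D p q : at0 (p + q) = at0 p + at0 q. Proof. exact: rmorphD. Qed.
Lemma at0B p q : at0 (p - q) = at0 p - at0 q. Proof. exact: rmorphB. Qed.
Lemma at0C c : at0 c%:MP = c. Proof. exact: mevalC. Qed.
Lemma at01 : at0 1 = 1. Proof. exact: rmorph1. Qed.
Lemma at0X a : at0 'X_a = 0. Proof. exact: mevalXU. Qed.

Lemma at0_neq0 p : at0 p != 0 -> p%:F != 0.
Proof. by apply: contra; rewrite tofrac_eq0 => /eqP ->; rewrite /at0 meval0. Qed.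

Lemma regular_poly p : regular p%:F.
Proof. by exists p, 1; rewrite at01 oner_neq0 tofrac1 divr1. Qed.

Lemma regular0 : regular 0.
Proof. by rewrite -tofrac0; exact: regular_poly. Qed.

Lemma regular1 : regular 1.
Proof. by rewrite -tofrac1; exact: regular_poly. Qed.

Lemma regularD r s : regular r -> regular s -> regular (r + s).
Proof.
move=> [p [q [q0 ->]]] [p' [q' [q'0 ->]]].
exists (p * q' + p' * q), (q * q'); split; first by rewrite at0M mulf_neq0.
by rewrite tofracD !tofracM addf_div ?at0_neq0.
Qed.

Lemma regularM r s : regular r -> regular s -> regular (r * s).
Proof.
move=> [p [q [q0 ->]]] [p' [q' [q'0 ->]]].
exists (p * p'), (q * q'); split; first by rewrite at0M mulf_neq0.
by rewrite !tofracM mulf_div.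
Qed.

Lemma regularN r : regular r -> regular (- r).
Proof. by move=> [p [q [q0 ->]]]; exists (- p), q; rewrite tofracN mulNr. Qed.

Lemma regunit_regular r : regunit r -> regular r.
Proof. by move=> [p [q [_ q0 ->]]]; exists p, q. Qed.

Lemma regunit_poly p : at0 p != 0 -> regunit p%:F.
Proof. by exists p, 1; rewrite at01 oner_neq0 tofrac1 divr1. Qed.

Lemma regunitM r s : regunit r -> regunit s -> regunit (r * s).
Proof.
move=> [p [q [p0 q0 ->]]] [p' [q' [p'0 q'0 ->]]].
by exists (p * p'), (q * q'); rewrite !at0M !tofracM mulf_div ?mulf_neq0.
Qed.

Lemma regunitV r : regunit r -> regunit r^-1.
Proof. by move=> [p [q [p0 q0 ->]]]; exists q, p; rewrite invf_div. Qed.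

Lemma regunitN r : regunit r -> regunit (- r).
Proof.
move=> [p [q [p0 q0 ->]]]; exists (- p), q; split=> //; last by rewrite tofracN mulNr.
by rewrite /at0 mevalN oppr_eq0.
Qed.

Lemma regunit_neq0 r : regunit r -> r != 0.
Proof. by move=> [p [q [p0 q0 ->]]]; rewrite mulf_neq0 ?invr_eq0 ?at0_neq0. Qed.

End RegularFunctions.

Section LocalAction.

Variables (k : fieldType) (n : nat) (V : lmodType k) (X : 'I_n -> V -> V).
Hypothesis Xlin : forall a, linear (X a).
Hypothesis XC : forall a b v, X a (X b v) = X b (X a v).

Definition locally_nilpotent (f : {mpoly k[n]}) : Prop :=
  forall v, exists N, poly_act X (f ^+ N) v = 0.

Lemma poly_act_expr_ge f N M v : (N <= M)%N ->
  poly_act X (f ^+ N) v = 0 -> poly_act X (f ^+ M) v = 0.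
Proof.
by move=> NM fv; rewrite -(subnK NM) exprD poly_actM // fv poly_act0r.
Qed.

Lemma poly_act_sum I (s : seq I) (F : I -> {mpoly k[n]}) v :
  poly_act X (\sum_(i <- s) F i) v = \sum_(i <- s) poly_act X (F i) v.
Proof.
by apply: (big_morph (fun f => poly_act X f v)) => [f g|];
   rewrite ?poly_actDl ?poly_act0l.
Qed.

Lemma nilpotent_vecD f g N M v :
  poly_act X (f ^+ N) v = 0 -> poly_act X (g ^+ M) v = 0 ->
  poly_act X ((f + g) ^+ (N + M)) v = 0.
Proof.
move=> fN gM; rewrite exprDn poly_act_sum big1 // => i _.
rewrite -scaler_nat poly_actZl; have [Mi|iM] := leqP M i.
  by rewrite poly_actM // (poly_act_expr_ge Mi gM) poly_act0r ?scaler0.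
rewrite mulrC poly_actM // (poly_act_expr_ge _ fN) ?poly_act0r ?scaler0 //.
by rewrite -addnBA ?leq_addr // ltnW.
Qed.

Lemma nilpotent_vecM f g N v :
  poly_act X (f ^+ N) v = 0 -> poly_act X ((g * f) ^+ N) v = 0.
Proof. by move=> fN; rewrite exprMn poly_actM // fN poly_act0r. Qed.

Lemma poly_actXn a N v : poly_act X ('X_a ^+ N) v = iter N (X a) v.
Proof.
elim: N => [|N IHN] /=; first by rewrite expr0 poly_act1.
by rewrite exprS poly_actM // IHN poly_actX.
Qed.

Hypothesis Xnil : forall a v, exists N, iter N (X a) v = 0.

(** The constant term being removed, each step from generators to sums and
    products only uses that nilpotent commuting operators form an ideal. *)
Lemma at0_locally_nilpotent f : at0 f = 0 -> locally_nilpotent f.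
Proof.
suff: locally_nilpotent (f - (at0 f)%:MP) by move=> + f0; rewrite f0 subr0.
elim/mpoly_gen_ind: f => [c|a|f g nf ng|f g nf ng] v.
- by exists 1%N; rewrite at0C subrr expr1 poly_act0l.
- by have [N aN] := Xnil a v; exists N; rewrite at0X subr0 poly_actXn.
- have [[N fN] [M gM]] := (nf v, ng v); exists (N + M)%N.
  by rewrite at0D mpolyCD opprD addrACA; exact: nilpotent_vecD.
- have [[N fN] [M gM]] := (nf v, ng v); exists (N + M)%N.
  have ->: f * g - (at0 (f * g))%:MP =
      g * (f - (at0 f)%:MP) + (at0 f)%:MP * (g - (at0 g)%:MP).
    by rewrite at0M mpolyCM !mulrBr addrA [g * f]mulrC [g * _]mulrC subrK.
  by apply: nilpotent_vecD; exact: nilpotent_vecM.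
Qed.

(** A geometric series: [q / q(0) = 1 - t] with [t] locally nilpotent. Where it
    stops depends on [v], and so does the inverse [g]. *)
Lemma poly_inverse_at q v : at0 q != 0 -> exists g, poly_act X (g * q) v = v.
Proof.
move=> q0; pose t := 1 - (at0 q)^-1 *: q.
have /at0_locally_nilpotent/(_ v)[N tN] : at0 t = 0.
  by rewrite at0B at01 /at0 mevalZ mulVf ?subrr.
exists ((\sum_(i < N) t ^+ i) * ((at0 q)^-1)%:MP).
rewrite -mulrA mul_mpolyC -[_ *: q](subKr 1) -/t mulrC.
have ->: (1 - t) * (\sum_(i < N) t ^+ i) = 1 - t ^+ N.
  by rewrite -opprB mulNr -subrX1 opprB.
by rewrite poly_actDl poly_act1 -scaleN1r poly_actZl tN scaler0 addr0.
Qed.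

Lemma poly_act_inj q v : at0 q != 0 -> poly_act X q v = 0 -> v = 0.
Proof.
move=> q0 qv; have [g <-] := poly_inverse_at v q0.
by rewrite poly_actM // qv poly_act0r.
Qed.

Lemma poly_act_inj2 q v w : at0 q != 0 ->
  poly_act X q v = poly_act X q w -> v = w.
Proof.
move=> q0 qvw; apply/eqP; rewrite -subr_eq0; apply/eqP/(poly_act_inj q0).
by rewrite poly_actDr // qvw -scaleN1r poly_actZr // scaleN1r subrr.
Qed.

(** [w] is the image of [v] under the fraction [r]. Quantifying over all the
    ways to write [r] makes the choice of one irrelevant. *)
Definition frac_spec r v w : Prop := forall p q : {mpoly k[n]},
  at0 q != 0 -> r = p%:F / q%:F -> poly_act X q w = poly_act X p v.

Lemma frac_spec_ex r v : regular r -> exists w, frac_spec r v w.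
Proof.
move=> [p [q [q0 rE]]]; have [g gq] := poly_inverse_at (poly_act X p v) q0.
exists (poly_act X g (poly_act X p v)) => p' q' q'0; rewrite rE => /eqP.
rewrite eqr_div ?at0_neq0 // -!tofracM tofrac_eq => /eqP pq.
have gqE: poly_act X q (poly_act X g (poly_act X p v)) = poly_act X p v.
  by rewrite -poly_actM // mulrC.
by apply: (poly_act_inj2 q0); rewrite poly_actAC // gqE -!poly_actM // mulrC pq mulrC.
Qed.

Definition frac_act r v : V :=
  if pselect (exists w, frac_spec r v w) is left h then sval (cid h) else 0.

Lemma frac_actP r v p q : at0 q != 0 -> r = p%:F / q%:F ->
  poly_act X q (frac_act r v) = poly_act X p v.
Proof.
move=> q0 rE; rewrite /frac_act; case: pselect => [h|[]].
  by case: cid => w /= /(_ p q q0 rE).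
by apply: frac_spec_ex; exists p, q.
Qed.

Lemma frac_actE r v w p q : at0 q != 0 -> r = p%:F / q%:F ->
  poly_act X q w = poly_act X p v -> frac_act r v = w.
Proof.
by move=> q0 rE qw; apply: (poly_act_inj2 q0); rewrite qw; exact: frac_actP.
Qed.

Lemma frac_act_poly p v : frac_act p%:F v = poly_act X p v.
Proof.
apply: (@frac_actE _ _ _ p 1); rewrite ?at01 ?oner_neq0 //.
  by rewrite tofrac1 divr1.
by rewrite poly_act1.
Qed.

Lemma frac_act_linear r : regular r -> linear (frac_act r).
Proof.
move=> [p [q [q0 rE]]] c u v; apply: (frac_actE q0 rE).
by rewrite poly_actDr // poly_actZr // !(frac_actP _ q0 rE) poly_actDr // poly_actZr.
Qed.

Lemma frac_actD r s v : regular r -> regular s ->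
  frac_act (r + s) v = frac_act r v + frac_act s v.
Proof.
move=> [p [q [q0 rE]]] [p' [q' [q'0 sE]]].
apply: (@frac_actE _ _ _ (p * q' + p' * q) (q * q')).
- by rewrite at0M mulf_neq0.
- by rewrite rE sE addf_div ?at0_neq0 // tofracD !tofracM.
rewrite poly_actDr // poly_actDl; congr (_ + _).
  by rewrite [q * _]mulrC !poly_actM // (frac_actP _ q0 rE) poly_actAC.
by rewrite !poly_actM // (frac_actP _ q'0 sE) poly_actAC.
Qed.

Lemma frac_actM r s v : regular r -> regular s ->
  frac_act (r * s) v = frac_act r (frac_act s v).
Proof.
move=> [p [q [q0 rE]]] [p' [q' [q'0 sE]]].
apply: (@frac_actE _ _ _ (p * p') (q * q')).
- by rewrite at0M mulf_neq0.
- by rewrite rE sE mulf_div !tofracM.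
rewrite [q * _]mulrC !poly_actM // (frac_actP _ q0 rE).
by rewrite poly_actAC // (frac_actP _ q'0 sE).
Qed.

Lemma frac_act1 v : frac_act 1 v = v.
Proof. by rewrite -tofrac1 frac_act_poly poly_act1. Qed.

End LocalAction.

Lemma poly_act_morph (k : fieldType) (n : nat) (V W : lmodType k)
    (X : 'I_n -> V -> V) (Y : 'I_n -> W -> W) (f : V -> W) :
  linear f -> (forall a v, f (X a v) = Y a (f v)) ->
  forall p v, f (poly_act X p v) = poly_act Y p (f v).
Proof.
move=> fL fXY p v; rewrite /poly_act (big_morph f (fun u w => linD u w fL) (lin0 fL)).
apply: eq_bigr => m _; rewrite (linZ _ _ fL); congr (_ *: _).
elim: (enum 'I_n) => //= a s <-; elim: (m a) => //= j <-; exact: fXY.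
Qed.

Lemma frac_act_morph (k : fieldType) (n : nat) (V W : lmodType k)
    (X : 'I_n -> V -> V) (Y : 'I_n -> W -> W) (f : V -> W) :
  (forall a, linear (X a)) -> (forall a b v, X a (X b v) = X b (X a v)) ->
  (forall a v, exists N, iter N (X a) v = 0) ->
  (forall a, linear (Y a)) -> (forall a b v, Y a (Y b v) = Y b (Y a v)) ->
  (forall a v, exists N, iter N (Y a) v = 0) ->
  linear f -> (forall a v, f (X a v) = Y a (f v)) ->
  forall r v, regular r -> f (frac_act X r v) = frac_act Y r (f v).
Proof.
move=> Xl XC Xn Yl YC Yn fL fXY r v [p [q [q0 rE]]].
apply/esym/(frac_actE Yl YC Yn q0 rE).
by rewrite -!(poly_act_morph fL fXY) (frac_actP Xl XC Xn _ q0 rE).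
Qed.

(** * Permutations of the variables and divided differences *)

Lemma frac_ex (R : idomainType) (r : {fraction R}) :
  exists p q : R, q != 0 /\ r = p%:F / q%:F.
Proof.
elim/quotW: r => x; have d0 := denom_ratioP x.
exists \n_x, \d_x; split=> //.
apply: (canRL (mulfK _)); first by rewrite tofrac_eq0.
rewrite !piE; apply/eqmodP; rewrite /= FracField.equivfE.
by rewrite /FracField.mulf !numden_Ratio ?mulf_neq0 ?oner_neq0 // !mulr1 mulrC.
Qed.

Section PermutingVariables.

Variables (k : fieldType) (n : nat) (s : 'S_n).
Implicit Types (p : {mpoly k[n]}) (r : ratfun k n).

Lemma msym_neq0 p : p != 0 -> msym s p != 0.
Proof. by apply: contra => /eqP p0; apply/eqP/(inj_msym s); rewrite p0 msym0. Qed.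

Lemma fsym_ex r : exists w, forall p q,
  q != 0 -> r = p%:F / q%:F -> w = (msym s p)%:F / (msym s q)%:F.
Proof.
have [p [q [q0 ->]]] := frac_ex r.
exists ((msym s p)%:F / (msym s q)%:F) => p' q' q'0 /eqP.
rewrite eqr_div ?tofrac_eq0 // -!tofracM tofrac_eq => /eqP pq; apply/eqP.
by rewrite eqr_div ?tofrac_eq0 ?msym_neq0 // -!tofracM -!msymM pq.
Qed.

(** The automorphism of the field of rational functions that permutes the
    variables. *)
Definition fsym r : ratfun k n := sval (cid (fsym_ex r)).

Lemma fsymE p q : q != 0 -> fsym (p%:F / q%:F) = (msym s p)%:F / (msym s q)%:F.
Proof. by move=> q0; rewrite /fsym; case: cid => w /= /(_ p q q0 erefl). Qed.

Lemma fsym_poly p : fsym p%:F = (msym s p)%:F.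
Proof. by rewrite -[p%:F]divr1 -tofrac1 fsymE ?oner_neq0 // msym1 tofrac1 divr1. Qed.

Lemma fsymM r1 r2 : fsym (r1 * r2) = fsym r1 * fsym r2.
Proof.
have [[p [q [q0 ->]]] [p' [q' [q'0 ->]]]] := (frac_ex r1, frac_ex r2).
by rewrite mulf_div -!tofracM !fsymE ?mulf_neq0 // mulf_div !msymM !tofracM.
Qed.

Lemma fsymD r1 r2 : fsym (r1 + r2) = fsym r1 + fsym r2.
Proof.
have [[p [q [q0 ->]]] [p' [q' [q'0 ->]]]] := (frac_ex r1, frac_ex r2).
rewrite addf_div ?tofrac_eq0 // -!tofracM -tofracD !fsymE ?mulf_neq0 //.
by rewrite addf_div ?tofrac_eq0 ?msym_neq0 // msymD !msymM !tofracD !tofracM.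
Qed.

Lemma fsym0 : fsym 0 = 0.
Proof. by rewrite -tofrac0 fsym_poly msym0. Qed.

Lemma fsym1 : fsym 1 = 1.
Proof. by rewrite -tofrac1 fsym_poly msym1. Qed.

Lemma fsymN r : fsym (- r) = - fsym r.
Proof. by apply: (addrI (fsym r)); rewrite -fsymD !subrr fsym0. Qed.

Fact fsym_zmod_morphism : zmod_morphism fsym.
Proof. by move=> r1 r2; rewrite fsymD fsymN. Qed.
HB.instance Definition _ :=
  GRing.isZmodMorphism.Build (ratfun k n) (ratfun k n) fsym fsym_zmod_morphism.
Fact fsym_monoid_morphism : monoid_morphism fsym.
Proof. by split; [exact: fsym1|exact: fsymM]. Qed.
HB.instance Definition _ :=
  GRing.isMonoidMorphism.Build (ratfun k n) (ratfun k n) fsym fsym_monoid_morphism.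

Lemma msym_polyC c : msym s (c%:MP : {mpoly k[n]}) = c%:MP.
Proof. exact: mmapC. Qed.

Lemma msym_polyX a : msym s ('X_a : {mpoly k[n]}) = 'X_(s a).
Proof. by rewrite /msym mmapX mmap1U. Qed.

Lemma at0_msym p : at0 (msym s p) = at0 p.
Proof.
elim/mpoly_gen_ind: p => [c|a|p q IHp IHq|p q IHp IHq].
- by rewrite msym_polyC.
- by rewrite msym_polyX !at0X.
- by rewrite msymD !at0D IHp IHq.
- by rewrite msymM !at0M IHp IHq.
Qed.

Lemma regular_fsym r : regular r -> regular (fsym r).
Proof.
move=> [p [q [q0 ->]]]; exists (msym s p), (msym s q); rewrite at0_msym; split=> //.
by rewrite fsymE //; apply: contra q0 => /eqP ->; rewrite /at0 meval0.
Qed.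

End PermutingVariables.

Lemma msym_tperm_sub (k : fieldType) (n : nat) (a b : 'I_n) (p : {mpoly k[n]}) :
  exists g, msym (tperm a b) p - p = ('X_a - 'X_b) * g.
Proof.
elim/mpoly_gen_ind: p => [c|e|p q [g pE] [h qE]|p q [g pE] [h qE]].
- by exists 0; rewrite msym_polyC subrr mulr0.
- rewrite msym_polyX; case: tpermP => [->|->|_ _].
  + by exists (-1); rewrite mulrN1 opprB.
  + by exists 1; rewrite mulr1.
  + by exists 0; rewrite subrr mulr0.
- by exists (g + h); rewrite msymD opprD addrACA pE qE mulrDr.
- exists (msym (tperm a b) p * h + g * q).
  rewrite mulrDr mulrCA -qE mulrA -pE msymM mulrBr mulrBl addrA subrK.
  by [].
Qed.

(** For [r = p / q], the numerator [s(p) q - p s(q)] of [s(r) - r] is a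
    combination of [s(p) - p] and [s(q) - q], both divisible by [X_a - X_b]. *)
Lemma regular_divdiff (k : fieldType) (n : nat) (a b : 'I_n) (r : ratfun k n) :
  a != b -> regular r ->
  regular ((fsym (tperm a b) r - r) / ('X_a - 'X_b)%:F).
Proof.
move=> ab [p [q [q0 ->]]]; set s := tperm a b.
have X0 : ('X_a - 'X_b : {mpoly k[n]}) != 0.
  apply/eqP => /(congr1 (mcoeff U_(a)%MM))/eqP.
  by rewrite mcoeffB mcoeff0 !mcoeffXU eqxx eq_sym [b == a]eq_sym (negPf ab) subr0 eq_sym oner_eq0.
have [[g pE] [h qE]] := (msym_tperm_sub a b p, msym_tperm_sub a b q).
have qn0 : q != 0 by apply: contra q0 => /eqP ->; rewrite /at0 meval0.
exists (g * q - p * h), (q * msym s q); split.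
  by rewrite at0M mulf_neq0 // at0_msym.
rewrite fsymE // -mulNr addf_div ?tofrac_eq0 ?msym_neq0 //.
have -> : (msym s p)%:F * q%:F + - p%:F * (msym s q)%:F =
    ('X_a - 'X_b)%:F * (g * q - p * h)%:F.
  rewrite mulNr -!tofracM -tofracB; congr (_%:F).
  have -> : msym s p = p + ('X_a - 'X_b) * g by rewrite -pE addrC subrK.
  have -> : msym s q = q + ('X_a - 'X_b) * h by rewrite -qE addrC subrK.
  by ring.
rewrite mulrAC [('X_a - 'X_b)%:F * _]mulrC mulfK ?tofrac_eq0 // tofracM.
by rewrite [(msym _ _)%:F * _]mulrC.
Qed.

(** * Functions on weights *)

(** The ring that acts on the modules of both categories. *)
Record wfun (k : fieldType) (n : nat) (L : Type) := WFun {
  wfval :> L -> ratfun k n;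
  wfvalP : forall nu, regular (wfval nu) }.

HB.instance Definition _ (k : fieldType) (n : nat) (L : Type) :=
  gen_eqMixin (wfun k n L).
HB.instance Definition _ (k : fieldType) (n : nat) (L : Type) :=
  gen_choiceMixin (wfun k n L).

Section WeightFunctions.

Variables (k : fieldType) (n : nat) (L : Type).
Implicit Types f g h : wfun k n L.

Lemma wfun_eq f g : (forall nu, f nu = g nu) -> f = g.
Proof.
case: f g => [f fP] [g gP] /= /funext fg; move: gP; rewrite -fg => gP.
by congr WFun; exact: Prop_irrelevance.
Qed.

Fact wfun_of_regular (f : L -> ratfun k n) nu :
  regular (if `[< regular (f nu) >] then f nu else 0).
Proof. by case: asboolP => // _; exact: regular0. Qed.

(** Cutting off at values that are not regular makes this total: functions can
    be written down first and shown to be regular afterwards. *)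
Definition wfun_of (f : L -> ratfun k n) : wfun k n L :=
  WFun (wfun_of_regular f).

Lemma wfun_ofE (f : L -> ratfun k n) nu : regular (f nu) -> wfun_of f nu = f nu.
Proof. by move=> fr /=; case: asboolP. Qed.

Definition wfadd f g := wfun_of (fun nu => f nu + g nu).
Definition wfopp f := wfun_of (fun nu => - f nu).
Definition wfmul f g := wfun_of (fun nu => f nu * g nu).
Definition wfcst c := wfun_of (fun=> c).

Lemma wfaddE f g nu : wfadd f g nu = f nu + g nu.
Proof. by apply: wfun_ofE; apply: regularD; exact: wfvalP. Qed.
Lemma wfoppE f nu : wfopp f nu = - f nu.
Proof. by apply: wfun_ofE; apply: regularN; exact: wfvalP. Qed.
Lemma wfmulE f g nu : wfmul f g nu = f nu * g nu.
Proof. by apply: wfun_ofE; apply: regularM; exact: wfvalP. Qed.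
Lemma wfcst0E nu : wfcst 0 nu = 0.
Proof. by apply: wfun_ofE; exact: regular0. Qed.
Lemma wfcst1E nu : wfcst 1 nu = 1.
Proof. by apply: wfun_ofE; exact: regular1. Qed.

Fact wfaddA : associative wfadd.
Proof. by move=> f g h; apply: wfun_eq => nu; rewrite !wfaddE addrA. Qed.
Fact wfaddC : commutative wfadd.
Proof. by move=> f g; apply: wfun_eq => nu; rewrite !wfaddE addrC. Qed.
Fact wfadd0 : left_id (wfcst 0) wfadd.
Proof. by move=> f; apply: wfun_eq => nu; rewrite wfaddE wfcst0E add0r. Qed.
Fact wfaddN : left_inverse (wfcst 0) wfopp wfadd.
Proof. by move=> f; apply: wfun_eq => nu; rewrite wfaddE wfoppE wfcst0E addNr. Qed.

HB.instance Definition _ :=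
  GRing.isZmodule.Build (wfun k n L) wfaddA wfaddC wfadd0 wfaddN.

Fact wfmulA : associative wfmul.
Proof. by move=> f g h; apply: wfun_eq => nu; rewrite !wfmulE mulrA. Qed.
Fact wfmulC : commutative wfmul.
Proof. by move=> f g; apply: wfun_eq => nu; rewrite !wfmulE mulrC. Qed.
Fact wfmul1 : left_id (wfcst 1) wfmul.
Proof. by move=> f; apply: wfun_eq => nu; rewrite wfmulE wfcst1E mul1r. Qed.
Fact wfmulDl : left_distributive wfmul +%R.
Proof.
by move=> f g h; apply: wfun_eq => nu; rewrite [RHS]wfaddE !wfmulE wfaddE mulrDl.
Qed.

HB.instance Definition _ :=
  GRing.Zmodule_isComPzRing.Build (wfun k n L) wfmulA wfmulC wfmul1 wfmulDl.

Lemma wfD f g nu : (f + g) nu = f nu + g nu. Proof. exact: wfaddE. Qed.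
Lemma wfN f nu : (- f) nu = - f nu. Proof. exact: wfoppE. Qed.
Lemma wfM f g nu : (f * g) nu = f nu * g nu. Proof. exact: wfmulE. Qed.
Lemma wfB f g nu : (f - g) nu = f nu - g nu. Proof. by rewrite wfD wfN. Qed.
Lemma wf0 nu : (0 : wfun k n L) nu = 0. Proof. exact: wfcst0E. Qed.
Lemma wf1 nu : (1 : wfun k n L) nu = 1. Proof. exact: wfcst1E. Qed.

End WeightFunctions.

Arguments wfun_of : simpl never.

Section Transpositions.

Variable n : nat.
Implicit Types (i j : 'I_n.-1) (a : 'I_n).

Lemma spos0 i : spos i (pos0 i) = pos1 i. Proof. exact: tpermL. Qed.
Lemma spos1 i : spos i (pos1 i) = pos0 i. Proof. exact: tpermR. Qed.
Lemma sposD i a : pos0 i != a -> pos1 i != a -> spos i a = a.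
Proof. by move=> a0 a1; rewrite /spos tpermD. Qed.
Lemma sposK i : involutive (spos i). Proof. exact: tpermK. Qed.

Lemma pos01_neq i : pos0 i != pos1 i.
Proof. by rewrite -val_eqE /= ltn_eqF. Qed.

Lemma sactE V i (nu : {ffun 'I_n -> V}) a : sact i nu a = nu (spos i a).
Proof. by rewrite ffunE. Qed.

Lemma sactK V i : involutive (@sact n V i).
Proof. by move=> nu; apply/ffunP => a; rewrite !sactE sposK. Qed.

Lemma sact_id (V : eqType) i (nu : {ffun 'I_n -> V}) :
  nu (pos0 i) = nu (pos1 i) -> sact i nu = nu.
Proof.
move=> nuE; apply/ffunP => a; rewrite sactE /spos.
by case: tpermP => // ->.
Qed.

End Transpositions.

Section HeckeFunctions.

Variables (k : fieldType) (q : k) (I : {pred k}) (n : nat).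
Local Notation L := {ffun 'I_n -> vert I}.
Local Notation K := (ratfun k n).
Local Notation A := (wfun k n L).
Implicit Types (f g : A) (nu : L) (i j : 'I_n.-1) (a b : 'I_n).

Definition kc (c : k) : K := (c%:MP)%:F.
Definition xvar a : K := ('X_a)%:F.
Definition yvar a : K := 1 + xvar a.
Definition cvar nu a : K := kc (val (nu a)).

Lemma kc_eq c d : (kc c == kc d) = (c == d).
Proof. by rewrite /kc tofrac_eq (inj_eq (can_inj (@mpolyCK _ _))). Qed.

Lemma kcM c d : kc (c * d) = kc c * kc d.
Proof. by rewrite /kc mpolyCM tofracM. Qed.
Lemma kcB c d : kc (c - d) = kc c - kc d.
Proof. by rewrite /kc mpolyCB tofracB. Qed.
Lemma kc0 : kc 0 = 0. Proof. by rewrite /kc mpolyC0 tofrac0. Qed.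
Lemma kc1 : kc 1 = 1. Proof. by rewrite /kc mpolyC1 tofrac1. Qed.

Lemma kc_neq0 c : c != 0 -> kc c != 0.
Proof. by rewrite -kc0 kc_eq. Qed.

Lemma kcV c : kc c^-1 = (kc c)^-1.
Proof.
have [->|c0] := eqVneq c 0; first by rewrite !(kc0, invr0).
by apply: (mulIf (kc_neq0 c0)); rewrite -kcM !mulVf ?kc_neq0 // kc1.
Qed.

Lemma cvar_eq nu a b : (cvar nu a == cvar nu b) = (nu a == nu b).
Proof. by rewrite /cvar kc_eq val_eqE. Qed.

Lemma fsym_kc (s : 'S_n) c : fsym s (kc c) = kc c.
Proof. by rewrite fsym_poly msym_polyC. Qed.

Lemma fsym_xvar (s : 'S_n) a : fsym s (xvar a) = xvar (s a).
Proof. by rewrite fsym_poly msym_polyX. Qed.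

Lemma fsym_yvar (s : 'S_n) a : fsym s (yvar a) = yvar (s a).
Proof. by rewrite rmorphD rmorph1 /= fsym_xvar. Qed.

Lemma xvar_neq a b : a != b -> xvar a - xvar b != 0.
Proof.
move=> ab; rewrite -tofracB tofrac_eq0.
apply/eqP => /(congr1 (mcoeff U_(a)%MM))/eqP.
by rewrite mcoeffB mcoeff0 !mcoeffXU eqxx [b == a]eq_sym (negPf ab) subr0 oner_eq0.
Qed.

Lemma yvarB a b : yvar a - yvar b = xvar a - xvar b.
Proof. by rewrite /yvar opprD addrACA subrr add0r. Qed.

Lemma regunit_linear c d a b : c != d -> regunit (kc c * yvar a - kc d * yvar b).
Proof.
move=> cd; rewrite /kc /yvar /xvar -tofrac1 -!tofracD -!tofracM -tofracB.
apply: regunit_poly; rewrite at0B !at0M !at0D !at01 !at0C !at0X !addr0 !mulr1.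
by rewrite subr_eq0.
Qed.

Lemma regular_kc c : regular (kc c). Proof. exact: regular_poly. Qed.
Lemma regular_yvar a : regular (yvar a).
Proof. by apply: regularD; [exact: regular1|exact: regular_poly]. Qed.

Lemma regunit_kc c : c != 0 -> regunit (kc c).
Proof. by move=> c0; apply: regunit_poly; rewrite at0C. Qed.

Lemma regunit_yvar a : regunit (yvar a).
Proof.
rewrite /yvar /xvar -tofrac1 -tofracD; apply: regunit_poly.
by rewrite at0D at01 at0X addr0 oner_neq0.
Qed.

Lemma linear_neq0 nu a b : nu a != nu b ->
  cvar nu a * yvar a - cvar nu b * yvar b != 0.
Proof. by move=> ab; apply: regunit_neq0; apply: regunit_linear; rewrite val_eqE. Qed.

(** At the origin the factors of [alpha] take the values [q - 1] if [c = d],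
    [q^{-1} - 1] if [d = q c], and [q c - d] and [c - d] otherwise. *)
Lemma regunit_alpha c d a b : q != 1 ->
  regunit (alpha (kc q) (kc c) (kc d) (yvar a) (yvar b)).
Proof.
move=> q1; rewrite /alpha -kcM !kc_eq -kcV.
have [cd|cd] := eqVneq c d.
  by rewrite -[yvar b]mul1r -kc1; exact: regunit_linear.
have [dE|dq] := eqVneq d (q * c).
  apply: regunitN; apply: regunitV; rewrite -[yvar b]mul1r -kc1.
  by apply: regunit_linear; rewrite -(inj_eq invr_inj) invrK invr1.
apply: regunitM; first by apply: regunit_linear; rewrite eq_sym.
by apply: regunitV; exact: regunit_linear.
Qed.

Lemma regular_beta c d a b :
  regular (beta (kc q) (kc c) (kc d) (yvar a) (yvar b)).
Proof.
rewrite /beta kc_eq; case: eqVneq => cd; first exact: regular_kc.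
apply: regularM; last first.
  by apply: regunit_regular; apply: regunitV; exact: regunit_linear.
by rewrite -kc1 -kcB -kcM; apply: regularM; [exact: regular_kc|exact: regular_yvar].
Qed.

Definition xfun a : A := wfun_of (fun=> xvar a).
(** The function by which [X_a] acts. *)
Definition eigfun a : A := wfun_of (fun nu => cvar nu a * yvar a).
Definition eigVfun a : A := wfun_of (fun nu => (cvar nu a * yvar a)^-1).
Definition indfun nu0 : A := wfun_of (fun nu => (nu == nu0)%:R).
Definition alphafun a b : A :=
  wfun_of (fun nu => alpha (kc q) (cvar nu a) (cvar nu b) (yvar a) (yvar b)).
Definition alphaVfun a b : A :=
  wfun_of (fun nu => (alpha (kc q) (cvar nu a) (cvar nu b) (yvar a) (yvar b))^-1).
Definition betafun a b : A :=
  wfun_of (fun nu => beta (kc q) (cvar nu a) (cvar nu b) (yvar a) (yvar b)).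
Definition Qfun a b : A :=
  wfun_of (fun nu => quiverQ (kc q) (cvar nu a) (cvar nu b) (yvar a) (yvar b)).
Definition polyfun (p : L -> {mpoly k[n]}) : A := wfun_of (fun nu => (p nu)%:F).
Definition kfun c : A := wfun_of (fun=> kc c).

(** The transposition of [i] and [i + 1] moves the weight and the variables. *)
Definition swapfun i f : A :=
  wfun_of (fun nu => fsym (tperm (pos0 i) (pos1 i)) (f (sact i nu))).
(** The term that appears when a function is moved past [tau_i]. *)
Definition difffun i f : A :=
  wfun_of (fun nu => divdiff (nu (pos0 i) == nu (pos1 i))
    (fsym (tperm (pos0 i) (pos1 i)) (f (sact i nu))) (f nu)
    (yvar (pos0 i) - yvar (pos1 i))).

Lemma swapfunE i f nu :
  swapfun i f nu = fsym (tperm (pos0 i) (pos1 i)) (f (sact i nu)).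
Proof. by apply: wfun_ofE; apply: regular_fsym; exact: wfvalP. Qed.

Lemma difffunE i f nu :
  difffun i f nu = divdiff (nu (pos0 i) == nu (pos1 i)) (swapfun i f nu) (f nu)
    (yvar (pos0 i) - yvar (pos1 i)).
Proof.
rewrite swapfunE; apply: wfun_ofE; rewrite /divdiff.
case: eqP => [nuE|_]; last exact: regular0.
(* [s_i] fixes the weight, so both values of [f] are taken at the same one. *)
rewrite (sact_id nuE) yvarB -tofracB; apply: regular_divdiff (pos01_neq i) _.
exact: wfvalP.
Qed.

Lemma swapfunD i f g : swapfun i (f + g) = swapfun i f + swapfun i g.
Proof. by apply: wfun_eq => nu; rewrite wfD !swapfunE wfD rmorphD. Qed.
Lemma swapfunM i f g : swapfun i (f * g) = swapfun i f * swapfun i g.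
Proof. by apply: wfun_eq => nu; rewrite wfM !swapfunE wfM rmorphM. Qed.

Lemma swap_difffunE i j f nu :
  swapfun i (difffun j f) nu =
  divdiff (nu (spos i (pos0 j)) == nu (spos i (pos1 j)))
    (swapfun i (swapfun j f) nu) (swapfun i f nu)
    (yvar (spos i (pos0 j)) - yvar (spos i (pos1 j))).
Proof.
rewrite ![swapfun i _ nu]swapfunE difffunE divdiff_morph rmorphB /=.
by rewrite !fsym_yvar !sactE.
Qed.

Lemma kfunE c nu : kfun c nu = kc c.
Proof. by apply: wfun_ofE; exact: regular_kc. Qed.
Lemma xfunE a nu : xfun a nu = xvar a.
Proof. by apply: wfun_ofE; exact: regular_poly. Qed.
Lemma eigfunE a nu : eigfun a nu = cvar nu a * yvar a.
Proof. by apply: wfun_ofE; apply: regularM; [exact: regular_kc|exact: regular_yvar]. Qed.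
Lemma indfunE nu0 nu : indfun nu0 nu = (nu == nu0)%:R.
Proof. by apply: wfun_ofE; case: eqP => _; [exact: regular1|exact: regular0]. Qed.
Lemma betafunE a b nu :
  betafun a b nu = beta (kc q) (cvar nu a) (cvar nu b) (yvar a) (yvar b).
Proof. by apply: wfun_ofE; exact: regular_beta. Qed.
Lemma polyfunE p nu : polyfun p nu = (p nu)%:F.
Proof. by apply: wfun_ofE; exact: regular_poly. Qed.
Lemma regular_yvarB a b : regular (yvar a - yvar b).
Proof. by apply: regularD; [|apply: regularN]; exact: regular_yvar. Qed.
Lemma QfunE a b nu :
  Qfun a b nu = quiverQ (kc q) (cvar nu a) (cvar nu b) (yvar a) (yvar b).
Proof.
apply: wfun_ofE; rewrite /quiverQ; case: eqP => _; first exact: regular0.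
by do 2!case: eqP => _; rewrite ?expr0 ?expr1 ?mul1r ?mulr1;
   (exact: regular1 || exact: regular_yvarB || (apply: regularM; exact: regular_yvarB)).
Qed.

Hypotheses (q0 : q != 0) (q1 : q != 1) (I0 : 0 \notin I).

Lemma cvar_neq0 nu a : cvar nu a != 0.
Proof. by apply: kc_neq0; apply: contraNneq I0 => <-; exact: valP (nu a). Qed.

Lemma regunit_eig nu a : regunit (cvar nu a * yvar a).
Proof.
apply: regunitM (regunit_yvar a); apply: regunit_kc.
by apply: contraNneq I0 => <-; exact: valP (nu a).
Qed.

Lemma alphafunE a b nu :
  alphafun a b nu = alpha (kc q) (cvar nu a) (cvar nu b) (yvar a) (yvar b).
Proof. by apply: wfun_ofE; apply: regunit_regular; exact: regunit_alpha. Qed.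

Lemma alphafunV a b : alphaVfun a b * alphafun a b = 1.
Proof.
apply: wfun_eq => nu; rewrite wfM wf1 alphafunE wfun_ofE.
  by rewrite mulVf //; apply: regunit_neq0; exact: regunit_alpha.
by apply: regunit_regular; apply: regunitV; exact: regunit_alpha.
Qed.

Lemma eigfunV a : eigVfun a * eigfun a = 1.
Proof.
apply: wfun_eq => nu; rewrite wfM wf1 eigfunE wfun_ofE.
  by rewrite mulVf //; apply: regunit_neq0; exact: regunit_eig.
by apply: regunit_regular; apply: regunitV; exact: regunit_eig.
Qed.

Lemma swap_cvar i nu a :
  fsym (tperm (pos0 i) (pos1 i)) (cvar (sact i nu) a) = cvar nu (spos i a).
Proof. by rewrite fsym_kc /cvar sactE. Qed.

Lemma swap_yvar i a :
  fsym (tperm (pos0 i) (pos1 i)) (yvar a) = yvar (spos i a).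
Proof. exact: fsym_yvar. Qed.

Lemma fsym_alpha (s : 'S_n) (e c d y z : K) :
  fsym s (alpha e c d y z) =
  alpha (fsym s e) (fsym s c) (fsym s d) (fsym s y) (fsym s z).
Proof. exact: alpha_morph. Qed.

Lemma fsym_beta (s : 'S_n) (e c d y z : K) :
  fsym s (beta e c d y z) =
  beta (fsym s e) (fsym s c) (fsym s d) (fsym s y) (fsym s z).
Proof. exact: beta_morph. Qed.

Lemma swap_alphafun i a b : swapfun i (alphafun a b) = alphafun (spos i a) (spos i b).
Proof.
apply: wfun_eq => nu; rewrite swapfunE [RHS]alphafunE alphafunE fsym_alpha fsym_kc.
by rewrite !swap_cvar !swap_yvar.
Qed.

Lemma swap_betafun i a b : swapfun i (betafun a b) = betafun (spos i a) (spos i b).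
Proof.
apply: wfun_eq => nu; rewrite swapfunE [RHS]betafunE betafunE fsym_beta fsym_kc.
by rewrite !swap_cvar !swap_yvar.
Qed.

Lemma swap_eigfun i a : swapfun i (eigfun a) = eigfun (spos i a).
Proof.
by apply: wfun_eq => nu; rewrite swapfunE [RHS]eigfunE eigfunE fsymM swap_cvar swap_yvar.
Qed.

Lemma swap_xfun i a : swapfun i (xfun a) = xfun (spos i a).
Proof. by apply: wfun_eq => nu; rewrite swapfunE [RHS]xfunE xfunE fsym_xvar. Qed.

End HeckeFunctions.

Arguments swap_alphafun {k q I n} q1 i a b.
Arguments swap_betafun {k q I n} i a b.
Arguments swap_eigfun {k I n} i a.
Arguments swap_xfun {k I n} i a.
Arguments alphafunE {k q I n} q1 a b nu.
Arguments alphafunV {k q I n} q1 a b.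
Arguments betafunE {k q I n} a b nu.
Arguments QfunE {k q I n} a b nu.
Arguments kc {k n} c.
Arguments xvar {k n} a.
Arguments yvar {k n} a.
Arguments kfun {k I n} c.
Arguments xfun {k I n} a.
Arguments eigfun {k I n} a.
Arguments eigVfun {k I n} a.
Arguments alphafun {k} q {I n} a b.
Arguments alphaVfun {k} q {I n} a b.
Arguments betafun {k} q {I n} a b.
Arguments Qfun {k} q {I n} a b.

(** * Hecke operators built from twisted derivations *)

Section SkewExpansion.

Variables (A : comPzRingType) (V : lmodType A).
Variables (t1 t2 : V -> V) (s1 s2 d1 d2 : A -> A) (a1 a2 b1 b2 Q1 : A).
Hypotheses (t1D : forall u v, t1 (u + v) = t1 u + t1 v)
  (t2D : forall u v, t2 (u + v) = t2 u + t2 v)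
  (t1Z : forall f v, t1 (f *: v) = s1 f *: t1 v + d1 f *: v)
  (t2Z : forall f v, t2 (f *: v) = s2 f *: t2 v + d2 f *: v)
  (t1K : forall v, t1 (t1 v) = Q1 *: v).

Let T1 v := a1 *: t1 v + b1 *: v.
Let T2 v := a2 *: t2 v + b2 *: v.

Let p := a2 * s2 a1.
Let r := a2 * d2 a1 + b2 * a1.
Let t := a2 * s2 b1.
Let w := a2 * d2 b1 + b2 * b1.

Lemma skew_comp2 v : T2 (T1 v) =
  p *: t2 (t1 v) + r *: t1 v + t *: t2 v + w *: v.
Proof.
rewrite /T1 /T2 t2D !t2Z !scalerDr !scalerA /p /r /t /w !scalerDl !addrA.
by rewrite [LHS](ACl (1*2*5*3*4*6)).
Qed.

Lemma skew_braid_expansion v : T1 (T2 (T1 v)) =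
  (a1 * s1 p) *: t1 (t2 (t1 v)) +
  (a1 * d1 p + b1 * p) *: t2 (t1 v) + (a1 * s1 t) *: t1 (t2 v) +
  (a1 * d1 r + a1 * s1 w + b1 * r) *: t1 v +
  (a1 * d1 t + b1 * t) *: t2 v +
  (a1 * s1 r * Q1 + a1 * d1 w + b1 * w) *: v.
Proof.
rewrite {1}/T1 skew_comp2 !t1D !t1Z t1K !scalerDr !scalerA !scalerDl !addrA.
by rewrite [LHS](ACl (1*2*9*5*4*7*10*6*11*3*8*12)).
Qed.

(** Nothing is assumed on [t1 t1], so that the quadratic relation for [T1] and
    the relation [t1 t1 = Q1] can be deduced from each other when [u] is
    invertible. *)
Lemma skew_square (c0 c1 u : A) :
  u = a1 * s1 a1 ->
  a1 * d1 a1 + a1 * s1 b1 + b1 * a1 = c1 * a1 ->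
  a1 * d1 b1 + b1 * b1 = c1 * b1 + c0 - u * Q1 ->
  forall v, T1 (T1 v) = u *: (t1 (t1 v) - Q1 *: v) + (c1 *: T1 v + c0 *: v).
Proof.
move=> uE ctau cone v; transitivity ((a1 * s1 a1) *: t1 (t1 v) +
    (a1 * d1 a1 + a1 * s1 b1 + b1 * a1) *: t1 v + (a1 * d1 b1 + b1 * b1) *: v).
  rewrite /T1 !t1D !t1Z !scalerDr !scalerA !scalerDl !addrA.
  by rewrite [LHS](ACl (1*2*3*5*4*6)).
rewrite ctau cone -uE /T1 scalerBr !scalerDr !scalerA !scalerDl scaleNr !addrA.
by rewrite [LHS](ACl (1*5*2*3*4)).
Qed.

End SkewExpansion.

Section SkewBraid.

Variables (A : comPzRingType) (V : lmodType A).
Variables (t1 t2 : V -> V) (s1 s2 d1 d2 : A -> A) (a1 a2 b1 b2 Q1 Q2 u D : A).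
Hypotheses (t1D : forall u v, t1 (u + v) = t1 u + t1 v)
  (t2D : forall u v, t2 (u + v) = t2 u + t2 v)
  (t1Z : forall f v, t1 (f *: v) = s1 f *: t1 v + d1 f *: v)
  (t2Z : forall f v, t2 (f *: v) = s2 f *: t2 v + d2 f *: v)
  (t1K : forall v, t1 (t1 v) = Q1 *: v)
  (t2K : forall v, t2 (t2 v) = Q2 *: v).

Let T1 v := a1 *: t1 v + b1 *: v.
Let T2 v := a2 *: t2 v + b2 *: v.

(** The hypotheses compare the coefficients of the words in [t1] and [t2] of
    length at most two in the two expansions; they leave [u] times the braid
    relation with right-hand side [D]. *)
Lemma skew_braid
    (p := a2 * s2 a1) (r := a2 * d2 a1 + b2 * a1)
    (t := a2 * s2 b1) (w := a2 * d2 b1 + b2 * b1)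
    (p' := a1 * s1 a2) (r' := a1 * d1 a2 + b1 * a2)
    (t' := a1 * s1 b2) (w' := a1 * d1 b2 + b1 * b2) :
  a1 * s1 p = u -> a2 * s2 p' = u ->
  a1 * d1 p + b1 * p = a2 * s2 t' -> a1 * s1 t = a2 * d2 p' + b2 * p' ->
  a1 * d1 r + a1 * s1 w + b1 * r = a2 * d2 t' + b2 * t' ->
  a1 * d1 t + b1 * t = a2 * d2 r' + a2 * s2 w' + b2 * r' ->
  a1 * s1 r * Q1 + a1 * d1 w + b1 * w =
    a2 * s2 r' * Q2 + a2 * d2 w' + b2 * w' + u * D ->
  forall v, T1 (T2 (T1 v)) - T2 (T1 (T2 v)) =
    u *: (t1 (t2 (t1 v)) - t2 (t1 (t2 v)) + D *: v).
Proof.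
move=> up up' c21 c12 c1 c2 c0 v.
rewrite /T1 /T2 (skew_braid_expansion _ _ _ _ t1D t2D t1Z t2Z t1K).
rewrite (skew_braid_expansion _ _ _ _ t2D t1D t2Z t1Z t2K).
rewrite -/p -/r -/t -/w -/p' -/r' -/t' -/w' up up' c21 c12 c1 c2 c0.
set e := a2 * s2 r' * Q2 + _ + _.
rewrite [(e + _) *: v]scalerDl !scalerDr scalerN scalerA !opprD !addrA.
set x1 := u *: t1 (t2 (t1 v)); set x2 := u *: t2 (t1 (t2 v)).
set x3 := _ *: t2 (t1 v); set x4 := _ *: t1 (t2 v).
set x5 := _ *: t1 v; set x6 := _ *: t2 v; set x7 := e *: v.
rewrite [LHS](ACl (1*8*7*(2*10)*(3*9)*(4*12)*(5*11)*(6*13))) /=.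
by rewrite !subrr !addr0.
Qed.

End SkewBraid.

(** What the Hecke relations need to know of the ring of functions: evaluations
    in a field that separate its elements, the values of the functions
    involved, and the operators [s_i] and [d_i]. Relations in the ring become
    the identities of rational functions above. *)
Record hecke_frame (F : fieldType) (A : comPzRingType) (n : nat) := HeckeFrame {
  hf_point : Type;
  ev : hf_point -> A -> F;
  ev_inj : forall f g, (forall nu, ev nu f = ev nu g) -> f = g;
  evD : forall nu f g, ev nu (f + g) = ev nu f + ev nu g;
  evM : forall nu f g, ev nu (f * g) = ev nu f * ev nu g;
  evN : forall nu f, ev nu (- f) = - ev nu f;
  ev1 : forall nu, ev nu 1 = 1;
  hf_q : F;
  hf_c : hf_point -> 'I_n -> F;
  hf_y : 'I_n -> F;
  hf_q_neq0 : hf_q != 0;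
  hf_c_neq0 : forall nu a, hf_c nu a != 0;
  hf_y_neq : forall a b, a != b -> hf_y a - hf_y b != 0;
  hf_cy_neq : forall nu a b, hf_c nu a != hf_c nu b ->
    hf_c nu a * hf_y a - hf_c nu b * hf_y b != 0;
  fq : A;
  fX : 'I_n -> A;
  fal : 'I_n -> 'I_n -> A;
  fbe : 'I_n -> 'I_n -> A;
  fQ : 'I_n -> 'I_n -> A;
  swap : 'I_n.-1 -> A -> A;
  diff : 'I_n.-1 -> A -> A;
  ev_q : forall nu, ev nu fq = hf_q;
  ev_X : forall nu a, ev nu (fX a) = hf_c nu a * hf_y a;
  ev_al : forall nu a b, ev nu (fal a b) =
    alpha hf_q (hf_c nu a) (hf_c nu b) (hf_y a) (hf_y b);
  ev_be : forall nu a b, ev nu (fbe a b) =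
    beta hf_q (hf_c nu a) (hf_c nu b) (hf_y a) (hf_y b);
  ev_Q : forall nu a b, ev nu (fQ a b) =
    quiverQ hf_q (hf_c nu a) (hf_c nu b) (hf_y a) (hf_y b);
  swapD : forall i f g, swap i (f + g) = swap i f + swap i g;
  swapM : forall i f g, swap i (f * g) = swap i f * swap i g;
  swap_X : forall i a, swap i (fX a) = fX (spos i a);
  swap_al : forall i a b, swap i (fal a b) = fal (spos i a) (spos i b);
  swap_be : forall i a b, swap i (fbe a b) = fbe (spos i a) (spos i b);
  ev_diff : forall i f nu, ev nu (diff i f) =
    divdiff (hf_c nu (pos0 i) == hf_c nu (pos1 i))
      (ev nu (swap i f)) (ev nu f) (hf_y (pos0 i) - hf_y (pos1 i));
  ev_swap_diff : forall i j f nu, ev nu (swap i (diff j f)) =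
    divdiff (hf_c nu (spos i (pos0 j)) == hf_c nu (spos i (pos1 j)))
      (ev nu (swap i (swap j f))) (ev nu (swap i f))
      (hf_y (spos i (pos0 j)) - hf_y (spos i (pos1 j))) }.

Section HeckeOperators.

Variables (F : fieldType) (A : comPzRingType) (n : nat) (H : hecke_frame F A n).
Variables (V : lmodType A) (tau : 'I_n.-1 -> V -> V).
Hypotheses (tauD : forall i u v, tau i (u + v) = tau i u + tau i v).
Hypotheses (tauZ : forall i (f : A) v,
  tau i (f *: v) = swap H i f *: tau i v + diff H i f *: v).

Local Notation al i := (fal H (pos0 i) (pos1 i)).
Local Notation be i := (fbe H (pos0 i) (pos1 i)).
Local Notation Qf i := (fQ H (pos0 i) (pos1 i)).

Definition hecke_op i (v : V) : V := al i *: tau i v + be i *: v.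

Lemma hecke_opD i u v : hecke_op i (u + v) = hecke_op i u + hecke_op i v.
Proof. by rewrite /hecke_op tauD !scalerDr addrACA. Qed.

Lemma hecke_opZ i f v : swap H i f = f -> diff H i f = 0 ->
  hecke_op i (f *: v) = f *: hecke_op i v.
Proof.
move=> sf df; rewrite /hecke_op tauZ sf df scale0r addr0 scalerDr !scalerA.
by rewrite mulrC [be i * f]mulrC.
Qed.

(** As in [hecke_op_far] and [hecke_op_braid], the relation for the [hecke_op]
    is an invertible multiple of the one for the [tau]: either of the two
    implies the other. *)
Lemma hecke_op_square i v :
  hecke_op i (hecke_op i v) =
  (al i * fal H (pos1 i) (pos0 i)) *: (tau i (tau i v) - Qf i *: v) +
  ((fq H - 1) *: hecke_op i v + fq H *: v).
Proof.
apply: (skew_square (tauD i) (tauZ i)).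
- by rewrite swap_al spos0 spos1.
- rewrite swap_be spos0 spos1; apply: (ev_inj (h := H)) => nu.
  rewrite !(evD, evM, evN, ev1) ev_diff swap_al spos0 spos1 ev_q !ev_al !ev_be.
  have := quadratic_coef_tau (hf_q H) (hf_y_neq H (pos01_neq i))
            (@hf_cy_neq _ _ _ H nu _ _).
  by move=> /eqP; rewrite subr_eq0 => /eqP <-; ring.
- apply: (ev_inj (h := H)) => nu.
  rewrite !(evD, evM, evN, ev1) ev_diff swap_be spos0 spos1 ev_q ev_Q !ev_al !ev_be.
  by apply: quadratic_coef_const => [||| /hf_cy_neq];
     rewrite ?hf_q_neq0 ?hf_c_neq0.
Qed.

Lemma hecke_op_X i v :
  hecke_op i (fX H (pos1 i) *: v) - fX H (pos0 i) *: hecke_op i v =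
  ((fq H - 1) * fX H (pos1 i)) *: v.
Proof.
rewrite /hecke_op tauZ !scalerDr !scalerA swap_X spos1.
have <- : al i * diff H i (fX H (pos1 i)) +
    be i * (fX H (pos1 i) - fX H (pos0 i)) = (fq H - 1) * fX H (pos1 i).
  apply: (ev_inj (h := H)) => nu.
  rewrite !(evD, evM, evN, ev1) ev_diff swap_X spos1 ev_q !ev_X ev_al ev_be.
  exact: (alpha_beta_commutator (hf_q H) (hf_y_neq H (pos01_neq i))
     (@hf_cy_neq _ _ _ H nu (pos0 i) (pos1 i))).
rewrite mulrBr !scalerDl scaleNr opprD !addrA [be i * fX H (pos0 i)]mulrC.
rewrite [al i * fX _ _]mulrC.
by rewrite [LHS](ACl ((1*4)*2*3*5)) /= subrr add0r.
Qed.

Lemma hecke_op_X_far i a v : a != pos0 i -> a != pos1 i ->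
  hecke_op i (fX H a *: v) = fX H a *: hecke_op i v.
Proof.
move=> a0 a1; have sa : spos i a = a by rewrite sposD // eq_sym.
rewrite /hecke_op tauZ !scalerDr !scalerA swap_X sa.
have -> : diff H i (fX H a) = 0.
  apply: (ev_inj (h := H)) => nu.
  rewrite ev_diff swap_X sa /divdiff subrr mul0r.
  by rewrite -(addrN (1 : A)) evD evN subrr; case: ifP.
by rewrite mulr0 scale0r addr0 mulrC [be i * _]mulrC.
Qed.

Lemma hecke_op_far (i j : 'I_n.-1) v : (i.+1 < j)%N || (j.+1 < i)%N ->
  hecke_op i (hecke_op j v) - hecke_op j (hecke_op i v) =
  (al i * al j) *: (tau i (tau j v) - tau j (tau i v)).
Proof.
have ev0 nu : ev (h := H) nu 0 = 0 by rewrite -(addrN (1 : A)) evD evN subrr.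
suff D (a b : 'I_n.-1) : (a.+1 < b)%N || (b.+1 < a)%N ->
    [/\ swap H a (al b) = al b, swap H a (be b) = be b,
        diff H a (al b) = 0 & diff H a (be b) = 0].
  move=> ij; have [sa sb da db] := D i j ij.
  have [sa' sb' da' db'] := D j i (eq_trans (orbC _ _) ij).
  rewrite /hecke_op !tauD !tauZ sa sb da db sa' sb' da' db' !scale0r !addr0.
  rewrite !scalerDr !scalerN !scalerA opprD !opprD !addrA.
  rewrite [al j * al i]mulrC [be j * al i]mulrC [al j * be i]mulrC.
  rewrite [be j * be i]mulrC.
  by rewrite [LHS](ACl (1*5*(2*7)*(3*6)*(4*8))) /= !subrr !addr0.
move=> ab; have sp : spos a (pos0 b) = pos0 b /\ spos a (pos1 b) = pos1 b.
  by split; apply: sposD; rewrite -val_eqE /=; case/orP: ab; lia.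
have [sp0 sp1] := sp; have sal : swap H a (al b) = al b by rewrite swap_al sp0 sp1.
have sbe : swap H a (be b) = be b by rewrite swap_be sp0 sp1.
split=> //; apply: (ev_inj (h := H)) => nu.
  by rewrite ev_diff sal /divdiff subrr mul0r ev0; case: ifP.
by rewrite ev_diff sbe /divdiff subrr mul0r ev0; case: ifP.
Qed.

Lemma hecke_op_braid (i j : 'I_n.-1) (D : A) :
  j = i.+1 :> nat ->
  (forall v, tau i (tau i v) = Qf i *: v) ->
  (forall v, tau j (tau j v) = Qf j *: v) ->
  (forall nu, ev (h := H) nu D =
     divdiff (hf_c nu (pos0 i) == hf_c nu (pos1 j))
       (quiverQ (hf_q H) (hf_c nu (pos0 i)) (hf_c nu (pos1 i)) (hf_y H (pos1 j)) (hf_y H (pos1 i)))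
       (quiverQ (hf_q H) (hf_c nu (pos0 i)) (hf_c nu (pos1 i)) (hf_y H (pos0 i)) (hf_y H (pos1 i)))
       (hf_y H (pos1 j) - hf_y H (pos0 i))) ->
  forall v,
  hecke_op i (hecke_op j (hecke_op i v)) - hecke_op j (hecke_op i (hecke_op j v)) =
  (al i * al j * fal H (pos0 i) (pos1 j)) *:
    (tau i (tau j (tau i v)) - tau j (tau i (tau j v)) + D *: v).
Proof.
move=> ij tauKi tauKj DE.
have p1 : pos0 j = pos1 i by apply: val_inj; rewrite /= ij.
have p01 := pos01_neq i; have p12 := pos01_neq j; rewrite p1 in p12.
have p02 : pos0 i != pos1 j by rewrite -val_eqE /= ij; lia.
have [si0 si1 si2] : [/\ spos i (pos0 i) = pos1 i, spos i (pos1 i) = pos0 i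
    & spos i (pos1 j) = pos1 j] by rewrite spos0 spos1 sposD // eq_sym.
have [sj0 sj1 sj2] : [/\ spos j (pos0 i) = pos0 i, spos j (pos1 i) = pos1 j
    & spos j (pos1 j) = pos1 i] by split; rewrite -?p1 ?spos0 ?spos1 // sposD // ?p1 eq_sym.
apply: (skew_braid (tauD i) (tauD j) (tauZ i) (tauZ j) tauKi tauKj);
  rewrite ?p1 ?(swapM, swapD) ?(swap_al, swap_be) ?(si0, si1, si2, sj0, sj1, sj2)
     ?(swap_al, swap_be) ?(si0, si1, si2, sj0, sj1, sj2).
- by rewrite mulrA mulrAC.
- by rewrite mulrCA mulrC [X in X * _ = _]mulrC.
1-5: apply: (ev_inj (h := H)) => nu; rewrite !(evD, evM) ?DE
    ?(ev_diff, ev_swap_diff) ?p1 ?(swapM, swapD) ?(swap_al, swap_be)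
    ?(si0, si1, si2, sj0, sj1, sj2) ?(evD, evM) ?(ev_diff, ev_swap_diff)
    ?(swap_al, swap_be) ?p1 ?(si0, si1, si2, sj0, sj1, sj2)
    ?(swap_al, swap_be) ?(si0, si1, si2, sj0, sj1, sj2) ?(ev_al, ev_be, ev_Q).
- by rewrite /divdiff [X in X - _]mulrC subrr mul0r if_same mulr0 add0r mulrC mulrA.
- by rewrite /divdiff [X in X - _]mulrC subrr mul0r if_same mulr0 add0r mulrA mulrC.
- by apply: braid_coef_tau1; rewrite ?hf_q_neq0 ?hf_c_neq0 ?hf_y_neq //;
    exact: hf_cy_neq.
- by apply: braid_coef_tau2; rewrite ?hf_q_neq0 ?hf_c_neq0 ?hf_y_neq //;
    exact: hf_cy_neq.
- by apply: braid_coef_const; rewrite ?hf_q_neq0 ?hf_c_neq0 ?hf_y_neq //;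
    exact: hf_cy_neq.
Qed.

End HeckeOperators.

(** * Weight decompositions *)

Definition weight_frame (k : fieldType) (q : k) (I : {pred k}) (n : nat)
    (q0 : q != 0) (q1 : q != 1) (I0 : 0 \notin I) :
  hecke_frame (ratfun k n) (wfun k n {ffun 'I_n -> vert I}) n.
Proof.
pose L := {ffun 'I_n -> vert I}.
refine (@HeckeFrame _ (wfun k n L) n L (fun nu f => f nu) _ _ _ _ _ (kc q)
  (@cvar k I n) (@yvar k n) (kc_neq0 _ q0) _ _ _ (kfun q) (@eigfun k I n)
  (alphafun q) (betafun q) (Qfun q) (@swapfun k I n) (@difffun k I n)
  _ _ _ _ _ _ _ _ _ _ _ _).
- exact: wfun_eq.
- by move=> nu f g; exact: wfD.
- by move=> nu f g; exact: wfM.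
- by move=> nu f; exact: wfN.
- exact: wf1.
- exact: cvar_neq0.
- by move=> a b ab; rewrite yvarB xvar_neq.
- by move=> nu a b; rewrite cvar_eq; exact: linear_neq0.
- by move=> nu; exact: kfunE.
- by move=> nu a; exact: eigfunE.
- by move=> nu a b; exact: (alphafunE q1).
- by move=> nu a b; exact: betafunE.
- by move=> nu a b; exact: QfunE.
- exact: swapfunD.
- exact: swapfunM.
- exact: swap_eigfun.
- exact: (swap_alphafun q1).
- exact: swap_betafun.
- by move=> i f nu; rewrite cvar_eq; exact: difffunE.
- by move=> i j f nu; rewrite cvar_eq; exact: swap_difffunE.
Defined.

(** What the two kinds of modules have in common: the projections [we nu] to the
    weight spaces, and locally nilpotent commuting operators on each of these,
    extended by zero to the others. *)
Record weight_data (k : fieldType) (n : nat) (L : choiceType) (V : lmodType k) :=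
  WeightData {
    we : L -> V -> V;
    wx : L -> 'I_n -> V -> V;
    we_linear : forall nu, linear (we nu);
    we_ortho : forall nu mu v, we nu (we mu v) = if nu == mu then we nu v else 0;
    we_fin : forall v, exists s : seq L, uniq s /\ v = \sum_(nu <- s) we nu v;
    wx_linear : forall nu a, linear (wx nu a);
    wx_comm : forall nu a b v, wx nu a (wx nu b v) = wx nu b (wx nu a v);
    wx_we : forall nu a v, wx nu a (we nu v) = wx nu a v;
    we_wx : forall nu a v, we nu (wx nu a v) = wx nu a v;
    wx_nil : forall nu a v, exists N, iter N (wx nu a) v = 0 }.

Section WeightSums.

Variables (k : fieldType) (n : nat) (L : choiceType) (V : lmodType k).
Variable W : weight_data n L V.
Local Notation e := (we W).

Lemma weD nu u v : e nu (u + v) = e nu u + e nu v.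
Proof. by have := we_linear W nu 1 u v; rewrite !scale1r. Qed.

Lemma we0 nu : e nu 0 = 0.
Proof. by apply: (addrI (e nu 0)); rewrite -weD !addr0. Qed.

Lemma weZ nu c v : e nu (c *: v) = c *: e nu v.
Proof. by have := we_linear W nu c v 0; rewrite we0 !addr0. Qed.

Lemma weB nu u v : e nu (u - v) = e nu u - e nu v.
Proof. by rewrite -scaleN1r weD weZ scaleN1r. Qed.

Lemma we_sum nu I (s : seq I) (F : I -> V) :
  e nu (\sum_(i <- s) F i) = \sum_(i <- s) e nu (F i).
Proof. exact: (big_morph _ (weD nu) (we0 nu)). Qed.

Lemma we_idem nu v : e nu (e nu v) = e nu v.
Proof. by rewrite we_ortho eqxx. Qed.

Lemma big_uniq_delta (s : seq L) (F : L -> V) nu :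
  uniq s -> (forall mu, mu != nu -> F mu = 0) ->
  \sum_(mu <- s) F mu = if nu \in s then F nu else 0.
Proof.
move=> us F0; case: ifP => [ns|/negbT ns].
  by rewrite (bigD1_seq nu) //= big1 ?addr0 // => mu /F0.
rewrite big_seq big1 // => mu mus; apply: F0; apply: contraNneq ns => <-.
by [].
Qed.

Lemma we_sep u v : (forall nu, e nu u = e nu v) -> u = v.
Proof.
move=> uv; apply/eqP; rewrite -subr_eq0; apply/eqP.
have [s [_ ->]] := we_fin W (u - v); rewrite big1 // => nu _.
by rewrite weB uv subrr.
Qed.

Lemma we_seq_notin (s : seq L) v nu : uniq s -> v = \sum_(mu <- s) e mu v ->
  nu \notin s -> e nu v = 0.
Proof.
move=> us -> ns; rewrite we_sum (big_uniq_delta (nu := nu)) ?(negPf ns) //.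
by move=> mu mn; rewrite we_ortho eq_sym (negPf mn).
Qed.

Definition wsupp v : seq L := sval (cid (we_fin W v)).

Lemma wsupp_uniq v : uniq (wsupp v).
Proof. by rewrite /wsupp; case: cid => s /= []. Qed.

Lemma wsuppE v : v = \sum_(nu <- wsupp v) e nu v.
Proof. by rewrite /wsupp; case: cid => s /= []. Qed.

(** An operator given weight by weight. Each vector has finitely many nonzero
    components, so the sum is finite even if there are infinitely many weights. *)
Definition wsum (G : L -> V -> V) v : V := \sum_(nu <- wsupp v) G nu (e nu v).

(** [phi] is the permutation of the weights that the operator induces. *)
Lemma we_wsum (G : L -> V -> V) (phi : L -> L) v mu : injective phi ->
  (forall nu, G nu 0 = 0) ->
  (forall ka nu w, e ka (G nu (e nu w)) = if ka == phi nu then G nu (e nu w) else 0) ->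
  e (phi mu) (wsum G v) = G mu (e mu v).
Proof.
move=> phi_inj G0 eG; rewrite we_sum (big_uniq_delta (nu := mu)) ?wsupp_uniq //.
  rewrite eG eqxx; case: ifP => // /negbT ms.
  by rewrite (we_seq_notin (wsupp_uniq v) (wsuppE v) ms) G0.
by move=> ka km; rewrite eG (inj_eq phi_inj) eq_sym (negPf km).
Qed.

End WeightSums.

Section WeightModule.

Variables (k : fieldType) (n : nat) (L : choiceType) (V : lmodType k).
Variable W : weight_data n L V.
Local Notation e := (we W).
Local Notation A := (wfun k n L).

Local Notation fact nu := (frac_act (wx W nu)).
Let xl nu : forall a, linear (wx W nu a) := wx_linear W nu.
Let xC nu := @wx_comm _ _ _ _ W nu.
Let xn nu := wx_nil W nu.

Lemma fact_we nu r v : regular r -> e nu (fact nu r v) = fact nu r (e nu v).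
Proof.
move=> rr; have xe a w : e nu (wx W nu a w) = wx W nu a (e nu w) by rewrite we_wx wx_we.
exact: (frac_act_morph (xl nu) (@xC nu) (xn nu) (xl nu) (@xC nu) (xn nu) (we_linear W nu) xe).
Qed.

Definition wact (f : A) : V -> V := wsum W (fun nu => fact nu (f nu)).

Lemma fact0 nu r : regular r -> fact nu r 0 = 0.
Proof.
move=> rr; have := frac_act_linear (xl nu) (@xC nu) (xn nu) rr 1 0 0.
by rewrite !scale1r addr0 -{1}[fact nu r 0]addr0 => /addrI/esym.
Qed.

Lemma we_wact f v nu : e nu (wact f v) = fact nu (f nu) (e nu v).
Proof.
apply: (we_wsum (phi := id)) => // [mu|ka mu w].
  by apply: fact0; exact: wfvalP.
case: eqVneq => [->|km]; rewrite -fact_we; try exact: wfvalP.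
  by rewrite we_idem.
by rewrite we_ortho (negPf km).
Qed.

Fact wact_scalerA f g v : wact f (wact g v) = wact (f * g) v.
Proof.
apply: (we_sep (W := W)) => nu; rewrite !we_wact wfM.
by rewrite (frac_actM (xl nu) (@xC nu) (xn nu)) //; exact: wfvalP.
Qed.

Fact wact_scale1r : left_id 1 wact.
Proof.
move=> v; apply: (we_sep (W := W)) => nu; rewrite !we_wact wf1.
by rewrite (frac_act1 (xl nu) (@xC nu) (xn nu)).
Qed.

Fact wact_scalerDr : right_distributive wact +%R.
Proof.
move=> f u v; apply: (we_sep (W := W)) => nu; rewrite weD !we_wact weD.
have := frac_act_linear (xl nu) (@xC nu) (xn nu)
   (wfvalP f nu) 1 (e nu u) (e nu v).
by rewrite !scale1r.
Qed.

Fact wact_scalerDl v : {morph wact^~ v : f g / f + g}.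
Proof.
move=> f g; apply: (we_sep (W := W)) => nu; rewrite weD !we_wact wfD.
by rewrite (frac_actD (xl nu) (@xC nu) (xn nu)) //; exact: wfvalP.
Qed.

End WeightModule.

(** A copy of the space that carries the action of functions on weights: the
    action depends on the weight data, not only on [V]. *)
Definition wspace (k : fieldType) (n : nat) (L : choiceType) (V : lmodType k)
  (W : weight_data n L V) : Type := V.

HB.instance Definition _ (k : fieldType) (n : nat) (L : choiceType) (V : lmodType k)
    (W : weight_data n L V) := GRing.Zmodule.on (wspace W).
HB.instance Definition _ (k : fieldType) (n : nat) (L : choiceType) (V : lmodType k)
    (W : weight_data n L V) :=
  GRing.Zmodule_isLmodule.Build (wfun k n L) (wspace W)
    (@wact_scalerA k n L V W) (@wact_scale1r k n L V W)
    (@wact_scalerDr k n L V W) (@wact_scalerDl k n L V W).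

(** * Twisted derivations of weight modules *)

Section TwistedDerivations.

Variables (A : comPzRingType) (V : lmodType A) (T : V -> V) (s d : A -> A).
Hypothesis TD : forall u v, T (u + v) = T u + T v.
Hypotheses (sD : forall f g, s (f + g) = s f + s g)
  (sM : forall f g, s (f * g) = s f * s g) (s1 : s 1 = 1).
Hypotheses (dD : forall f g, d (f + g) = d f + d g)
  (dM : forall f g, d (f * g) = s f * d g + d f * g) (d1 : d 1 = 0).

Definition twisted f : Prop := forall v, T (f *: v) = s f *: T v + d f *: v.

Lemma twistedD f g : twisted f -> twisted g -> twisted (f + g).
Proof.
by move=> tf tg v; rewrite scalerDl TD tf tg sD dD !scalerDl addrACA.
Qed.

Lemma twistedM f g : twisted f -> twisted g -> twisted (f * g).
Proof.
move=> tf tg v; rewrite -scalerA tf tg scalerDr !scalerA sM dM scalerDl.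
by rewrite addrA.
Qed.

(** The rule for [f] at [v] is the rule for [g] at [f v], solved for
    [T (f v)]. *)
Lemma twistedV f g : g * f = 1 -> twisted g -> twisted f.
Proof.
move=> gf tg v; have sfg : s f * s g = 1 by rewrite -sM mulrC gf.
have := tg (f *: v); rewrite scalerA gf scale1r => ->.
rewrite scalerDr !scalerA sfg scale1r -addrA -scalerDl -mulrA.
have : d (g * f) = 0 by rewrite gf.
rewrite dM => dgf; suff -> : s f * (d g * f) + d f = 0 by rewrite scale0r addr0.
by rewrite -[d f]mul1r -sfg -mulrA -mulrDr addrC dgf mulr0.
Qed.

End TwistedDerivations.

Lemma divdiffD (F : fieldType) b (f' f g' g x : F) :
  divdiff b (f' + g') (f + g) x = divdiff b f' f x + divdiff b g' g x.
Proof. by rewrite /divdiff; case: b; [rewrite -mulrDl opprD addrACA|rewrite addr0]. Qed.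

Lemma divdiffM (F : fieldType) b (f' f g' g x : F) :
  divdiff b (f' * g') (f * g) x = f' * divdiff b g' g x + divdiff b f' f x * g.
Proof. by rewrite /divdiff; case: b; move: x^-1 => y; ring. Qed.

Section WeightTwisted.

Variables (k : fieldType) (I : {pred k}) (n : nat).
Local Notation L := {ffun 'I_n -> vert I}.
Local Notation A := (wfun k n L).

Lemma difffunD i (f g : A) : difffun i (f + g) = difffun i f + difffun i g.
Proof.
apply: wfun_eq => nu; rewrite [RHS]wfD !difffunE swapfunD.
by rewrite [X in divdiff _ X]wfD [X in divdiff _ _ X]wfD divdiffD.
Qed.

Lemma difffunM i (f g : A) :
  difffun i (f * g) = swapfun i f * difffun i g + difffun i f * g.
Proof.
apply: wfun_eq => nu; rewrite [RHS]wfD [X in X + _]wfM [X in _ + X]wfM.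
rewrite !difffunE swapfunM.
by rewrite [X in divdiff _ X]wfM [X in divdiff _ _ X]wfM divdiffM.
Qed.

Definition constfun (r : ratfun k n) : A := wfun_of (fun=> r).

Lemma constfunE r nu : regular r -> constfun r nu = r.
Proof. exact: wfun_ofE. Qed.

Lemma swap_constfun i r : regular r ->
  swapfun i (constfun r) = constfun (fsym (tperm (pos0 i) (pos1 i)) r).
Proof.
move=> rr; apply: wfun_eq => nu; rewrite swapfunE !constfunE //.
exact: regular_fsym.
Qed.

Lemma indfun_idem (mu : L) : indfun mu * indfun mu = indfun mu :> A.
Proof.
apply: wfun_eq => nu; rewrite [LHS]wfM indfunE.
by case: eqP => _; rewrite ?mulr1 ?mulr0.
Qed.

Lemma mul_indfun (f g : A) (mu : L) : f mu = g mu -> f * indfun mu = g * indfun mu.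
Proof.
move=> fg; apply: wfun_eq => nu; rewrite [LHS]wfM [RHS]wfM indfunE.
by case: eqP => [->|_]; rewrite ?fg ?mulr0.
Qed.

Lemma kfun_const c : kfun c = constfun (kc c) :> A. Proof. by []. Qed.

Lemma swap_kfun i c : swapfun i (kfun c : A) = kfun c.
Proof.
by rewrite kfun_const swap_constfun ?fsym_kc //; exact: regular_kc.
Qed.

Lemma diff_kfun i c : difffun i (kfun c : A) = 0.
Proof.
apply: wfun_eq => nu; rewrite difffunE swap_kfun wf0 /divdiff subrr mul0r.
by case: ifP.
Qed.

Lemma kfun1 : kfun 1 = 1 :> A.
Proof. by apply: wfun_eq => nu; rewrite [RHS]wf1 [LHS]kfunE kc1. Qed.

Lemma swapfun1 i : swapfun i (1 : A) = 1.
Proof. by rewrite -kfun1 swap_kfun. Qed.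

Lemma difffun1 i : difffun i (1 : A) = 0.
Proof. by rewrite -kfun1 diff_kfun. Qed.

Variables (V : lmodType k) (W : weight_data n L V).
Local Notation M := (wspace W).
Local Notation e := (we W).
Local Notation x := (wx W).

Lemma we_scale nu (f : A) (v : M) :
  e nu (f *: v) = frac_act (x nu) (f nu) (e nu v).
Proof. exact: we_wact. Qed.

Let xl nu : forall a, linear (x nu a) := wx_linear W nu.
Let xC nu := @wx_comm _ _ _ _ W nu.
Let xn nu := wx_nil W nu.

Lemma kfun_scale c (v : M) : kfun c *: v = (c *: (v : V)) :> V.
Proof.
apply: (we_sep (W := W)) => nu; rewrite we_scale kfunE weZ.
by rewrite (frac_act_poly (xl nu) (@xC nu) (xn nu)) poly_actC.
Qed.

Lemma indfun_scale nu (v : M) : indfun nu *: v = e nu v.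
Proof.
apply: (we_sep (W := W)) => mu; rewrite we_scale indfunE we_ortho.
case: eqP => [->|_].
  by rewrite (frac_act1 (xl nu) (@xC nu) (xn nu)).
rewrite mulr0n -tofrac0 (frac_act_poly (xl mu) (@xC mu) (xn mu)).
by rewrite poly_act0l.
Qed.

Lemma wspace_sum (v : M) :
  exists s : seq L, uniq s /\ v = \sum_(nu <- s) indfun nu *: v.
Proof.
have [s [us vE]] := we_fin W v; exists s; split=> //; rewrite {1}vE.
by apply: eq_bigr => nu _; rewrite indfun_scale.
Qed.

Variables (i : 'I_n.-1) (T : M -> M).
Hypothesis TD : forall u v, T (u + v) = T u + T v.
Hypothesis Tk : forall c v, T (kfun c *: v) = kfun c *: T v.
Hypothesis Tind : forall nu v,
  T (indfun nu *: v) = indfun (sact i nu) *: T v.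
Hypothesis Tx : forall a v, T (xfun a *: v) =
  xfun (spos i a) *: T v + difffun i (xfun a) *: v.

Local Notation tw := (twisted T (@swapfun k I n i) (@difffun k I n i)).

Lemma twisted_const_poly p : tw (constfun p%:F).
Proof.
elim/mpoly_gen_ind: p => [c|a|f g tf tg|f g tf tg].
- rewrite -/(kc c) -kfun_const => v.
  by rewrite Tk swap_kfun diff_kfun scale0r addr0.
- by move=> v; rewrite [LHS]Tx -swap_xfun.
- have -> : constfun (f + g)%:F = constfun f%:F + constfun g%:F.
    apply: wfun_eq => nu; rewrite wfD !constfunE; try exact: regular_poly.
    exact: tofracD.
  exact: (twistedD TD (@swapfunD _ _ _ i) (@difffunD i)).
- have -> : constfun (f * g)%:F = constfun f%:F * constfun g%:F.
    apply: wfun_eq => nu; rewrite wfM !constfunE; try exact: regular_poly.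
    exact: tofracM.
  exact: (twistedM (@swapfunM _ _ _ i) (@difffunM i)).
Qed.

Lemma twisted_const r : regular r -> tw (constfun r).
Proof.
move=> [p [b [b0 rE]]].
have bu : regunit b%:F by exact: regunit_poly.
have -> : constfun r = constfun p%:F * constfun b%:F^-1.
  apply: wfun_eq => nu; rewrite wfM !constfunE //.
  - exact: regunit_regular (regunitV bu).
  - exact: regular_poly.
  - by exists p, b.
apply: (twistedM (@swapfunM _ _ _ i) (@difffunM i)).
  exact: twisted_const_poly.
apply: (twistedV (@swapfunM _ _ _ i) (swapfun1 i) (@difffunM i) (difffun1 i)
          (g := constfun b%:F)).
  apply: wfun_eq => nu; rewrite wf1 wfM !constfunE ?mulfV ?at0_neq0 //.
    exact: regunit_regular (regunitV bu).
  exact: regular_poly.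
exact: twisted_const_poly.
Qed.

(** On the weight space of [nu] only the value [f nu] matters, so [f] may be
    replaced by a constant function. Constants are obtained from the scalars
    and the [x_a] by sums, products and inverses, and all these preserve the
    rule. *)
Lemma weight_twisted f : tw f.
Proof.
move=> v; have T0 : T 0 = 0 by apply: (addrI (T 0)); rewrite -TD !addr0.
have [s [_ vE]] := wspace_sum v.
have E (g : A) : g *: v = \sum_(nu <- s) g *: (indfun nu *: v).
  by rewrite -scaler_sumr -vE.
rewrite E (big_morph T TD T0) [X in _ *: T X]vE (big_morph T TD T0) [X in _ + X]E.
rewrite scaler_sumr -big_split; apply: eq_bigr => nu _ /=.
have fr := wfvalP f nu; have rc := regular_fsym (tperm (pos0 i) (pos1 i)) fr.
rewrite {1}scalerA (@mul_indfun f (constfun (f nu)) nu) ?constfunE // -scalerA.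
rewrite twisted_const // Tind !scalerA; congr (_ *: _ + _ *: _).
  apply: mul_indfun; rewrite swap_constfun // constfunE // swapfunE sactK.
  by [].
apply: mul_indfun; rewrite !difffunE swap_constfun // !constfunE // swapfunE.
by rewrite /divdiff; case: eqP => // nuE; rewrite (sact_id nuE).
Qed.

End WeightTwisted.

(** * Actions of presented algebras *)

Fixpoint nx_eval (k : fieldType) (G : Type) (V : lmodType k) (rho : G -> V -> V)
    (x : nexpr k G) (v : V) : V :=
  match x with
  | NGen g => rho g v
  | NZero => 0
  | NAdd x y => nx_eval rho x v + nx_eval rho y v
  | NScale c x => c *: nx_eval rho x v
  | NMul x y => nx_eval rho x (nx_eval rho y v)
  end.

Section PresentedAction.

Variables (k : fieldType) (G : Type) (R : nrel k G) (V : lmodType k).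
Variable rho : G -> V -> V.
Hypothesis rho_linear : forall g, linear (rho g).
Hypothesis rho_rel : forall x y v, R x y -> nx_eval rho x v = nx_eval rho y v.

Lemma nx_eval_linear x : linear (nx_eval rho x).
Proof.
elim: x => [g||x IHx y IHy|c x IHx|x IHx y IHy] d u v /=.
- exact: rho_linear.
- by rewrite scaler0 addr0.
- by rewrite IHx IHy scalerDr addrACA.
- by rewrite IHx scalerDr !scalerA mulrC.
- by rewrite IHy IHx.
Qed.

Lemma nx_eval_cong x y v : ncong R x y -> nx_eval rho x v = nx_eval rho y v.
Proof.
move=> xy; elim: xy v => {x y} //=.
- by move=> x y xy v; exact: rho_rel.
- by move=> x y z _ xy _ yz v; rewrite xy.
- by move=> x x' y y' _ xx _ yy v; rewrite xx yy.
- by move=> c x x' _ xx v; rewrite xx.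
- by move=> x x' y y' _ xx _ yy v; rewrite xx yy.
- by move=> x y z v; rewrite addrA.
- by move=> x y v; rewrite addrC.
- by move=> x v; rewrite add0r.
- by move=> x v; rewrite scaleN1r addNr.
- by move=> c d x v; rewrite scalerA.
- by move=> x v; rewrite scale1r.
- by move=> c x y v; rewrite scalerDr.
- by move=> c d x v; rewrite scalerDl.
- by move=> x y z v; rewrite (linD _ _ (nx_eval_linear x)).
- by move=> c x y v; rewrite (linZ _ _ (nx_eval_linear x)).
Qed.

Definition presented_act (a : presented_alg R) (v : V) : V := nx_eval rho (rep a) v.

Lemma presented_act_cls x v : presented_act (cls R x) v = nx_eval rho x v.
Proof. by apply: nx_eval_cong; exact: rep_cls. Qed.

Fact presented_actDl a b v :
  presented_act (a + b) v = presented_act a v + presented_act b v.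
Proof. by rewrite -[a]repK -[b]repK [_ + _]cls_add !presented_act_cls. Qed.

Fact presented_actZl (r : k) a v :
  presented_act (r *: a) v = r *: presented_act a v.
Proof. by rewrite -[a]repK [_ *: _]cls_scale !presented_act_cls. Qed.

Fact presented_actDr a v w :
  presented_act a (v + w) = presented_act a v + presented_act a w.
Proof. exact: linD (nx_eval_linear _). Qed.

Fact presented_actZr (r : k) a v :
  presented_act a (r *: v) = r *: presented_act a v.
Proof. exact: linZ (nx_eval_linear _). Qed.

Fact presented_actM a b v :
  presented_act (numul a b) v = presented_act a (presented_act b v).
Proof. by rewrite -[a]repK -[b]repK [numul _ _]cls_mul !presented_act_cls. Qed.

(** The universal property of an algebra given by generators and relations. *)
Definition presented_action : action (presented_alg R) V :=
  Action presented_actDl presented_actZl presented_actDr presented_actZr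
    presented_actM.

Lemma presented_action_gen g v : presented_action (gen R g) v = rho g v.
Proof. exact: presented_act_cls. Qed.

End PresentedAction.

Section ActionTheory.

Variables (k : fieldType) (G : Type) (R : nrel k G) (V : lmodType k).
Variable M : action (presented_alg R) V.

Lemma act_linear (a : presented_alg R) : linear (M a).
Proof. by move=> c u v; rewrite actDr actZr. Qed.

Lemma act_cls x v : M (cls R x) v = nx_eval (fun g => M (gen R g)) x v.
Proof.
have M0 w : M 0 w = 0 by rewrite -(scale0r (0 : presented_alg R)) actZl scale0r.
elim: x v => [g||x IHx y IHy|c x IHx|x IHx y IHy] v //=.
- by rewrite -IHx -IHy -actDl; congr (M _ v); rewrite -cls_add.
- by rewrite -IHx -actZl; congr (M _ v); rewrite -cls_scale.
- by rewrite -IHy -IHx -actM; congr (M _ v); rewrite -cls_mul.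
Qed.

Lemma act_rel x y v : R x y ->
  nx_eval (fun g => M (gen R g)) x v = nx_eval (fun g => M (gen R g)) y v.
Proof. by move=> xy; rewrite -!act_cls; congr (M _ v); apply/clsP/nc_rel. Qed.

Lemma act0 a : M a 0 = 0.
Proof. exact: lin0 (act_linear a). Qed.

End ActionTheory.

(** For [f = id] this says that two actions agree if the generators do. *)
Lemma act_eq_gen (k : fieldType) (G : Type) (R : nrel k G) (V W : lmodType k)
    (M : action (presented_alg R) V) (N : action (presented_alg R) W)
    (f : V -> W) : linear f ->
  (forall g v, f (M (gen R g) v) = N (gen R g) (f v)) -> equivariant M N f.
Proof.
move=> fL fg a; elim/presented_ind: a => [//||a b IHa IHb|c a IHa|a b IHa IHb] v.
- by rewrite -(scale0r (0 : presented_alg R)) !actZl !scale0r (lin0 fL).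
- by rewrite !actDl (linD _ _ fL) IHa IHb.
- by rewrite !actZl (linZ _ _ fL) IHa.
- by rewrite !actM IHa IHb.
Qed.

Section KLRPolynomials.

Variables (k : fieldType) (n : nat) (S : Type) (V : lmodType k).
Variable rho : klr_gen n S -> V -> V.
Local Notation x nu := (fun a => rho (KX a nu)).

Lemma nx_eval_klr_poly nu f v :
  nx_eval rho (klr_poly nu f) v = poly_act (x nu) f (rho (KE nu) v).
Proof.
rewrite /klr_poly /poly_act; elim: (msupp f) => [|m s IHs] /=.
  by rewrite big_nil.
rewrite big_cons IHs; congr (_ *: _ + _); rewrite /klr_mon.
elim: (enum 'I_n) => //= a t <-; by elim: (m a) => //= j ->.
Qed.

End KLRPolynomials.

(** * The operators tau_i of a module over H_n(Gamma) *)

Section QuiverPolynomials.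

Variables (k : fieldType) (n : nat).

Lemma eval2M P P' (u v : {mpoly k[n]}) : eval2 (P * P') u v = eval2 P u v * eval2 P' u v.
Proof. exact: rmorphM. Qed.
Lemma eval2D P P' (u v : {mpoly k[n]}) : eval2 (P + P') u v = eval2 P u v + eval2 P' u v.
Proof. exact: rmorphD. Qed.
Lemma eval2B P P' (u v : {mpoly k[n]}) : eval2 (P - P') u v = eval2 P u v - eval2 P' u v.
Proof. exact: rmorphB. Qed.
Lemma eval2Xn P d (u v : {mpoly k[n]}) : eval2 (P ^+ d) u v = eval2 P u v ^+ d.
Proof. exact: rmorphXn. Qed.
Lemma eval2_0 (u v : {mpoly k[n]}) : eval2 (0 : {mpoly k[2]}) u v = 0.
Proof. exact: rmorph0. Qed.
Lemma eval2C c (u v : {mpoly k[n]}) : eval2 (c%:MP : {mpoly k[2]}) u v = c%:MP.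
Proof. exact: comp_mpolyC. Qed.
Lemma eval2X0 (u v : {mpoly k[n]}) : eval2 ('X_ord0 : {mpoly k[2]}) u v = u.
Proof. by rewrite /eval2 comp_mpolyXU. Qed.
Lemma eval2X1 (u v : {mpoly k[n]}) : eval2 ('X_ord_max : {mpoly k[2]}) u v = v.
Proof. by rewrite /eval2 comp_mpolyXU. Qed.

Lemma msym_eval2 (s : 'S_n) P (u v : {mpoly k[n]}) :
  msym s (eval2 P u v) = eval2 P (msym s u) (msym s v).
Proof.
elim/mpoly_gen_ind: P => [c|a|P P' IHP IHP'|P P' IHP IHP'].
- by rewrite !eval2C msym_polyC.
- by rewrite /eval2 !comp_mpolyXU; case: a => [[|[|]]].
- by rewrite !eval2D msymD IHP IHP'.
- by rewrite !eval2M msymM IHP IHP'.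
Qed.

(** The transposition of [a] and [c] turns [P(X_a, X_b)] into [P(X_c, X_b)]. *)
Lemma eval2_divisible P (a b c : 'I_n) : c != a -> b != a -> b != c ->
  exists D : {mpoly k[n]}, ('X_c - 'X_a) * D =
    eval2 P 'X_c 'X_b - eval2 P 'X_a 'X_b.
Proof.
move=> ca ba bc; have [D DE] := msym_tperm_sub c a (eval2 P 'X_a 'X_b : {mpoly k[n]}).
by exists D; rewrite -DE msym_eval2 !msym_polyX tpermR tpermD // eq_sym.
Qed.

End QuiverPolynomials.

Lemma eval2_quiverQ (k : fieldType) (q : k) (I : {pred k}) (n : nat)
    (c d : vert I) (a b : 'I_n) :
  (eval2 (Qpoly q c d) 'X_a 'X_b : {mpoly k[n]})%:F =
  quiverQ (kc q) (kc (val c)) (kc (val d)) (yvar a) (yvar b).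
Proof.
rewrite /Qpoly /quiverQ kc_eq val_eqE; case: eqP => _.
  by rewrite eval2_0 tofrac0.
rewrite eval2M tofracM /Ppoly !eval2Xn !eval2B !eval2X0 !eval2X1.
rewrite ?eval2Xn ?eval2B ?eval2X0 ?eval2X1 !tofracXn !tofracB !yvarB.
by rewrite /arrows -!kcM !kc_eq.
Qed.

Section WeightVectors.

Variables (k : fieldType) (I : {pred k}) (n : nat).
Local Notation L := {ffun 'I_n -> vert I}.
Local Notation A := (wfun k n L).
Variables (V : lmodType k) (W : weight_data n L V).
Local Notation M := (wspace W).
Local Notation e := (we W).
Local Notation x := (wx W).

Lemma scale_we (f : A) nu (v : V) :
  f *: (e nu v : M) = frac_act (x nu) (f nu) (e nu v) :> V.
Proof.
apply: (we_sep (W := W)) => mu; rewrite we_scale we_ortho.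
have [->|mn] := eqVneq mu nu.
  by rewrite fact_we ?we_idem //; exact: wfvalP.
rewrite fact0; last exact: wfvalP.
by rewrite -[e nu v]we_idem -fact_we ?we_ortho ?(negPf mn) //; exact: wfvalP.
Qed.

Lemma scale_we_poly (f : A) nu p (v : V) : f nu = p%:F ->
  f *: (e nu v : M) = poly_act (x nu) p (e nu v) :> V.
Proof.
move=> fE; rewrite scale_we fE.
exact: (frac_act_poly (wx_linear W nu) (@wx_comm _ _ _ _ W nu) (wx_nil W nu)).
Qed.

Lemma scale_we_const (f : A) nu c (v : V) : f nu = kc c ->
  f *: (e nu v : M) = c *: e nu v :> V.
Proof. by move=> fE; rewrite (scale_we_poly v fE) poly_actC. Qed.

Lemma scale_we_xfun a nu (v : V) : xfun a *: (e nu v : M) = x nu a v :> V.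
Proof.
have fE : (xfun a : A) nu = ('X_a)%:F by exact: xfunE.
by rewrite (scale_we_poly v fE) poly_actX ?wx_we //; exact: wx_linear.
Qed.

Lemma additive_we_ext (V' : zmodType) (F G : V -> V') :
  (forall u v, F (u + v) = F u + F v) -> (forall u v, G (u + v) = G u + G v) ->
  (forall nu v, F (e nu v) = G (e nu v)) -> forall v, F v = G v.
Proof.
move=> FD GD FG v.
have F0 : F 0 = 0 by apply: (addrI (F 0)); rewrite -FD !addr0.
have G0 : G 0 = 0 by apply: (addrI (G 0)); rewrite -GD !addr0.
rewrite (wsuppE W v) (big_morph F FD F0) (big_morph G GD G0).
by apply: eq_bigr => nu _; exact: FG.
Qed.

Lemma weight_direct_sum : direct_sum (fun nu v => e nu v = v).
Proof.
split=> [v|s w us we sw0 nu nus].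
  by exists (wsupp W v), (fun nu => e nu v); split=>
    [|nu|]; [exact: wsupp_uniq|exact: we_idem|exact: wsuppE].
have := congr1 (e nu) sw0; rewrite we0 we_sum (big_uniq_delta (nu := nu)) //.
  by rewrite nus we.
by move=> mu mn; rewrite -we we_ortho eq_sym (negPf mn).
Qed.

End WeightVectors.

Section KLRWeights.

Variables (k : fieldType) (q : k) (I : {pred k}) (n : nat).
Local Notation L := {ffun 'I_n -> vert I}.
Variables (V : lmodType k) (M : action (Hgamma q I n) V).
Local Notation e nu := (M (idem q nu)).
Local Notation x nu a := (M (xgen q a nu)).
Local Notation t i nu := (M (taugen q i nu)).

Lemma klr_e_ortho nu mu v : e nu (e mu v) = if nu == mu then e nu v else 0.
Proof.
have := act_rel M v (klr_idem (@Qpoly k q I) nu mu) => /= ->.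
by case: ifP.
Qed.

Lemma klr_x_e nu a v : x nu a (e nu v) = x nu a v.
Proof.
have xE w : x nu a w = e nu (x nu a (e nu w)).
  exact: (act_rel M w (klr_x_idem (@Qpoly k q I) a nu)).
by rewrite xE klr_e_ortho eqxx -xE.
Qed.

Lemma klr_e_x nu a v : e nu (x nu a v) = x nu a v.
Proof.
have xE w : x nu a w = e nu (x nu a (e nu w)).
  exact: (act_rel M w (klr_x_idem (@Qpoly k q I) a nu)).
by rewrite xE klr_e_ortho eqxx.
Qed.

Lemma klr_x_comm nu a b v : x nu a (x nu b v) = x nu b (x nu a v).
Proof. exact: (act_rel M v (klr_xx (@Qpoly k q I) a b nu)). Qed.

Lemma klr_tE i nu v : t i nu v = e (sact i nu) (t i nu (e nu v)).
Proof. exact: (act_rel M v (klr_tau_idem (@Qpoly k q I) i nu)). Qed.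

Lemma klr_t_e i nu mu v : t i nu (e mu v) = if nu == mu then t i nu v else 0.
Proof.
rewrite klr_tE klr_e_ortho; case: eqP => [_|_]; first by rewrite -klr_tE.
by rewrite !act0.
Qed.

Lemma klr_e_t i nu mu v : e mu (t i nu v) = if mu == sact i nu then t i nu v else 0.
Proof.
by rewrite klr_tE klr_e_ortho; case: eqP => [->|_] //.
Qed.

Lemma block_idem nu v : block M nu v <-> e nu v = v.
Proof.
split=> [[w ->]|<-]; last by exists v.
by rewrite klr_e_ortho eqxx.
Qed.

Hypothesis MP : Mod0_pred (NUMod M).

Fact klr_e_fin v : exists s : seq L, uniq s /\ v = \sum_(nu <- s) e nu v.
Proof.
have [[dec _] _] := MP; have [s [w [us wb vE]]] := dec v.
exists s; split=> //; rewrite {1}vE big_seq [RHS]big_seq; apply: eq_bigr => nu nus.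
have wE mu : e mu (w mu) = w mu by apply/block_idem; exact: wb.
have eD u u' : e nu (u + u') = e nu u + e nu u' by exact: actDr.
rewrite vE (big_morph _ eD (act0 M _)) (big_uniq_delta (nu := nu)) ?nus ?wE //.
by move=> mu mn; rewrite -wE klr_e_ortho eq_sym (negPf mn).
Qed.

Fact klr_x_nil nu a v : exists N, iter N (M (xgen q a nu)) v = 0.
Proof.
have [_ /(_ nu a (x nu a v)) []] := MP.
  by apply/block_idem; exact: klr_e_x.
by move=> N xN; exists N.+1; rewrite iterSr.
Qed.

Definition klr_weights : weight_data n L V :=
  @WeightData k n L V (fun nu => M (idem q nu)) (fun nu a => M (xgen q a nu))
    (fun nu => act_linear M (idem q nu)) klr_e_ortho klr_e_fin
    (fun nu a => act_linear M (xgen q a nu)) klr_x_comm klr_x_e klr_e_x klr_x_nil.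

Local Notation W := klr_weights.

Lemma klr_weE nu v : we W nu v = e nu v. Proof. by []. Qed.
Lemma klr_wxE nu a v : wx W nu a v = x nu a v. Proof. by []. Qed.

(** The sum of the [tau_{i,nu}] over all weights. It need not exist in the
    algebra, but it does on modules that are sums of their weight spaces. *)
Definition klr_tau i : wspace W -> wspace W :=
  wsum W (fun nu => M (taugen q i nu)).

Lemma we_klr_tau i nu v : e nu (klr_tau i v) = t i (sact i nu) v.
Proof.
have := we_wsum (W := W) (G := fun nu => M (taugen q i nu)) (phi := @sact n _ i)
  v (sact i nu) (inv_inj (@sactK n _ i)) (fun mu => act0 M (taugen q i mu)).
rewrite sactK => /= ->; first by rewrite klr_t_e eqxx.
by move=> ka mu w; rewrite klr_e_t.
Qed.

Lemma klr_tauD i u v : klr_tau i (u + v) = klr_tau i u + klr_tau i v.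
Proof.
apply: (we_sep (W := W)) => nu; rewrite [RHS]weD !klr_weE !we_klr_tau.
exact: actDr.
Qed.

Lemma klr_tauZ i c (v : V) : klr_tau i (c *: v) = c *: (klr_tau i v : V) :> V.
Proof.
apply: (we_sep (W := W)) => nu; rewrite [RHS]weZ !klr_weE !we_klr_tau.
exact: actZr.
Qed.

Lemma klr_tau_e i nu v : klr_tau i (e nu v) = t i nu v.
Proof.
apply: (we_sep (W := W)) => mu; rewrite !klr_weE we_klr_tau klr_t_e klr_e_t.
rewrite -(inj_eq (inv_inj (@sactK n _ i))) sactK.
by case: eqP => [->|//]; rewrite ?sactK.
Qed.

Lemma klr_tau_indfun i nu (v : wspace W) :
  klr_tau i (indfun nu *: v) = indfun (sact i nu) *: klr_tau i v.
Proof.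
rewrite !indfun_scale !klr_weE klr_tau_e; apply: (we_sep (W := W)) => mu.
rewrite !klr_weE klr_e_t klr_e_ortho; case: eqP => // ->.
by rewrite we_klr_tau sactK.
Qed.

Lemma klr_tau_x_rel i a nu v :
  t i nu (x nu a v) - x (sact i nu) (spos i a) (t i nu v) =
  if nu (pos0 i) == nu (pos1 i) then
    if a == pos0 i then - e nu v else if a == pos1 i then e nu v else 0
  else 0.
Proof.
have := act_rel M v (klr_tau_x (@Qpoly k q I) i a nu) => /=.
rewrite scaleN1r => ->; case: ifP => // _.
by case: ifP => _; rewrite /= ?scaleN1r //; case: ifP.
Qed.

Lemma difffun_xfun i a nu :
  difffun i (xfun a : wfun k n L) nu =
  kc (if nu (pos0 i) == nu (pos1 i) then
        if a == pos0 i then - 1 else if a == pos1 i then 1 else 0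
      else 0).
Proof.
rewrite difffunE swap_xfun !xfunE /divdiff; case: ifP => _; last by rewrite kc0.
have nz := xvar_neq k (pos01_neq i); rewrite yvarB.
have [->|a0] := eqVneq a (pos0 i).
  by rewrite spos0 -opprB mulNr divff // -sub0r -(kc1 _ n) -[X in X - _](kc0 k n) -kcB sub0r.
have [->|a1] := eqVneq a (pos1 i); first by rewrite spos1 divff // kc1.
by rewrite sposD 1?eq_sym // subrr mul0r kc0.
Qed.

Lemma klr_tau_xfun i a (v : wspace W) :
  klr_tau i (xfun a *: v) =
  xfun (spos i a) *: klr_tau i v + difffun i (xfun a) *: v.
Proof.
apply: (additive_we_ext (W := W) (F := fun v : wspace W => klr_tau i (xfun a *: v))
  (G := fun v : wspace W => xfun (spos i a) *: klr_tau i v + difffun i (xfun a) *: v)).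
- by move=> u w; rewrite scalerDr klr_tauD.
- by move=> u w; rewrite klr_tauD !scalerDr addrACA.
move=> nu {}v; rewrite scale_we_xfun klr_wxE -klr_e_x klr_weE !klr_tau_e.
rewrite (scale_we_const W v (difffun_xfun i a nu)) klr_weE.
have tE : t i nu v = we W (sact i nu) (t i nu v).
  by rewrite klr_weE klr_e_t eqxx.
rewrite [X in xfun _ *: X]tE scale_we_xfun klr_wxE.
have /eqP := klr_tau_x_rel i a nu v; rewrite subr_eq => /eqP ->.
rewrite addrC; congr (_ + _); case: ifP => _; last by rewrite scale0r.
case: ifP => _; first by rewrite scaleN1r.
by case: ifP => _; rewrite ?scale1r ?scale0r.
Qed.

Lemma klr_tau_twisted i (f : wfun k n L) (v : wspace W) :
  klr_tau i (f *: v) = swapfun i f *: klr_tau i v + difffun i f *: v.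
Proof.
apply: (weight_twisted (@klr_tauD i)) => [c w|nu w|a w].
- by rewrite !kfun_scale; exact: klr_tauZ.
- exact: klr_tau_indfun.
- exact: klr_tau_xfun.
Qed.

Lemma klr_tau_t i j nu v : klr_tau i (t j nu v) = t i (sact j nu) (t j nu v).
Proof.
have {1}-> : t j nu v = e (sact j nu) (t j nu v) by rewrite klr_e_t eqxx.
exact: klr_tau_e.
Qed.

Lemma klr_tau_square i (v : wspace W) :
  klr_tau i (klr_tau i v) = Qfun q (pos0 i) (pos1 i) *: v.
Proof.
apply: (additive_we_ext (W := W) (F := fun v : wspace W => klr_tau i (klr_tau i v))
  (G := fun v : wspace W => Qfun q (pos0 i) (pos1 i) *: v)).
- by move=> u w; rewrite !klr_tauD.
- by move=> u w; rewrite scalerDr.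
move=> nu {}v; rewrite klr_weE klr_tau_e klr_tau_t.
have QE : Qfun q (pos0 i) (pos1 i) nu =
    (eval2 (Qpoly q (nu (pos0 i)) (nu (pos1 i))) 'X_(pos0 i) 'X_(pos1 i))%:F.
  by rewrite eval2_quiverQ QfunE.
rewrite -klr_weE (scale_we_poly W v QE).
have := act_rel M v (klr_tau_sq (@Qpoly k q I) i nu).
by rewrite nx_eval_klr_poly.
Qed.

Lemma klr_tau_commute (i j : 'I_n.-1) (v : wspace W) : (i.+1 < j)%N || (j.+1 < i)%N ->
  klr_tau i (klr_tau j v) = klr_tau j (klr_tau i v).
Proof.
move=> ij; apply: (additive_we_ext (W := W)
   (F := fun v : wspace W => klr_tau i (klr_tau j v))
   (G := fun v : wspace W => klr_tau j (klr_tau i v))).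
- by move=> u w; rewrite !klr_tauD.
- by move=> u w; rewrite !klr_tauD.
move=> nu {}v; rewrite !klr_weE !klr_tau_e !klr_tau_t.
exact: (act_rel M v (klr_tau_far (@Qpoly k q I) nu ij)).
Qed.

Lemma klr_tau_braid (i j : 'I_n.-1) (v : wspace W) (D : L -> {mpoly k[n]}) :
  j = i.+1 :> nat ->
  (forall nu : L, ('X_(pos1 j) - 'X_(pos0 i)) * D nu =
      eval2 (Qpoly q (nu (pos0 i)) (nu (pos1 i))) 'X_(pos1 j) 'X_(pos1 i)
      - eval2 (Qpoly q (nu (pos0 i)) (nu (pos1 i))) 'X_(pos0 i) 'X_(pos1 i)) ->
  klr_tau j (klr_tau i (klr_tau j v)) - klr_tau i (klr_tau j (klr_tau i v)) =
  polyfun (fun nu : L => if nu (pos0 i) == nu (pos1 j) then D nu else 0) *: v.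
Proof.
move=> ij DE; apply: (additive_we_ext (W := W)
   (F := fun v : wspace W => klr_tau j (klr_tau i (klr_tau j v)) -
     klr_tau i (klr_tau j (klr_tau i v)))
   (G := fun v : wspace W => polyfun (fun nu : L =>
      if nu (pos0 i) == nu (pos1 j) then D nu else 0) *: v)).
- by move=> u w; rewrite !klr_tauD opprD addrACA.
- by move=> u w; rewrite scalerDr.
move=> nu {}v; rewrite !klr_weE !klr_tau_e !klr_tau_t -klr_weE.
rewrite (scale_we_poly W v (polyfunE _ nu)).
have := act_rel M v (klr_braid ij (DE nu)) => /=.
rewrite scaleN1r => ->; case: ifP => _; last by rewrite poly_act0l.
by rewrite nx_eval_klr_poly.
Qed.

End KLRWeights.

Lemma divdiff_quiverQ (k : fieldType) (q : k) (I : {pred k}) (n : nat)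
    (c d : vert I) (a b e : 'I_n) (D : {mpoly k[n]}) (t : bool) : e != a ->
  ('X_e - 'X_a) * D = eval2 (Qpoly q c d) 'X_e 'X_b - eval2 (Qpoly q c d) 'X_a 'X_b ->
  divdiff t (quiverQ (kc q) (kc (val c)) (kc (val d)) (yvar e) (yvar b))
      (quiverQ (kc q) (kc (val c)) (kc (val d)) (yvar a) (yvar b))
      (yvar e - yvar a) = (if t then D else 0)%:F.
Proof.
move=> ea DE; rewrite /divdiff; case: t; last by rewrite tofrac0.
rewrite -!eval2_quiverQ -tofracB -DE tofracM yvarB -tofracB mulrAC divff ?mul1r //.
by rewrite tofracB; exact: xvar_neq.
Qed.

(** * From H_n(Gamma) to the affine Hecke algebra *)

Lemma wscale_linear (k : fieldType) (I : {pred k}) (n : nat) (V : lmodType k)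
    (W : weight_data n {ffun 'I_n -> vert I} V) (f : wfun k n {ffun 'I_n -> vert I}) :
  linear (fun v : V => (f *: (v : wspace W) : V)).
Proof.
move=> c u v; rewrite -[c *: u](kfun_scale (W := W)) -[c *: (_ : V)](kfun_scale (W := W)).
by rewrite scalerDr !scalerA mulrC.
Qed.

Lemma kfunB1_scale (k : fieldType) (I : {pred k}) (n : nat) (V : lmodType k)
    (W : weight_data n {ffun 'I_n -> vert I} V) c (v : wspace W) :
  (kfun c - 1) *: v = (c - 1) *: (v : V) :> V.
Proof. by rewrite scalerBl scale1r kfun_scale scalerBl scale1r. Qed.

Lemma frame_braid_poly (k : fieldType) (q : k) (I : {pred k}) (n : nat) (i j : 'I_n.-1) :
  j = i.+1 :> nat ->
  exists D : {ffun 'I_n -> vert I} -> {mpoly k[n]}, forall nu,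
    ('X_(pos1 j) - 'X_(pos0 i)) * D nu =
      eval2 (Qpoly q (nu (pos0 i)) (nu (pos1 i))) 'X_(pos1 j) 'X_(pos1 i)
      - eval2 (Qpoly q (nu (pos0 i)) (nu (pos1 i))) 'X_(pos0 i) 'X_(pos1 i).
Proof.
move=> ij; suff /choice[D DE] : forall nu : {ffun 'I_n -> vert I}, exists D : {mpoly k[n]},
    ('X_(pos1 j) - 'X_(pos0 i)) * D =
      eval2 (Qpoly q (nu (pos0 i)) (nu (pos1 i))) 'X_(pos1 j) 'X_(pos1 i)
      - eval2 (Qpoly q (nu (pos0 i)) (nu (pos1 i))) 'X_(pos0 i) 'X_(pos1 i).
  by exists D.
by move=> nu; apply: eval2_divisible; rewrite -val_eqE /=; lia.
Qed.

Lemma quadratic_zero (k : fieldType) (V : lmodType k) (q : k) (u v : V) :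
  (q - 1) *: u + q *: v + u + -1 *: (q *: (u + v)) = 0.
Proof. by rewrite scaleN1r scalerDr scalerBl scale1r [X in X - _]addrAC subrK subrr. Qed.

Section HeckeFromKLR.

Variables (k : fieldType) (q : k) (I : {pred k}) (n : nat).
Hypotheses (q0 : q != 0) (q1 : q != 1) (I0 : 0 \notin I).
Local Notation L := {ffun 'I_n -> vert I}.
Local Notation H := (weight_frame n q0 q1 I0).
Variables (V : lmodType k) (M : action (Hgamma q I n) V).
Hypothesis MP : Mod0_pred (NUMod M).
Local Notation W := (klr_weights MP).
Local Notation tau := (@klr_tau k q I n V M MP).

Definition klr_T (i : 'I_n.-1) (v : wspace W) : wspace W := hecke_op H tau i v.

Lemma klr_TD i u v : klr_T i (u + v) = klr_T i u + klr_T i v.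
Proof. exact: (hecke_opD H (@klr_tauD _ _ _ _ _ _ MP)). Qed.

Lemma klr_TZ i c (v : V) : klr_T i (c *: v) = c *: (klr_T i v : V) :> V.
Proof.
rewrite -(kfun_scale (W := W)) -[RHS](kfun_scale (W := W)).
apply: (hecke_opZ (H := H) (@klr_tau_twisted _ _ _ _ _ _ MP)).
  exact: swap_kfun.
exact: diff_kfun.
Qed.

Lemma klr_T_square i v :
  klr_T i (klr_T i v) = (kfun q - 1) *: klr_T i v + kfun q *: v.
Proof.
have := hecke_op_square (H := H) (@klr_tauD _ _ _ _ _ _ MP) (@klr_tau_twisted _ _ _ _ _ _ MP) i v.
move=> E; apply: (etrans E).
by rewrite klr_tau_square subrr scaler0 add0r.
Qed.

Lemma klr_T_commute (i j : 'I_n.-1) v : (i.+1 < j)%N || (j.+1 < i)%N ->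
  klr_T i (klr_T j v) = klr_T j (klr_T i v).
Proof.
move=> ij; apply/eqP; rewrite -subr_eq0; apply/eqP.
apply: (etrans (hecke_op_far (H := H) (@klr_tauD _ _ _ _ _ _ MP) (@klr_tau_twisted _ _ _ _ _ _ MP) v ij)).
by rewrite (klr_tau_commute _ ij) subrr scaler0.
Qed.

Lemma klr_T_braid (i j : 'I_n.-1) v : j = i.+1 :> nat ->
  klr_T i (klr_T j (klr_T i v)) = klr_T j (klr_T i (klr_T j v)).
Proof.
move=> ij; apply/eqP; rewrite -subr_eq0; apply/eqP.
have [D DE] := frame_braid_poly q I ij.
have p20 : pos1 j != pos0 i by rewrite -val_eqE /=; lia.
pose Df : wfun k n L := polyfun (fun nu => if nu (pos0 i) == nu (pos1 j) then D nu else 0).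
have E := hecke_op_braid (H := H) (D := Df) (@klr_tauD _ _ _ _ _ _ MP)
  (@klr_tau_twisted _ _ _ _ _ _ MP) ij (klr_tau_square (MP := MP) i) (klr_tau_square (MP := MP) j).
apply: etrans; first apply: E.
  move=> nu; rewrite [LHS]polyfunE -(divdiff_quiverQ _ p20 (DE nu)).
  by congr (divdiff _ _ _ _); exact: esym (cvar_eq nu _ _).
rewrite -(klr_tau_braid (MP := MP) v ij DE).
by rewrite addrA subrK subrr scaler0.
Qed.

Lemma klr_T_X i v :
  klr_T i (eigfun (pos1 i) *: v) - eigfun (pos0 i) *: klr_T i v =
  ((kfun q - 1) * eigfun (pos1 i)) *: v.
Proof. exact: (hecke_op_X (H := H) (@klr_tau_twisted _ _ _ _ _ _ MP) i v). Qed.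

Lemma klr_T_X_far i a v : a != pos0 i -> a != pos1 i ->
  klr_T i (eigfun a *: v) = eigfun a *: klr_T i v.
Proof. exact: (hecke_op_X_far (H := H) (@klr_tau_twisted _ _ _ _ _ _ MP) v). Qed.

Definition klr_hecke_gen (g : option (hecke_gen n)) (v : V) : V :=
  match g with
  | None => v
  | Some (HX a) => eigfun a *: (v : wspace W)
  | Some (HXinv a) => eigVfun a *: (v : wspace W)
  | Some (HT i) => klr_T i v
  end.

Lemma klr_hecke_gen_linear g : linear (klr_hecke_gen g).
Proof.
case: g => [[a|a|i]|] //=; try exact: wscale_linear.
by move=> c u v; rewrite [LHS]klr_TD klr_TZ.
Qed.

Lemma klr_hecke_rel x y v : unital_rel (@hecke_rel k q n) x y ->
  nx_eval klr_hecke_gen x v = nx_eval klr_hecke_gen y v.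
Proof.
case=> {x y} [x y|g|g] //; case=> {x y} /=.
- by move=> a; rewrite scalerA mulrC eigfunV // scale1r.
- by move=> a; rewrite scalerA eigfunV // scale1r.
- by move=> a b; rewrite !scalerA mulrC.
- by move=> i j ij; exact: klr_T_braid.
- by move=> i j ij; exact: klr_T_commute.
- move=> i; rewrite klr_TD klr_T_square kfun_scale kfunB1_scale.
  exact: quadratic_zero.
- by move=> i a a0 a1; exact: klr_T_X_far.
- move=> i; rewrite scaleN1r klr_T_X -scalerA kfunB1_scale.
  by [].
Qed.

Definition klr_hecke_action : action (hecke q n) V :=
  presented_action klr_hecke_gen_linear klr_hecke_rel.

Lemma klr_hecke_actionX a v : klr_hecke_action (Xgen q a) v = eigfun a *: (v : wspace W).
Proof. exact: presented_action_gen. Qed.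

Lemma klr_hecke_actionT i v : klr_hecke_action (Tgen q i) v = klr_T i v.
Proof. exact: presented_action_gen. Qed.

Lemma klr_hecke_action1 v : klr_hecke_action (one_alg (@hecke_rel k q n)) v = v.
Proof. exact: presented_action_gen. Qed.

End HeckeFromKLR.

(** * Supports *)

(** Ideals that contain [Z] and no power of [g]. *)
Record separating (R : comNzRingType) (Z : R -> Prop) (g : R) (J : R -> Prop) : Prop :=
  Separating {
    sep_add : forall a b, J a -> J b -> J (a + b);
    sep_mul : forall a b, J b -> J (a * b);
    sep_sub : forall a, Z a -> J a;
    sep_avoid : forall N, ~ J (g ^+ N) }.

(** An ideal maximal among the separating ones is prime: if it contains neither
    [a] nor [b], then adding either to it brings in a power of [g], and the
    product of the two powers lies in the ideal as soon as [a b] does. *)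
Lemma prime_avoiding (R : comNzRingType) (Z : R -> Prop) (g : R) :
  Z 0 -> (forall a b, Z a -> Z b -> Z (a + b)) -> (forall a b, Z b -> Z (a * b)) ->
  (forall N, ~ Z (g ^+ N)) ->
  exists P : R -> Prop, [/\ prime_ideal P, forall a, Z a -> P a & ~ P g].
Proof.
move=> Z0 ZD ZM Zg.
(* The empty set is admitted for the union of the empty chain. *)
pose good (J : set R) := J = set0 \/ separating Z g J.
have [F Fgood Ftot|P [Pgood Pmax]] := @Zorn_bigcup R good.
  have [[J FJ sJ]|noJ] := pselect (exists2 J, F J & separating Z g J); last first.
    left; apply/seteqP; split=> // a [J FJ Ja]; have [J0|sJ] := Fgood J FJ.
      by move: Ja; rewrite J0.
    by case: noJ; exists J.
  right; split.
  - move=> a b [Ja FJa aJa] [Jb FJb bJb].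
    have sep K c : F K -> K c -> separating Z g K.
      by move=> FK Kc; have [K0|//] := Fgood K FK; move: Kc; rewrite K0.
    have [ab|ba] := Ftot _ _ FJa FJb.
      exists Jb => //; apply: (sep_add (sep _ _ FJb bJb)) => //; exact: ab.
    exists Ja => //; apply: (sep_add (sep _ _ FJa aJa)) => //; exact: ba.
  - move=> a b [K FK Kb]; exists K => //.
    have [K0|sK] := Fgood K FK; first by move: Kb; rewrite K0.
    exact: (sep_mul sK).
  - by move=> a Za; exists J => //; exact: (sep_sub sJ).
  - move=> N [K FK KN]; have [K0|sK] := Fgood K FK; first by move: KN; rewrite K0.
    exact: (sep_avoid sK KN).
have PS : separating Z g P.
  have [P0|//] := Pgood; case: (Pmax Z); last by right; split.
  by rewrite P0; split=> // /(_ 0 Z0).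
have P0 : P 0 by exact: (sep_sub PS).
have ext a : ~ P a -> exists N p r, P p /\ g ^+ N = p + r * a.
  move=> Pa; apply: contrapT => no.
  pose J b := exists p r, P p /\ b = p + r * a.
  case: (Pmax J).
    split=> [b Pb|/(_ a) JP]; first by exists b, 0; rewrite mul0r addr0.
    by apply: Pa; apply: JP; exists 0, 1; rewrite mul1r add0r.
  right; split.
  - move=> b c [p [r [Pp ->]]] [p' [r' [Pp' ->]]]; exists (p + p'), (r + r').
    by split; [exact: (sep_add PS)|rewrite mulrDl addrACA].
  - move=> b c [p [r [Pp ->]]]; exists (b * p), (b * r).
    by split; [exact: (sep_mul PS)|rewrite mulrDr mulrA].
  - move=> b Zb; exists b, 0; rewrite mul0r addr0; split=> //; exact: (sep_sub PS).
  - by move=> N [p [r [Pp gN]]]; case: no; exists N, p, r.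
exists P; split; last 2 first.
- exact: (sep_sub PS).
- by move=> Pg; apply: (sep_avoid PS (N := 1%N)); rewrite expr1.
split=> //; [exact: (sep_add PS)|exact: (sep_mul PS)| |].
  by move=> P1; apply: (sep_avoid PS (N := 0%N)); rewrite expr0.
move=> a b Pab; have [Pa|/ext[N [p [r [Pp gN]]]]] := pselect (P a); first by left.
have [Pb|/ext[N' [p' [r' [Pp' gN']]]]] := pselect (P b); first by right.
case: (sep_avoid PS (N := (N + N')%N)); rewrite exprD gN gN' mulrDl.
apply: (sep_add PS); first by rewrite mulrC; exact: (sep_mul PS).
rewrite mulrDr; apply: (sep_add PS); first exact: (sep_mul PS).
by rewrite mulrACA; exact: (sep_mul PS).
Qed.

Section Support.

Variables (k : fieldType) (n : nat) (V : lmodType k) (X : 'I_n -> V -> V).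
Hypothesis Xlin : forall a, linear (X a).
Hypothesis XC : forall a b v, X a (X b v) = X b (X a v).
Variable c : 'I_n -> k.

Definition supported (v : V) : Prop :=
  forall P, in_support X v P -> forall f, P f <-> closed_point c f.

(** If no power of [X_a - c_a] kills [v], there is a prime that contains the
    annihilator of [v] but not [X_a - c_a]; it lies in the support and differs
    from [c]. Conversely, a prime in the support contains each [X_a - c_a] if
    powers of these kill [v], and then it is the maximal ideal of [c]. *)
Lemma supported_nilpotent v : supported v <->
  forall a, exists N, poly_act X (('X_a - (c a)%:MP) ^+ N) v = 0.
Proof.
split=> [sv a|nil P [PP Pv] f].
  apply: contrapT => no; set g := 'X_a - (c a)%:MP in no.
  have [||f h fv|N gN|P [PP ZP Pg]] :=
    @prime_avoiding _ (fun f => poly_act X f v = 0) g.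
  - exact: poly_act0l.
  - by move=> f h fv hv; rewrite poly_actDl fv hv addr0.
  - by rewrite poly_actM // fv poly_act0r.
  - by apply: no; exists N.
  apply: Pg; apply/(sv P); last by rewrite /closed_point /g mevalB mevalXU mevalC subrr.
  by split=> // s Ps /ZP.
have PX a : P ('X_a - (c a)%:MP).
  have [N gN] := nil a; have : P (('X_a - (c a)%:MP) ^+ N).
    by apply: contrapT => /Pv; rewrite gN.
  elim: N {gN} => [|N IHN]; first by rewrite expr0 => /(Defs.pi_proper PP).
  by rewrite exprS => /(Defs.pi_prime PP)[|/IHN].
(* Congruence to the value at [c] is compatible with sums and products. *)
have PB h : P (h - (h.@[c])%:MP).
  elim/mpoly_gen_ind: h => [b|a|h h' Ph Ph'|h h' Ph Ph'].
  - by rewrite mevalC subrr; exact: (Defs.pi_zero PP).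
  - by rewrite mevalXU.
  - by rewrite mevalD mpolyCD opprD addrACA; apply: (Defs.pi_add PP).
  - have -> : h * h' - ((h * h').@[c])%:MP =
        h' * (h - (h.@[c])%:MP) + (h.@[c])%:MP * (h' - (h'.@[c])%:MP).
      by rewrite mevalM mpolyCM; ring.
    by apply: (Defs.pi_add PP); exact: (Defs.pi_mul PP).
split=> [Pf|fc]; last first.
  by have := PB f; rewrite /closed_point in fc; rewrite fc mpolyC0 subr0.
apply/eqP; rewrite -/(_ == 0); apply: contrapT => /negP fc.
apply: (Defs.pi_proper PP); have Pc : P (f.@[c])%:MP.
  have -> : (f.@[c])%:MP = f + (-1) * (f - (f.@[c])%:MP) by ring.
  by apply: (Defs.pi_add PP) => //; apply: (Defs.pi_mul PP).
have -> : 1 = ((f.@[c])^-1)%:MP * (f.@[c])%:MP :> {mpoly k[n]}.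
  by rewrite -mpolyCM mulVf.
exact: (Defs.pi_mul PP).
Qed.

End Support.

(** * Weight spaces and formulas for the new Hecke action *)

Lemma direct_sum_ext (k : fieldType) (V : lmodType k) (L : choiceType)
    (W W' : L -> V -> Prop) :
  (forall l v, W l v <-> W' l v) -> direct_sum W -> direct_sum W'.
Proof.
move=> WW' [dec ind]; split=> [v|s w us wW]; last first.
  by apply: ind => // l; apply/WW'.
by have [s [w [us wW vE]]] := dec v; exists s, w; split=> // l; apply/WW'.
Qed.

Section WeightSpectrum.

Variables (k : fieldType) (I : {pred k}) (n : nat).
Local Notation L := {ffun 'I_n -> vert I}.
Local Notation A := (wfun k n L).
Variables (V : lmodType k) (W : weight_data n L V).
Local Notation M := (wspace W).
Local Notation e := (we W).
Local Notation x := (wx W).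
Let xl nu : forall a, linear (x nu a) := wx_linear W nu.
Let xC nu := @wx_comm _ _ _ _ W nu.
Let xn nu := wx_nil W nu.

Lemma wfX (f : A) N nu : (f ^+ N) nu = f nu ^+ N.
Proof.
elim: N => [|N IHN]; first by rewrite !expr0; exact: wf1.
by rewrite !exprS -IHN; exact: wfM.
Qed.

Lemma eigfunB (nu : L) a (c : k) :
  (eigfun a - kfun c : A) nu = ((val (nu a) - c)%:MP + val (nu a) *: 'X_a)%:F.
Proof.
rewrite [LHS]wfB eigfunE kfunE /cvar /yvar /xvar /kc -tofrac1 -tofracD -tofracM -tofracB.
by rewrite mulrDr mulr1 mpolyCB mul_mpolyC addrAC.
Qed.

(** At a weight other than [nu], some [X_a - nu_a] has a nonzero constant term
    and acts injectively. *)
Lemma weight_vector_nilpotent (nu : L) (v : M) :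
  (forall a, exists N, (eigfun a - kfun (val (nu a))) ^+ N *: v = 0) <-> e nu v = v.
Proof.
split=> [nil|vE a].
  apply: (we_sep (W := W)) => mu; rewrite we_ortho.
  have [-> //|mn] := eqVneq mu nu; apply/esym.
  have [a ma] : exists a, mu a != nu a.
    apply: contrapT => no; case/eqP: mn; apply/ffunP => a.
    by apply/eqP; apply: contrapT => /negP ma; apply: no; exists a.
  have [N /(congr1 (e mu))] := nil a.
  rewrite we_scale we0 wfX eigfunB -tofracXn.
  rewrite (frac_act_poly (xl mu) (@xC mu) (xn mu)) => /(poly_act_inj (xl mu) (@xC mu) (xn mu)).
  apply; rewrite /at0 rmorphXn expf_neq0 //=.
  rewrite -/(at0 _) at0D at0C /at0 mevalZ mevalXU mulr0 addr0 subr_eq0.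
  by rewrite (inj_eq val_inj).
have [N gN] := at0_locally_nilpotent (xl nu) (@xC nu) (xn nu)
  (f := val (nu a) *: 'X_a) (etrans (mevalZ _ _ _) (etrans (congr1 _ (mevalXU _ _)) (mulr0 _))) v.
exists N; rewrite -vE.
have fE : ((eigfun a - kfun (val (nu a)) : A) ^+ N) nu = ((val (nu a) *: 'X_a) ^+ N)%:F.
  by rewrite wfX eigfunB subrr mpolyC0 add0r tofracXn.
by rewrite (scale_we_poly W v fE) vE.
Qed.

End WeightSpectrum.

Section KLRHeckeSpectrum.

Variables (k : fieldType) (q : k) (I : {pred k}) (n : nat).
Variables (V : lmodType k) (N : action (hecke q n) V).
Local Notation L := {ffun 'I_n -> vert I}.

Lemma Xgen_comm a b v : N (Xgen q a) (N (Xgen q b) v) = N (Xgen q b) (N (Xgen q a) v).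
Proof. exact: (act_rel N v (unital_given (hecke_XX q a b))). Qed.

Lemma Xgen_linear a : linear (N (Xgen q a)).
Proof. exact: act_linear. Qed.

Lemma supported_atP (c : 'I_n -> k) v : supported_at N c v <->
  forall a, exists d, poly_act (fun i => N (Xgen q i)) (('X_a - (c a)%:MP) ^+ d) v = 0.
Proof. exact: supported_nilpotent Xgen_linear Xgen_comm _ _. Qed.

Variable W : weight_data n L V.
Hypothesis NX : forall a v, N (Xgen q a) v = eigfun a *: (v : wspace W) :> V.

Lemma poly_act_eigfun a (c : k) d v :
  poly_act (fun i => N (Xgen q i)) (('X_a - c%:MP) ^+ d) v =
  (eigfun a - kfun c) ^+ d *: (v : wspace W) :> V.
Proof.
elim: d v => [|d IHd] v; first by rewrite !expr0 poly_act1 scale1r.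
rewrite exprS (poly_actM Xgen_linear Xgen_comm) IHd exprS -scalerA.
rewrite poly_actDl -mpolyCN poly_actX ?poly_actC //.
by rewrite scaleNr -(kfun_scale (W := W)) scalerBl NX.
Qed.

(** Hence the weight spaces can be recovered from the action of the [X_a], no
    matter how they were obtained. *)
Lemma supported_at_we (nu : L) v :
  supported_at N (fun a => val (nu a)) v <-> we W nu v = v.
Proof.
rewrite -(weight_vector_nilpotent (W := W)) supported_atP.
split=> nil a; have [d dv] := nil a; exists d.
  exact: etrans (esym (poly_act_eigfun _ _ _ _)) dv.
exact: etrans (poly_act_eigfun _ _ _ _) dv.
Qed.

Lemma CGamma_of_weights :
  (forall v, N (one_alg (@hecke_rel k q n)) v = v) -> CGamma_pred I (NUMod N).
Proof.
move=> N1; split=> //; apply: direct_sum_ext (weight_direct_sum W) => nu v.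
by apply: iff_sym; exact: supported_at_we.
Qed.

End KLRHeckeSpectrum.

Section Formulas.

Variables (k : fieldType) (q : k) (I : {pred k}) (n : nat).
Hypotheses (q0 : q != 0) (q1 : q != 1) (I0 : 0 \notin I).
Local Notation L := {ffun 'I_n -> vert I}.
Variables (V : lmodType k) (M : action (Hgamma q I n) V).
Hypothesis MP : Mod0_pred (NUMod M).
Local Notation W := (klr_weights MP).
Local Notation e := (we W).
Local Notation fact nu := (frac_act (wx W nu)).
Let xl nu : forall a, linear (wx W nu a) := wx_linear W nu.
Let xC nu := @wx_comm _ _ _ _ W nu.
Let xn nu := wx_nil W nu.

Lemma yact_fact nu a c (u : V) : c *: yact M nu a u = fact nu (kc c * yvar a) u.
Proof.
rewrite /kc /yvar /xvar -tofrac1 -tofracD -tofracM.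
rewrite (frac_act_poly (xl nu) (@xC nu) (xn nu)) mul_mpolyC poly_actZl poly_actDl.
by rewrite poly_act1 poly_actX // addrC.
Qed.

Lemma regular_kyvar c (a : 'I_n) : regular (kc c * yvar a : ratfun k n).
Proof. by apply: regularM; [exact: regular_kc|exact: regular_yvar]. Qed.

Lemma yact2_fact nu a b c d (u : V) :
  c *: yact M nu a u - d *: yact M nu b u =
  fact nu (kc c * yvar a - kc d * yvar b) u.
Proof.
have rN : regular (- (kc d * yvar b) : ratfun k n).
  by apply: regularN; exact: regular_kyvar.
rewrite (frac_actD (xl nu) (@xC nu) (xn nu) _ (regular_kyvar c a) rN) yact_fact.
congr (_ + _); rewrite yact_fact.
have := frac_actD (xl nu) (@xC nu) (xn nu) u (regular_kyvar d b) rN.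
rewrite subrr -tofrac0 (frac_act_poly (xl nu) (@xC nu) (xn nu)) poly_act0l.
by move=> /esym/eqP; rewrite addr_eq0 => /eqP ->; rewrite opprK.
Qed.

Lemma klr_X_formula : X_formula M (klr_hecke_action q0 q1 I0 MP).
Proof.
move=> nu a v /block_idem vE; rewrite klr_hecke_actionX yact_fact.
have {1}-> : v = e nu v by rewrite [RHS]vE.
rewrite scale_we eigfunE; congr (frac_act _ _ _); exact: vE.
Qed.

(** The component of [T_i v] at [nu] involves [tau_i] from [s_i nu] to [nu]. *)
Lemma klr_T_weight (nu : L) i v :
  e nu (klr_T q0 q1 I0 (MP := MP) i v) =
  fact nu (alphafun q (pos0 i) (pos1 i) nu) (M (taugen q i (sact i nu)) v) +
  fact nu (betafun q (pos0 i) (pos1 i) nu) (e nu v).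
Proof.
rewrite weD [X in X + _]we_scale [X in _ + X]we_scale; congr (frac_act _ _ _ + _).
exact: we_klr_tau.
Qed.

Lemma fact_is_inverse_image nu r u w : regunit r -> e nu u = u ->
  fact nu r u = w ->
  is_inverse_image (block M nu) (fact nu r) w u.
Proof.
move=> ru uE rw; split=> //; first by apply/block_idem; exact: uE.
move=> u' _ rw'.
have K z : fact nu r^-1 (fact nu r z) = z.
  rewrite -(frac_actM (xl nu) (@xC nu) (xn nu)) ?mulVf ?regunit_neq0 //.
  - by rewrite (frac_act1 (xl nu) (@xC nu) (xn nu)).
  - exact: regunit_regular (regunitV ru).
  - exact: regunit_regular.
by rewrite -[u']K rw' -rw K.
Qed.

Lemma klr_T_formula : T_formula M (klr_hecke_action q0 q1 I0 MP).
Proof.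
move=> nu i v c d y y' v_nu tau_v Tv_nu.
have TE : Tv_nu = fact nu (alphafun q (pos0 i) (pos1 i) nu) tau_v +
    fact nu (betafun q (pos0 i) (pos1 i) nu) v_nu.
  by rewrite /Tv_nu klr_hecke_actionT -klr_T_weight.
have TvE : e nu Tv_nu = Tv_nu by exact: we_idem.
have ra := wfvalP (alphafun q (pos0 i) (pos1 i) : wfun k n L) nu.
have rb := wfvalP (betafun q (pos0 i) (pos1 i) : wfun k n L) nu.
move: TE ra rb; rewrite (alphafunE q1) betafunE /cvar -/c -/d => TE ra rb.
have facD r u w : regular r -> fact nu r (u + w) = fact nu r u + fact nu r w.
  by move=> rr; apply: linD; exact: (frac_act_linear (xl nu) (@xC nu) (xn nu) rr).
have facM r s u : regular r -> regular s -> fact nu (r * s) u = fact nu r (fact nu s u).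
  exact: (frac_actM (xl nu) (@xC nu) (xn nu)).
have fac1 z : fact nu 1 z = z by exact: (frac_act1 (xl nu) (@xC nu) (xn nu)).
have fack z a : fact nu (kc a) z = a *: z.
  by rewrite (frac_act_poly (xl nu) (@xC nu) (xn nu)) poly_actC.
have kcN1 : kc (-1) = -1 :> ratfun k n by rewrite -sub0r kcB kc0 kc1 sub0r.
have c0 : c != 0 by apply: contraNneq I0 => <-; exact: valP (nu (pos0 i)).
case: ifP => [cd|/negbT cd].
  rewrite TE -[y' tau_v]scale1r yact2_fact kc1 mul1r /beta /alpha kc_eq cd.
  by rewrite fack.
case: ifP => [dE|/negbT dq].
  have -> : (fun u => q^-1 *: y u - y' u) =
      fact nu (kc q^-1 * yvar (pos0 i) - kc 1 * yvar (pos1 i)).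
    by apply/funext => u; rewrite -yact2_fact scale1r.
  have gu : regunit (kc q^-1 * yvar (pos0 i) - kc 1 * yvar (pos1 i) : ratfun k n).
    by apply: regunit_linear; rewrite -(inj_eq invr_inj) invrK invr1.
  apply: fact_is_inverse_image => //.
  have gr := regunit_regular gu; have := regunit_neq0 gu.
  have kd : kc d = kc q * kc c :> ratfun k n by rewrite -kcM (eqP dE).
  have kcd : kc c != kc d :> ratfun k n by rewrite kc_eq.
  rewrite TE facD // -!facM //; move: (kc_neq0 n q0) (kc_neq0 n c0) => kq0 kc0'.
  rewrite kc1 mul1r kcV => g0; rewrite (alpha_arrowK kcd kd g0).
  rewrite (beta_arrowK kq0 kc0' kcd kd g0) -kcN1 fack scaleN1r; congr (_ + _).
  by rewrite yact_fact kcB kc1.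
have -> : (fun u => c *: y u - d *: y' u) =
    fact nu (kc c * yvar (pos0 i) - kc d * yvar (pos1 i)).
  by apply/funext => u; rewrite -yact2_fact.
have gu : regunit (kc c * yvar (pos0 i) - kc d * yvar (pos1 i) : ratfun k n).
  exact: regunit_linear.
apply: fact_is_inverse_image => //.
have gr := regunit_regular gu; have g0 := regunit_neq0 gu.
have kcd : kc c != kc d :> ratfun k n by rewrite kc_eq.
have kdq : kc d != kc q * kc c :> ratfun k n by rewrite -kcM kc_eq.
rewrite TE facD // -!facM // (alpha_genericK kcd kdq g0) (betaK _ kcd g0).
by rewrite yact2_fact yact_fact !kcM kcB kc1.
Qed.

End Formulas.

(** * The weight decomposition of a module in C_Gamma *)

Section DirectSumProjections.

Variables (k : fieldType) (V : lmodType k) (L : choiceType) (B : L -> V -> Prop).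
Hypotheses (B0 : forall l, B l 0)
  (BD : forall l u v, B l u -> B l v -> B l (u + v))
  (BZ : forall l c v, B l v -> B l (c *: v)).
Hypothesis Bsum : direct_sum B.

Lemma big_sub_uniq (s t : seq L) (F : L -> V) : uniq s -> uniq t ->
  {subset s <= t} -> (forall l, l \notin s -> F l = 0) ->
  \sum_(l <- t) F l = \sum_(l <- s) F l.
Proof.
move=> us ut st F0; rewrite (bigID (mem s)) /= [X in _ + X]big1 ?addr0; last first.
  by move=> l; exact: F0.
rewrite -big_filter; apply: perm_big; apply: uniq_perm => //.
  exact: filter_uniq.
by move=> l; rewrite mem_filter; case: (boolP (l \in s)) => // /st ->.
Qed.

(** The family [p] vanishes outside [s], so that families obtained from
    different finite sets can be compared. *)
Lemma dproj_ex v : exists p : L -> V, (forall l, B l (p l)) /\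
  exists s, [/\ uniq s, forall l, l \notin s -> p l = 0 & v = \sum_(l <- s) p l].
Proof.
have [dec _] := Bsum; have [s [w [us wB vE]]] := dec v.
exists (fun l => if l \in s then w l else 0); split=> [l|]; first by case: ifP.
exists s; split=> // [l /negPf ->//|]; rewrite vE big_seq [RHS]big_seq.
by apply: eq_bigr => l ->.
Qed.

Definition dproj (l : L) (v : V) : V := sval (cid (dproj_ex v)) l.

Lemma dproj_in l v : B l (dproj l v).
Proof. by rewrite /dproj; case: cid => p []. Qed.

Lemma dproj_sum v : exists s : seq L,
  [/\ uniq s, forall l, l \notin s -> dproj l v = 0 & v = \sum_(l <- s) dproj l v].
Proof. by rewrite /dproj; case: cid => p []. Qed.

Lemma dproj_unique v (s : seq L) (w : L -> V) : uniq s ->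
  (forall l, B l (w l)) -> (forall l, l \notin s -> w l = 0) ->
  v = \sum_(l <- s) w l -> forall l, dproj l v = w l.
Proof.
move=> us wB w0 vE l; have [s' [us' p0 vE']] := dproj_sum v.
pose t := undup (s ++ s'); have ut : uniq t by exact: undup_uniq.
have st : {subset s <= t} by move=> m; rewrite mem_undup mem_cat => ->.
have st' : {subset s' <= t} by move=> m; rewrite mem_undup mem_cat orbC => ->.
have [lt|lt] := boolP (l \in t); last first.
  by rewrite p0 ?w0 //; apply: contra lt; [exact: st|exact: st'].
have [_ ind] := Bsum.
apply/eqP; rewrite -subr_eq0; apply/eqP.
apply: (ind t (fun l => dproj l v - w l)) => //.
  by move=> m; apply: BD; [exact: dproj_in|rewrite -scaleN1r; exact: BZ].
rewrite big_split /= sumrN (big_sub_uniq us' ut st' p0) (big_sub_uniq us ut st w0).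
by rewrite -vE -vE' subrr.
Qed.

Lemma dproj_id l m v : B l v -> dproj m v = if m == l then v else 0.
Proof.
move=> lv; apply: (@dproj_unique v [:: l] (fun m => if m == l then v else 0)) => //.
- by move=> m'; case: eqP => [->|].
- by move=> m'; rewrite inE => /negPf ->.
- by rewrite big_seq1 eqxx.
Qed.

Lemma dproj_linear_map (f : V -> V) l v : linear f ->
  (forall m u, B m u -> B m (f u)) -> dproj l (f v) = f (dproj l v).
Proof.
move=> fL fB; have [s [us p0 vE]] := dproj_sum v.
apply: (@dproj_unique _ s (fun l => f (dproj l v))) => //.
- by move=> m; apply: fB; exact: dproj_in.
- by move=> m /p0 ->; exact: lin0 fL.
rewrite {1}vE; apply: (big_morph f _ (lin0 fL)) => u w.
by apply: linD.
Qed.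

Lemma dprojD l u v : dproj l (u + v) = dproj l u + dproj l v.
Proof.
have [[s [us p0 uE]] [s' [us' p0' vE]]] := (dproj_sum u, dproj_sum v).
pose t := undup (s ++ s'); have ut : uniq t by exact: undup_uniq.
have st : {subset s <= t} by move=> m; rewrite mem_undup mem_cat => ->.
have st' : {subset s' <= t} by move=> m; rewrite mem_undup mem_cat orbC => ->.
apply: (@dproj_unique _ t (fun l => dproj l u + dproj l v)) => //.
- by move=> m; apply: BD; exact: dproj_in.
- move=> m mt; rewrite p0 ?p0' ?addr0 //; apply: contra mt; [exact: st'|exact: st].
by rewrite big_split (big_sub_uniq us ut st p0) (big_sub_uniq us' ut st' p0') -uE -vE.
Qed.

Lemma dproj_linear l : linear (dproj l).
Proof.
move=> c u v; rewrite dprojD; congr (_ + _).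
apply: (@dproj_linear_map (fun w => c *: w)) => [d w w'|m w]; last exact: BZ.
by rewrite scalerDr !scalerA mulrC.
Qed.

Lemma dproj_ortho l m v : dproj l (dproj m v) = if l == m then dproj l v else 0.
Proof.
by rewrite (dproj_id l (dproj_in m v)); case: eqP => [->|].
Qed.

End DirectSumProjections.

Section HeckeWeights.

Variables (k : fieldType) (q : k) (I : {pred k}) (n : nat).
Hypothesis I0 : 0 \notin I.
Local Notation L := {ffun 'I_n -> vert I}.
Variables (V : lmodType k) (N : action (hecke q n) V).
Hypothesis NP : CGamma_pred I (NUMod N).
Local Notation X a := (N (Xgen q a)).
Local Notation pact := (poly_act (fun a => N (Xgen q a))).
Local Notation S := (fun nu : L => supported_at N (fun a => val (nu a))).
Local Notation Xl := (@Xgen_linear k q n V N).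
Local Notation Xc := (@Xgen_comm k q n V N).

Lemma supported0 (nu : L) : S nu 0.
Proof. by apply/supported_atP => a; exists 0%N; exact: (poly_act0r Xl). Qed.

Lemma supportedD (nu : L) u v : S nu u -> S nu v -> S nu (u + v).
Proof.
move=> /supported_atP Su /supported_atP Sv; apply/supported_atP => a.
have [[d ud] [d' vd]] := (Su a, Sv a); exists (d + d')%N.
rewrite (poly_actDr Xl) (poly_act_expr_ge Xl Xc _ ud) ?leq_addr //.
by rewrite (poly_act_expr_ge Xl Xc _ vd) ?addr0 ?leq_addl.
Qed.

Lemma supportedZ (nu : L) c v : S nu v -> S nu (c *: v).
Proof.
move=> /supported_atP Sv; apply/supported_atP => a; have [d vd] := Sv a.
by exists d; rewrite (poly_actZr Xl) vd scaler0.
Qed.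

Lemma supportedX (nu : L) a v : S nu v -> S nu (X a v).
Proof.
move=> /supported_atP Sv; apply/supported_atP => b; have [d vd] := Sv b.
exists d; rewrite -(poly_actX (fun a => X a)) (poly_actAC Xl Xc) vd.
exact: (poly_act0r Xl).
Qed.

Let Ssum : direct_sum (fun nu : L => S nu). Proof. by case: NP. Qed.

Definition hecke_proj (nu : L) : V -> V := dproj supported0 Ssum nu.

Lemma hecke_proj_in nu v : S nu (hecke_proj nu v).
Proof. exact: dproj_in. Qed.

Lemma hecke_proj_id nu v : S nu v -> hecke_proj nu v = v.
Proof.
move=> nuv; have := dproj_id supported0 supportedD supportedZ Ssum nu nuv.
by rewrite eqxx.
Qed.

Lemma hecke_projX nu a v : hecke_proj nu (X a v) = X a (hecke_proj nu v).
Proof.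
apply: (dproj_linear_map supported0 supportedD supportedZ Ssum nu v (Xl a)) => m u.
exact: supportedX.
Qed.

(** [X_a / nu_a - 1] on the weight space of [nu] and zero on the others. *)
Definition hecke_x (nu : L) a (v : V) : V :=
  (val (nu a))^-1 *: X a (hecke_proj nu v) - hecke_proj nu v.

Fact hecke_proj_linear nu : linear (hecke_proj nu).
Proof. exact: dproj_linear supported0 supportedD supportedZ _ _. Qed.

Fact hecke_proj_ortho nu mu v :
  hecke_proj nu (hecke_proj mu v) = if nu == mu then hecke_proj nu v else 0.
Proof. exact: dproj_ortho supported0 supportedD supportedZ _ _ _ _. Qed.

Fact hecke_proj_fin v : exists s : seq L, uniq s /\ v = \sum_(nu <- s) hecke_proj nu v.
Proof. by have [s [us _ vE]] := dproj_sum supported0 Ssum v; exists s. Qed.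

Lemma hecke_proj_x nu a v : hecke_proj nu (hecke_x nu a v) = hecke_x nu a v.
Proof.
apply: hecke_proj_id; rewrite /hecke_x -scaleN1r; apply: supportedD.
  by apply: supportedZ; apply: supportedX; exact: hecke_proj_in.
by apply: supportedZ; exact: hecke_proj_in.
Qed.

Lemma hecke_x_proj nu a v : hecke_x nu a (hecke_proj nu v) = hecke_x nu a v.
Proof. by rewrite /hecke_x hecke_proj_ortho eqxx. Qed.

Fact hecke_x_linear nu a : linear (hecke_x nu a).
Proof.
move=> c u v; rewrite /hecke_x hecke_proj_linear Xgen_linear.
rewrite scalerDr !scalerBr opprD addrACA !scalerA mulrC.
by [].
Qed.

Lemma hecke_x_poly nu a v :
  hecke_x nu a v = (val (nu a))^-1 *: pact ('X_a - (val (nu a))%:MP) (hecke_proj nu v).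
Proof.
have nz : val (nu a) != 0 by apply: contraNneq I0 => <-; exact: valP (nu a).
rewrite poly_actDl -mpolyCN poly_actX poly_actC.
by rewrite scalerDr scalerA mulrN mulVf // scaleN1r.
Qed.

Fact hecke_x_comm nu a b v : hecke_x nu a (hecke_x nu b v) = hecke_x nu b (hecke_x nu a v).
Proof.
rewrite !(hecke_x_poly _ _ (hecke_x _ _ _)) !hecke_proj_x !hecke_x_poly.
by rewrite !(poly_actZr Xl) !scalerA (poly_actAC Xl Xc) mulrC.
Qed.

Fact hecke_x_nil nu a v : exists d, iter d (hecke_x nu a) v = 0.
Proof.
have /supported_atP/(_ a)[d vd] := @hecke_proj_in nu (hecke_x nu a v).
exists d.+1; rewrite iterSr -hecke_proj_x; set u := hecke_proj _ _.
have {vd}vd : pact (('X_a - (val (nu a))%:MP) ^+ d) u = 0 by [].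
have uE : hecke_proj nu u = u by rewrite /u hecke_proj_ortho eqxx.
suff -> : iter d (hecke_x nu a) u =
    (val (nu a))^-1 ^+ d *: pact (('X_a - (val (nu a))%:MP) ^+ d) u.
  by rewrite vd scaler0.
elim: d {vd} => [|d IHd]; first by rewrite /= !expr0 scale1r poly_act1.
rewrite iterS hecke_x_poly (_ : hecke_proj nu _ = iter d (hecke_x nu a) u).
  by rewrite IHd (poly_actZr Xl) scalerA -exprS -(poly_actM Xl Xc) -exprS.
by case: d {IHd} => //= d; exact: hecke_proj_x.
Qed.

Definition hecke_weights : weight_data n L V :=
  @WeightData k n L V hecke_proj hecke_x hecke_proj_linear hecke_proj_ortho
    hecke_proj_fin hecke_x_linear hecke_x_comm hecke_x_proj hecke_proj_x hecke_x_nil.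

Local Notation W := hecke_weights.

Lemma hecke_X_eigfun a v : X a v = eigfun a *: (v : wspace W) :> V.
Proof.
apply: (we_sep (W := W)) => nu; rewrite we_scale eigfunE /=.
rewrite hecke_projX /cvar /kc /yvar /xvar -tofrac1 -tofracD -tofracM.
rewrite (frac_act_poly (hecke_x_linear nu) (@hecke_x_comm nu) (hecke_x_nil nu)).
have nz : val (nu a) != 0 by apply: contraNneq I0 => <-; exact: valP (nu a).
rewrite mul_mpolyC poly_actZl poly_actDl poly_act1 poly_actX.
rewrite /hecke_x hecke_proj_ortho eqxx addrC subrK scalerA mulfV //.
by rewrite scale1r.
Qed.

End HeckeWeights.

(** * The commutation relation between T_i and X_j *)

Section DemazureOperator.

Variables (F : fieldType) (A : comPzRingType) (n : nat) (H : hecke_frame F A n).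
Variables (V : lmodType A) (T : V -> V) (i : 'I_n.-1) (qV alV : A).
Local Notation fX a := (fX H a).
Local Notation fq := (fq H).
Local Notation X0 := (fX (pos0 i)).
Local Notation X1 := (fX (pos1 i)).
Local Notation al := (fal H (pos0 i) (pos1 i)).
Local Notation be := (fbe H (pos0 i) (pos1 i)).
Hypotheses (TD : forall u v, T (u + v) = T u + T v)
  (Tq : forall v, T (fq *: v) = fq *: T v)
  (TT : forall v, T (T v) = (fq - 1) *: T v + fq *: v)
  (TX1 : forall v, T (X1 *: v) - X0 *: T v = ((fq - 1) * X1) *: v)
  (TXfar : forall a v, a != pos0 i -> a != pos1 i -> T (fX a *: v) = fX a *: T v).
Hypotheses (qVq : qV * fq = 1) (alVal : alV * al = 1).

Lemma demazureX1 v : T (X1 *: v) = X0 *: T v + ((fq - 1) * X1) *: v.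
Proof. by rewrite -TX1 addrC subrK. Qed.

Lemma demazure0 : T 0 = 0.
Proof. by apply: (addrI (T 0)); rewrite -TD !addr0. Qed.

Lemma demazureN v : T (- v) = - T v.
Proof. by apply: (addrI (T v)); rewrite -TD !subrr demazure0. Qed.

Lemma demazure_fqB1 v : T ((fq - 1) *: v) = (fq - 1) *: T v.
Proof. by rewrite !scalerBl !scale1r TD demazureN Tq. Qed.

(** [T X_0 T = q X_1] is the other usual form of the commutation relation; it
    comes from the quadratic relation applied to [X_1 v]. *)
Lemma demazureX0T v : T (X0 *: T v) = (fq * X1) *: v.
Proof.
have := TT (X1 *: v); rewrite {1}demazureX1 TD.
rewrite -[((fq - 1) * X1) *: v]scalerA demazure_fqB1 addrC => /addrI ->.
by rewrite scalerA.
Qed.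

(** The rule for [X_0] is not assumed; it follows from [T X_0 T = q X_1] because
    the quadratic relation makes [T] invertible. *)
Lemma demazureX0 v : T (X0 *: v) = X1 *: T v - ((fq - 1) * X1) *: v.
Proof.
have qI (u w : V) : fq *: u = fq *: w -> u = w.
  by move=> /(congr1 ( *:%R qV)); rewrite !scalerA qVq !scale1r.
apply: qI; have := demazureX0T (T v); rewrite TT scalerDr TD.
rewrite [X0 *: (_ *: T v)]scalerA [X0 * _]mulrC -[((fq - 1) * X0) *: _]scalerA.
rewrite demazure_fqB1 demazureX0T [X0 *: (fq *: v)]scalerA [X0 * fq]mulrC.
rewrite -[(fq * X0) *: v]scalerA Tq scalerA => E.
by rewrite scalerBr !scalerA -E [fq * (_ * X1)]mulrCA [X in X - _]addrC addrK.
Qed.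

Definition commutes_with (f : A) : Prop := forall v, T (f *: v) = f *: T v.

Lemma commutesM f g : commutes_with f -> commutes_with g -> commutes_with (f * g).
Proof. by move=> cf cg v; rewrite -!scalerA cf cg. Qed.

Lemma commutesB f g : commutes_with f -> commutes_with g -> commutes_with (f - g).
Proof. by move=> cf cg v; rewrite !scalerBl TD demazureN cf cg. Qed.

Lemma commutesXn f d : commutes_with f -> commutes_with (f ^+ d).
Proof.
move=> cf; elim: d => [|d IHd]; first by move=> v; rewrite expr0 !scale1r.
by rewrite exprS; exact: commutesM.
Qed.

(** With [commutes_prod], the symmetric functions of [X_0] and [X_1] commute
    with [T], as in the Bernstein presentation. *)
Lemma commutes_sum : commutes_with (X0 + X1).
Proof.
move=> v; rewrite !scalerDl TD demazureX0 demazureX1 addrACA [X in _ + X]addrC.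
by rewrite subrr addr0 addrC.
Qed.

Lemma commutes_prod : commutes_with (X0 * X1).
Proof.
move=> v; rewrite -scalerA demazureX0 demazureX1 scalerDr !scalerA.
rewrite [X1 * X0]mulrC [X1 * ((fq - 1) * X1)]mulrCA mulrA addrK.
by [].
Qed.

Section DiagonalBlock.

Variables (E c : A).
Hypotheses (EE : E * E = E) (Ebe : be * (X1 - X0) * E = (fq - 1) * X1 * E)
  (Tc : commutes_with c).

Let Z v := E *: T (E *: v) - (be * E) *: v.

(** [Z] measures how far the block [E T E] is from multiplication by [be]. It
    intertwines [X_1 - c] with [X_0 - c], so it vanishes where the former is
    locally nilpotent and the latter is invertible. *)
Lemma diagonal_shift d v : Z ((X1 - c) ^+ d *: v) = (X0 - c) ^+ d *: Z v.
Proof.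
have Tf u : T ((X1 - c) *: u) = (X0 - c) *: T u + ((fq - 1) * X1) *: u.
  by rewrite scalerBl TD demazureN demazureX1 Tc scalerBl addrAC.
have Z1 u : Z ((X1 - c) *: u) = (X0 - c) *: Z u.
  have Ef : E *: ((X1 - c) *: u) = (X1 - c) *: (E *: u).
    by rewrite !scalerA mulrC.
  rewrite /Z Ef Tf scalerDr scalerBr !scalerA -addrA; congr (_ *: _ + _).
    exact: mulrC.
  rewrite -scalerBl -scaleNr; congr (_ *: _).
  have -> : E * ((fq - 1) * X1) * E = be * (X1 - X0) * E.
    by rewrite Ebe -[X in _ = _ * X]EE; ring.
  by ring.
elim: d v => [|d IHd] v; first by rewrite !expr0 !scale1r.
by rewrite !exprS -!scalerA Z1 IHd.
Qed.

Lemma diagonal_killed d v : ((X1 - c) ^+ d * E) *: v = 0 ->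
  (X0 - c) ^+ d *: Z v = 0.
Proof.
move=> Ev; rewrite -diagonal_shift /Z !scalerA [E * _]mulrC -mulrA [E * _]mulrC Ev.
by rewrite demazure0 !scaler0 -scalerA Ev scaler0 subr0.
Qed.

End DiagonalBlock.

Definition demazure_tau (v : V) : V := alV *: (T v - be *: v).

Lemma demazure_tauK v : T v = al *: demazure_tau v + be *: v.
Proof. by rewrite /demazure_tau scalerA mulrC alVal scale1r subrK. Qed.

Lemma demazure_tauD u v : demazure_tau (u + v) = demazure_tau u + demazure_tau v.
Proof. by rewrite /demazure_tau TD [be *: _]scalerDr opprD addrACA scalerDr. Qed.

Lemma demazure_tauZ f v : commutes_with f -> demazure_tau (f *: v) = f *: demazure_tau v.
Proof.
move=> cf; rewrite /demazure_tau cf !scalerBr !scalerA.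
by congr (_ *: _ - _ *: _); ring.
Qed.

Lemma demazure_commutator : al * diff H i X1 + be * (X1 - X0) = (fq - 1) * X1.
Proof.
apply: (ev_inj (h := H)) => nu.
rewrite !(evD, evM, evN, ev1) ev_diff swap_X spos1 ev_q !ev_X ev_al ev_be.
exact: (alpha_beta_commutator (hf_q H) (hf_y_neq H (pos01_neq i))
   (@hf_cy_neq _ _ _ H nu (pos0 i) (pos1 i))).
Qed.

Lemma diffX1 : diff H i X1 = alV * ((fq - 1) * X1 - be * (X1 - X0)).
Proof. by rewrite -demazure_commutator addrK mulrA alVal mul1r. Qed.

Lemma diffX0 : diff H i X0 = - diff H i X1.
Proof.
apply: (ev_inj (h := H)) => nu; rewrite evN !ev_diff !swap_X spos0 spos1.
by rewrite /divdiff; case: ifP => _; rewrite ?oppr0 // -mulNr opprB.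
Qed.

Lemma diffX_far a : a != pos0 i -> a != pos1 i -> diff H i (fX a) = 0.
Proof.
move=> a0 a1; have sa : spos i a = a by rewrite sposD // eq_sym.
apply: (ev_inj (h := H)) => nu.
rewrite ev_diff swap_X sa /divdiff subrr mul0r.
by rewrite -(addrN (1 : A)) evD evN subrr; case: ifP.
Qed.

Lemma demazure_tauX a v :
  demazure_tau (fX a *: v) = fX (spos i a) *: demazure_tau v + diff H i (fX a) *: v.
Proof.
have [->|a0] := eqVneq a (pos0 i).
  rewrite spos0 diffX0 diffX1 /demazure_tau demazureX0.
  rewrite !scalerBr !scalerA -!addrA; congr (_ + _); first by rewrite mulrC.
  rewrite -!scaleNr -!scalerDl; congr (_ *: _).
  ring.
have [->|a1] := eqVneq a (pos1 i).
  rewrite spos1 diffX1 /demazure_tau demazureX1 -addrA scalerDr !scalerBr !scalerA.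
  rewrite -!addrA; congr (_ + _); first by rewrite mulrC.
  rewrite -!scaleNr -!scalerDl; congr (_ *: _).
  ring.
rewrite sposD 1?eq_sym // diffX_far // scale0r addr0.
by apply: demazure_tauZ => u; exact: TXfar.
Qed.

End DemazureOperator.

(** * The blocks of T_i between weight spaces *)

Section WeightNilpotence.

Variables (k : fieldType) (I : {pred k}) (n : nat).
Local Notation L := {ffun 'I_n -> vert I}.
Local Notation A := (wfun k n L).
Variables (V : lmodType k) (W : weight_data n L V).
Local Notation M := (wspace W).
Local Notation e := (we W).
Local Notation x := (wx W).
Let xl nu : forall a, linear (x nu a) := wx_linear W nu.
Let xC nu := @wx_comm _ _ _ _ W nu.
Let xn nu := wx_nil W nu.

Lemma weight_nilpotent (f : A) nu p (v : V) : f nu = p%:F -> at0 p = 0 ->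
  exists d, f ^+ d *: (e nu v : M) = 0.
Proof.
move=> fE p0.
have [d pd] := at0_locally_nilpotent (xl nu) (@xC nu) (xn nu) p0 (e nu v).
exists d; have fdE : (f ^+ d) nu = (p ^+ d)%:F by rewrite wfX fE tofracXn.
exact: etrans (scale_we_poly W v fdE) pd.
Qed.

Lemma weight_killed (f : A) nu p (v : M) d : f nu = p%:F -> at0 p != 0 ->
  f ^+ d *: v = 0 -> e nu v = 0.
Proof.
move=> fE p0 /(congr1 (e nu)); rewrite we_scale we0 wfX fE -tofracXn.
rewrite (frac_act_poly (xl nu) (@xC nu) (xn nu)).
apply: (poly_act_inj (xl nu) (@xC nu) (xn nu)).
by rewrite /at0 rmorphXn expf_neq0.
Qed.

Lemma we_scale_we (f : A) nu (v : V) : e nu (f *: (e nu v : M)) = f *: (e nu v : M).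
Proof. by rewrite we_scale we_idem; apply: esym; exact: scale_we. Qed.

Lemma scale_we_eq (f g : A) nu (v : V) : f nu = g nu ->
  f *: (e nu v : M) = g *: (e nu v : M).
Proof. by move=> fg; rewrite [LHS]scale_we [RHS]scale_we fg. Qed.

Definition eigpoly (nu : L) a : {mpoly k[n]} := (val (nu a))%:MP * (1 + 'X_a).

Lemma eigfun_poly nu a : (eigfun a : A) nu = (eigpoly nu a)%:F.
Proof. by rewrite eigfunE /eigpoly tofracM tofracD tofrac1. Qed.

Lemma at0_eigpoly nu a : at0 (eigpoly nu a) = val (nu a).
Proof. by rewrite at0M at0D at01 at0X at0C addr0 mulr1. Qed.

End WeightNilpotence.

Lemma sum_prod_eq (k : fieldType) (a b c d : k) :
  a + b = c + d -> a * b = c * d -> (a = c /\ b = d) \/ (a = d /\ b = c).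
Proof.
move=> s p; have /eqP : (a - c) * (a - d) = 0.
  have -> : (a - c) * (a - d) = a * a - a * (c + d) + c * d by ring.
  by rewrite -s -p; ring.
rewrite mulf_eq0 !subr_eq0 => /orP[/eqP E|/eqP E]; [left|right].
  by split=> //; apply: (addrI a); rewrite s E.
by split=> //; apply: (addrI a); rewrite s E addrC.
Qed.

Section KLRFromHecke.

Variables (k : fieldType) (q : k) (I : {pred k}) (n : nat).
Hypotheses (q0 : q != 0) (q1 : q != 1) (I0 : 0 \notin I).
Local Notation L := {ffun 'I_n -> vert I}.
Local Notation A := (wfun k n L).
Local Notation H := (weight_frame n q0 q1 I0).
Variables (V : lmodType k) (N : action (hecke q n) V).
Hypothesis NP : CGamma_pred I (NUMod N).
Local Notation W := (hecke_weights I0 NP).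
Local Notation M := (wspace W).
Local Notation e := (we W).

Definition hecke_T (i : 'I_n.-1) (v : M) : M := N (Tgen q i) v.

Let N1 v : N (gen (unital_rel (@hecke_rel k q n)) None) v = v.
Proof. by case: NP => /(_ v). Qed.

Lemma hecke_TD i u v : hecke_T i (u + v) = hecke_T i u + hecke_T i v.
Proof. exact: actDr. Qed.

Lemma hecke_Tk i c v : hecke_T i (kfun c *: v) = kfun c *: hecke_T i v.
Proof. by rewrite !kfun_scale; exact: actZr. Qed.

Lemma hecke_TT i v :
  hecke_T i (hecke_T i v) = (kfun q - 1) *: hecke_T i v + kfun q *: v.
Proof.
rewrite kfunB1_scale kfun_scale.
have /eqP := act_rel N v (unital_given (hecke_quad q i)).
rewrite /= !N1 scaleN1r subr_eq0 => /eqP E.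
have TD (u w : V) : N (Tgen q i) (u + w) = N (Tgen q i) u + N (Tgen q i) w by exact: actDr.
move: E; rewrite [LHS]TD scalerDr => E.
rewrite scalerBl scale1r addrAC; apply/eqP; rewrite eq_sym subr_eq; apply/eqP.
exact: esym.
Qed.

Lemma hecke_TX1 i v :
  hecke_T i (eigfun (pos1 i) *: v) - eigfun (pos0 i) *: hecke_T i v =
  ((kfun q - 1) * eigfun (pos1 i)) *: v.
Proof.
rewrite -scalerA kfunB1_scale -!(hecke_X_eigfun I0 NP).
have := act_rel N v (unital_given (hecke_TX q i)).
by rewrite /= scaleN1r.
Qed.

Lemma hecke_TXfar i a v : a != pos0 i -> a != pos1 i ->
  hecke_T i (eigfun a *: v) = eigfun a *: hecke_T i v.
Proof.
move=> a0 a1; rewrite -!(hecke_X_eigfun I0 NP).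
exact: (act_rel N v (unital_given (hecke_TX_far q a0 a1))).
Qed.

Lemma kfunV c : c != 0 -> kfun c^-1 * kfun c = 1 :> A.
Proof.
move=> c0; apply: wfun_eq => nu; rewrite [LHS]wfM [RHS]wf1 !kfunE -kcM mulVf //.
Qed.

Local Notation commutes i f := (commutes_with (hecke_T i) f).

Lemma commutes_kfun i c : commutes i (kfun c : A).
Proof. exact: hecke_Tk. Qed.

(** [T_i] maps vectors on which [f] is nilpotent to such vectors, while [f] is
    injective on the weight space of [nu]. *)
Lemma commuting_separates i (f : A) mu nu p p' (v : V) : commutes i f ->
  f mu = p%:F -> f nu = p'%:F -> at0 p = 0 -> at0 p' != 0 ->
  e nu (hecke_T i (e mu v)) = 0.
Proof.
move=> cf fmu fnu p0 p'0; have [d fd] := weight_nilpotent W v fmu p0.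
apply: (weight_killed (W := W) (d := d) fnu p'0).
rewrite -(commutesXn d cf) fd.
exact: (demazure0 (hecke_TD i)).
Qed.

(** [T_i] preserves the generalized eigenvalues of [X_i + X_{i+1}],
    [X_i X_{i+1}] and the other [X_a]. These determine the weight up to
    [s_i]. *)
Lemma hecke_T_blocks i mu nu (v : V) : nu != mu -> nu != sact i mu ->
  e nu (hecke_T i (e mu v)) = 0.
Proof.
move=> nm ns; apply: contrapT => nz.
have sepB (f : A) (p : L -> {mpoly k[n]}) : commutes i f ->
    (forall ka, f ka = (p ka)%:F) -> at0 (p nu) = at0 (p mu).
  move=> cf fE; apply/eqP; apply: contrapT => /negP pn; apply: nz.
  pose c := at0 (p mu).
  apply: (@commuting_separates i (f - kfun c) mu nu (p mu - c%:MP) (p nu - c%:MP)).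
  - exact: (commutesB (hecke_TD i) cf (commutes_kfun i c)).
  - by rewrite [LHS]wfB fE kfunE tofracB.
  - by rewrite [LHS]wfB fE kfunE tofracB.
  - by rewrite at0B at0C subrr.
  - by rewrite at0B at0C subr_eq0.
have far a : a != pos0 i -> a != pos1 i -> val (nu a) = val (mu a).
  move=> a0 a1; rewrite -!at0_eigpoly; apply: (sepB (eigfun a) (fun ka => eigpoly ka a)).
    by move=> w; exact: hecke_TXfar.
  by move=> ka; exact: eigfun_poly.
have sum : val (nu (pos0 i)) + val (nu (pos1 i)) = val (mu (pos0 i)) + val (mu (pos1 i)).
  have := sepB (eigfun (pos0 i) + eigfun (pos1 i))
    (fun ka => eigpoly ka (pos0 i) + eigpoly ka (pos1 i)).
  rewrite !at0D !at0_eigpoly; apply.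
    exact: (commutes_sum (H := H) (hecke_TD i) (hecke_Tk i q) (hecke_TT i) (hecke_TX1 i) (kfunV q0)).
  by move=> ka; rewrite [LHS]wfD !eigfun_poly tofracD.
have prod : val (nu (pos0 i)) * val (nu (pos1 i)) = val (mu (pos0 i)) * val (mu (pos1 i)).
  have := sepB (eigfun (pos0 i) * eigfun (pos1 i))
    (fun ka => eigpoly ka (pos0 i) * eigpoly ka (pos1 i)).
  rewrite (at0M (eigpoly nu _)) (at0M (eigpoly mu _)) !at0_eigpoly; apply.
    exact: (commutes_prod (H := H) (hecke_TD i) (hecke_Tk i q) (hecke_TT i) (hecke_TX1 i) (kfunV q0)).
  by move=> ka; rewrite [LHS]wfM !eigfun_poly; exact: esym (tofracM _ _).
have [[E0 E1]|[E0 E1]] := sum_prod_eq sum prod.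
  case/eqP: nm; apply/ffunP => a; apply: val_inj.
  have [->//|a0] := eqVneq a (pos0 i); have [->//|a1] := eqVneq a (pos1 i).
  exact: far.
case/eqP: ns; apply/ffunP => a; apply: val_inj; rewrite sactE.
have [->|a0] := eqVneq a (pos0 i); first by rewrite spos0.
have [->|a1] := eqVneq a (pos1 i); first by rewrite spos1.
by rewrite sposD 1?eq_sym //; exact: far.
Qed.

(** Take [c = mu_{i+1}] in [diagonal_killed]: on the weight space of [mu],
    [X_{i+1} - c] is locally nilpotent and [X_i - c] is invertible. *)
Lemma hecke_T_diagonal i (mu : L) (v : M) : mu (pos0 i) != mu (pos1 i) ->
  e mu (hecke_T i (e mu v)) = betafun q (pos0 i) (pos1 i) *: (e mu v : M).
Proof.
move=> m01; pose c := val (mu (pos1 i)).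
have Ebe : betafun q (pos0 i) (pos1 i) * (eigfun (pos1 i) - eigfun (pos0 i)) * indfun mu =
    (kfun q - 1) * eigfun (pos1 i) * indfun mu :> A.
  apply: mul_indfun; have <- : alphafun q (pos0 i) (pos1 i) * difffun i (eigfun (pos1 i)) +
      betafun q (pos0 i) (pos1 i) * (eigfun (pos1 i) - eigfun (pos0 i)) =
      (kfun q - 1) * eigfun (pos1 i) :> A by exact: (demazure_commutator H i).
  rewrite [RHS]wfD [X in _ = X + _]wfM difffunE (negPf m01) mulr0 add0r.
  by [].
have p0 : at0 ((c - c)%:MP + c *: 'X_(pos1 i) : {mpoly k[n]}) = 0.
  by rewrite subrr mpolyC0 add0r /at0 mevalZ mevalXU mulr0.
have [d dE] := weight_nilpotent W v (eigfunB mu (pos1 i) c) p0.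
have fE : (eigfun (pos0 i) - kfun c : A) mu =
    ((val (mu (pos0 i)) - c)%:MP + val (mu (pos0 i)) *: 'X_(pos0 i))%:F.
  exact: eigfunB.
have p1 : at0 ((val (mu (pos0 i)) - c)%:MP + val (mu (pos0 i)) *: 'X_(pos0 i) : {mpoly k[n]}) != 0.
  rewrite at0D at0C /at0 mevalZ mevalXU mulr0 addr0 subr_eq0.
  by rewrite /c (inj_eq val_inj).
have Ev : ((eigfun (pos1 i) - kfun c) ^+ d * indfun mu) *: v = 0.
  by rewrite -scalerA indfun_scale.
have := diagonal_killed (H := H) (hecke_TD i) (hecke_TX1 i) (indfun_idem mu) Ebe
  (commutes_kfun i c) Ev.
move=> /(weight_killed fE p1); rewrite -scalerA !indfun_scale.
by rewrite weB we_scale_we we_idem => /eqP; rewrite subr_eq0 => /eqP.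
Qed.

End KLRFromHecke.

(** * The operators tau_i of a module in C_Gamma *)

Lemma unit_scale_eq0 (A : comPzRingType) (V : lmodType A) (b a : A) (v : V) :
  b * a = 1 -> a *: v = 0 -> v = 0.
Proof. by move=> ba av; rewrite -[v]scale1r -ba -scalerA av scaler0. Qed.

Lemma scaleMB1 (A : comPzRingType) (V : lmodType A) (f g : A) (v : V) :
  (f * g - 1) *: v = f *: (g *: v) - v.
Proof. by rewrite scalerBl scale1r scalerA. Qed.

Section HeckeTau.

Variables (k : fieldType) (q : k) (I : {pred k}) (n : nat).
Hypotheses (q0 : q != 0) (q1 : q != 1) (I0 : 0 \notin I).
Local Notation L := {ffun 'I_n -> vert I}.
Local Notation A := (wfun k n L).
Local Notation H := (weight_frame n q0 q1 I0).
Variables (V : lmodType k) (N : action (hecke q n) V).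
Hypothesis NP : CGamma_pred I (NUMod N).
Local Notation W := (hecke_weights I0 NP).
Local Notation M := (wspace W).
Local Notation e := (we W).
Local Notation T := (@hecke_T k q I n I0 V N NP).

Definition hecke_tau (i : 'I_n.-1) (v : M) : M :=
  demazure_tau H (T i) i (alphaVfun q (pos0 i) (pos1 i)) v.

Lemma hecke_tauD i u v : hecke_tau i (u + v) = hecke_tau i u + hecke_tau i v.
Proof. exact: (demazure_tauD H i _ (hecke_TD (NP := NP) i)). Qed.

Lemma hecke_tauK i v :
  T i v = alphafun q (pos0 i) (pos1 i) *: hecke_tau i v + betafun q (pos0 i) (pos1 i) *: v.
Proof. exact: (demazure_tauK (H := H) (T i) (alphafunV q1 (pos0 i) (pos1 i))). Qed.

Lemma hecke_tau_kfun i c v : hecke_tau i (kfun c *: v) = kfun c *: hecke_tau i v.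
Proof. exact: (demazure_tauZ H i _ v (hecke_Tk (NP := NP) i c)). Qed.

Lemma hecke_tau_eigfun i a v : hecke_tau i (eigfun a *: v) =
  eigfun (spos i a) *: hecke_tau i v + difffun i (eigfun a) *: v.
Proof.
exact: (demazure_tauX (H := H) (hecke_TD i) (hecke_Tk i q) (hecke_TT i) (hecke_TX1 i)
   (hecke_TXfar (i := i)) (kfunV _ _ q0) (alphafunV q1 _ _)).
Qed.

(** The block of [T_i] from [mu] to itself is removed by [beta_i]. *)
Lemma hecke_tau_blocks i mu nu (v : V) : nu != sact i mu ->
  e nu (hecke_tau i (e mu v)) = 0.
Proof.
move=> ns; rewrite we_scale weB.
suff -> : e nu (T i (e mu v)) - e nu (betafun q (pos0 i) (pos1 i) *: (e mu v : M)) = 0.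
  by apply: fact0; exact: wfvalP.
have [nm|nm] := eqVneq nu mu.
  rewrite nm in ns *; have m01 : mu (pos0 i) != mu (pos1 i).
    by apply: contraNneq ns => /sact_id ->.
  by rewrite (hecke_T_diagonal q0 q1) // we_scale_we subrr.
rewrite (hecke_T_blocks q0 q1) // -we_scale_we we_ortho (negPf nm) subrr.
by [].
Qed.

Lemma hecke_tau_weight i mu (v : V) :
  e (sact i mu) (hecke_tau i (e mu v)) = hecke_tau i (e mu v).
Proof.
apply: (we_sep (W := W)) => nu; rewrite we_ortho; case: eqP => [->//|/eqP ns].
by rewrite hecke_tau_blocks.
Qed.

Lemma hecke_tau0 i : hecke_tau i 0 = 0.
Proof. by apply: (addrI (hecke_tau i 0)); rewrite -hecke_tauD !addr0. Qed.

Lemma hecke_tau_indfun i nu v :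
  hecke_tau i (indfun nu *: v) = indfun (sact i nu) *: hecke_tau i v.
Proof.
rewrite !indfun_scale.
apply: (additive_we_ext (W := W) (F := fun v => hecke_tau i (e nu v))
  (G := fun v => e (sact i nu) (hecke_tau i v))).
- by move=> u w; rewrite weD hecke_tauD.
- by move=> u w; rewrite hecke_tauD weD.
move=> mu {}v; rewrite we_ortho.
have [->|nm] := eqVneq nu mu; first by rewrite hecke_tau_weight.
by rewrite hecke_tau0 hecke_tau_blocks // (inj_eq (inv_inj (@sactK n _ i))).
Qed.

(** At the weight [mu], [x_a] is [X_a / mu_a - 1], a polynomial in [X_a]. This
    is how the rule for moving [X_a] past [tau_i] gives the one for [x_a]. *)
Lemma eigfun_local (mu : L) a c : val (mu a) = c -> c != 0 ->
  (kfun c^-1 * eigfun a - 1 : A) mu = xfun a mu.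
Proof.
move=> <- c0; rewrite [LHS]wfB wf1 [X in X - _]wfM kfunE eigfunE xfunE /cvar mulrA -kcM mulVf //.
by rewrite kc1 mul1r addrC addKr.
Qed.

Lemma diff_eigfun_local (mu : L) i a c : val (mu a) = c -> c != 0 ->
  (kfun c^-1 * difffun i (eigfun a) : A) mu = difffun i (xfun a) mu.
Proof.
move=> muc c0; rewrite [LHS]wfM kfunE !difffunE swap_eigfun swap_xfun !eigfunE !xfunE /divdiff.
case: eqP => [m01|_]; last by rewrite mulr0.
have -> : cvar mu (spos i a) = cvar mu a.
  by rewrite /cvar -sactE (sact_id m01).
rewrite -mulrBr (yvarB _ (pos0 i)) /cvar muc !mulrA -kcM mulVf // kc1 mul1r.
by rewrite yvarB.
Qed.

Lemma hecke_tau_xfun i a v : hecke_tau i (xfun a *: v) =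
  xfun (spos i a) *: hecke_tau i v + difffun i (xfun a) *: v.
Proof.
apply: (additive_we_ext (W := W) (F := fun v : M => hecke_tau i (xfun a *: v))
  (G := fun v : M => xfun (spos i a) *: hecke_tau i v + difffun i (xfun a) *: v)).
- by move=> u w; rewrite scalerDr hecke_tauD.
- by move=> u w; rewrite hecke_tauD !scalerDr addrACA.
move=> mu {}v; pose c := val (mu a).
have c0 : c != 0 by apply: contraNneq I0 => <-; exact: valP (mu a).
have sc : val (sact i mu (spos i a)) = c by rewrite sactE sposK.
rewrite -(scale_we_eq W v (eigfun_local erefl c0)).
rewrite -(scale_we_eq W v (diff_eigfun_local i erefl c0)).
rewrite -[X in xfun _ *: X]hecke_tau_weight -(scale_we_eq W _ (eigfun_local sc c0)).
rewrite hecke_tau_weight.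
set u := e mu v.
have TB (w w' : M) : hecke_tau i (w - w') = hecke_tau i w - hecke_tau i w'.
  by apply/eqP; rewrite eq_sym subr_eq -hecke_tauD subrK.
rewrite [X in hecke_tau i X]scaleMB1 TB hecke_tau_kfun hecke_tau_eigfun.
by rewrite [X in _ = X + _]scaleMB1 -[X in _ = _ + X]scalerA scalerDr addrAC.
Qed.

Lemma hecke_tau_twisted i (f : A) v :
  hecke_tau i (f *: v) = swapfun i f *: hecke_tau i v + difffun i f *: v.
Proof.
apply: (weight_twisted (@hecke_tauD i)).
- exact: hecke_tau_kfun.
- exact: hecke_tau_indfun.
- exact: hecke_tau_xfun.
Qed.

(** The two sides of the quadratic relation for [T_i] cancel in
    [hecke_op_square], and what is left is multiplied by invertible functions. *)
Lemma hecke_tau_square i v :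
  hecke_tau i (hecke_tau i v) = Qfun q (pos0 i) (pos1 i) *: v.
Proof.
have E := hecke_op_square (H := H) hecke_tauD hecke_tau_twisted i v.
have oK w : hecke_op H hecke_tau i w = T i w by exact: esym (hecke_tauK i w).
move: E; rewrite !oK hecke_TT -{1}[X in X = _]add0r => /addIr/esym E.
apply/eqP; rewrite -subr_eq0; apply/eqP.
rewrite -scalerA in E.
exact: (unit_scale_eq0 (alphafunV q1 _ _) (unit_scale_eq0 (alphafunV q1 _ _) E)).
Qed.

Lemma hecke_tau_commute (i j : 'I_n.-1) v : (i.+1 < j)%N || (j.+1 < i)%N ->
  hecke_tau i (hecke_tau j v) = hecke_tau j (hecke_tau i v).
Proof.
move=> ij; have E := hecke_op_far (H := H) hecke_tauD hecke_tau_twisted v ij.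
have oK l w : hecke_op H hecke_tau l w = T l w by exact: esym (hecke_tauK l w).
have TC : T i (T j v) = T j (T i v).
  exact: (act_rel N v (unital_given (hecke_far q ij))).
move: E; rewrite !oK TC subrr => /esym; rewrite -scalerA => E.
apply/eqP; rewrite -subr_eq0; apply/eqP.
exact: (unit_scale_eq0 (alphafunV q1 _ _) (unit_scale_eq0 (alphafunV q1 _ _) E)).
Qed.

Lemma hecke_tau_braid (i j : 'I_n.-1) v (D : L -> {mpoly k[n]}) :
  j = i.+1 :> nat ->
  (forall nu : L, ('X_(pos1 j) - 'X_(pos0 i)) * D nu =
      eval2 (Qpoly q (nu (pos0 i)) (nu (pos1 i))) 'X_(pos1 j) 'X_(pos1 i)
      - eval2 (Qpoly q (nu (pos0 i)) (nu (pos1 i))) 'X_(pos0 i) 'X_(pos1 i)) ->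
  hecke_tau j (hecke_tau i (hecke_tau j v)) - hecke_tau i (hecke_tau j (hecke_tau i v)) =
  polyfun (fun nu : L => if nu (pos0 i) == nu (pos1 j) then D nu else 0) *: v.
Proof.
move=> ij DE; have p20 : pos1 j != pos0 i by rewrite -val_eqE /=; lia.
pose Df : A := polyfun (fun nu => if nu (pos0 i) == nu (pos1 j) then D nu else 0).
have E := hecke_op_braid (H := H) (D := Df) hecke_tauD hecke_tau_twisted ij
  (hecke_tau_square i) (hecke_tau_square j).
have {}E := E _ v.
have oK l w : hecke_op H hecke_tau l w = T l w by exact: esym (hecke_tauK l w).
have TC : T i (T j (T i v)) = T j (T i (T j v)).
  exact: (act_rel N v (unital_given (hecke_braid q ij))).
have {}E : 0 = (alphafun q (pos0 i) (pos1 i) * alphafun q (pos0 j) (pos1 j) *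
    alphafun q (pos0 i) (pos1 j)) *: (hecke_tau i (hecke_tau j (hecke_tau i v)) -
    hecke_tau j (hecke_tau i (hecke_tau j v)) + Df *: v) :> M.
  rewrite -{1}(subrr (T i (T j (T i v)))) {2}TC -!oK; apply: E => nu.
  rewrite [LHS]polyfunE -(divdiff_quiverQ _ p20 (DE nu)).
  by congr (divdiff _ _ _ _); exact: esym (cvar_eq nu _ _).
move: E => /esym; rewrite -[X in X *: _]mulrA -scalerA => /(unit_scale_eq0 (alphafunV q1 _ _)).
rewrite -scalerA => /(unit_scale_eq0 (alphafunV q1 _ _))/(unit_scale_eq0 (alphafunV q1 _ _)) E.
apply/esym/eqP; rewrite -[X in _ == X]opprB -addr_eq0 addrC; apply/eqP; exact: E.
Qed.

End HeckeTau.

(** * From the affine Hecke algebra to H_n(Gamma) *)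

Arguments we : simpl never.
Arguments wx : simpl never.

Section KLRFromHeckeAction.

Variables (k : fieldType) (q : k) (I : {pred k}) (n : nat).
Hypotheses (q0 : q != 0) (q1 : q != 1) (I0 : 0 \notin I).
Local Notation L := {ffun 'I_n -> vert I}.
Variables (V : lmodType k) (N : action (hecke q n) V).
Hypothesis NP : CGamma_pred I (NUMod N).
Local Notation W := (hecke_weights I0 NP).
Local Notation e := (we W).
Local Notation x := (wx W).
Local Notation tau := (@hecke_tau k q I n q0 q1 I0 V N NP).

Definition hecke_klr_gen (g : klr_gen n (vert I)) (v : V) : V :=
  match g with
  | KE nu => e nu v
  | KX a nu => x nu a v
  | KT i nu => tau i (e nu v)
  end.

Lemma hecke_tauZ i c (v : V) : tau i (c *: v) = c *: (tau i v : V) :> V.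
Proof.
rewrite -(kfun_scale (W := W)) -[RHS](kfun_scale (W := W)).
exact: hecke_tau_kfun.
Qed.

Lemma hecke_klr_gen_linear g : linear (hecke_klr_gen g).
Proof.
case: g => [nu|a nu|i nu]; [exact: (we_linear W)|exact: (wx_linear W)|].
move=> c u v; rewrite /hecke_klr_gen (we_linear W) [LHS]hecke_tauD hecke_tauZ.
by [].
Qed.

Lemma hecke_tau_x i a (nu : L) v :
  tau i (x nu a v) = x (sact i nu) (spos i a) (tau i (e nu v)) +
   (if nu (pos0 i) == nu (pos1 i) then
      if a == pos0 i then - 1 else if a == pos1 i then 1 else 0
    else 0) *: e nu v.
Proof.
rewrite -(scale_we_xfun W a nu v) hecke_tau_xfun -(scale_we_const W v (difffun_xfun i a nu)).
by rewrite -scale_we_xfun hecke_tau_weight.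
Qed.

(** By [hecke_tau_weight] the idempotents inside products of [tau]s may be
    dropped, and the relations become those of the operators [hecke_tau]. *)
Lemma hecke_klr_rel u w v : klr_rel (n := n) (@Qpoly k q I) u w ->
  nx_eval hecke_klr_gen u v = nx_eval hecke_klr_gen w v.
Proof.
case=> {u w} /=.
- by move=> nu mu; rewrite we_ortho; case: ifP.
- by move=> i nu; rewrite we_idem hecke_tau_weight.
- by move=> a nu; rewrite wx_we we_wx.
- by move=> a b nu; exact: wx_comm.
- move=> i nu; rewrite hecke_tau_weight hecke_tau_square nx_eval_klr_poly.
  apply: scale_we_poly; rewrite QfunE eval2_quiverQ.
  by [].
- by move=> i j nu ij; rewrite !hecke_tau_weight; exact: hecke_tau_commute.
- move=> i j nu D ij DE; rewrite scaleN1r !hecke_tau_weight.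
  have [D' D'E] := frame_braid_poly q I ij.
  rewrite [LHS](hecke_tau_braid q0 q1 (NP := NP) _ ij D'E).
  (* The quotient [D] in the relation is unique. *)
  have -> : D = D' nu.
    have p20 : pos1 j != pos0 i by rewrite -val_eqE /=; lia.
    apply: (@mulfI _ ('X_(pos1 j) - 'X_(pos0 i))); last by rewrite DE D'E.
    by rewrite -tofrac_eq0 tofracB; exact: xvar_neq.
  rewrite (scale_we_poly W v (polyfunE _ nu)).
  by case: ifP => _; rewrite ?nx_eval_klr_poly //= poly_act0l.
- move=> i a nu; rewrite scaleN1r we_wx hecke_tau_x addrC addKr.
  case: ifP => _ /=; last by rewrite scale0r.
  by case: ifP => _ /=; [|case: ifP => _ /=]; rewrite ?scale1r ?scale0r.
Qed.

Definition hecke_klr_action : action (Hgamma q I n) V :=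
  presented_action hecke_klr_gen_linear hecke_klr_rel.

Lemma hecke_klr_action_gen g v :
  hecke_klr_action (gen (klr_rel (@Qpoly k q I)) g) v = hecke_klr_gen g v.
Proof. exact: presented_action_gen. Qed.

Lemma hecke_klr_Mod0 : Mod0_pred (NUMod hecke_klr_action).
Proof.
have bE nu v : block hecke_klr_action nu v <-> e nu v = v.
  by rewrite block_idem hecke_klr_action_gen.
split=> [|nu a v _].
  by apply: direct_sum_ext (weight_direct_sum W) => nu v; exact: iff_sym (bE nu v).
have [d xd] := wx_nil W nu a v; exists d; rewrite -[RHS]xd.
by apply: eq_iter => u; exact: hecke_klr_action_gen.
Qed.

End KLRFromHeckeAction.

Section WeightMorphisms.

Variables (k : fieldType) (I : {pred k}) (n : nat).
Local Notation L := {ffun 'I_n -> vert I}.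
Variables (V V' : lmodType k) (W : weight_data n L V) (W' : weight_data n L V').
Variable f : V -> V'.
Hypotheses (fL : linear f) (fe : forall nu v, f (we W nu v) = we W' nu (f v))
  (fx : forall nu a v, f (wx W nu a v) = wx W' nu a (f v)).

(** Fractions are determined by the [x_a], so a map that respects the weight
    data respects all functions on weights. *)
Lemma weight_morph_scale (g : wfun k n L) (v : V) :
  f (g *: (v : wspace W)) = g *: (f v : wspace W').
Proof.
apply: (we_sep (W := W')) => nu; rewrite -fe we_scale [RHS]we_scale -fe.
apply: (frac_act_morph (wx_linear W nu) (@wx_comm _ _ _ _ W nu) (wx_nil W nu)
  (wx_linear W' nu) (@wx_comm _ _ _ _ W' nu) (wx_nil W' nu) fL) => //.
exact: wfvalP.
Qed.

End WeightMorphisms.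

Section KLRMorphisms.

Variables (k : fieldType) (q : k) (I : {pred k}) (n : nat).
Hypotheses (q0 : q != 0) (q1 : q != 1) (I0 : 0 \notin I).
Variables (V V' : lmodType k) (M : action (Hgamma q I n) V) (M' : action (Hgamma q I n) V').
Hypotheses (MP : Mod0_pred (NUMod M)) (MP' : Mod0_pred (NUMod M')).
Variable f : V -> V'.
Hypotheses (fL : linear f) (fM : equivariant M M' f).

Lemma klr_morph_scale g (v : V) :
  f (g *: (v : wspace (klr_weights MP))) = g *: (f v : wspace (klr_weights MP')).
Proof. by apply: weight_morph_scale => // *; exact: fM. Qed.

Lemma klr_morph_tau i v : f (klr_tau (MP := MP) i v) = klr_tau (MP := MP') i (f v).
Proof.
apply: (additive_we_ext (W := klr_weights MP)
  (F := fun v => f (klr_tau (MP := MP) i v)) (G := fun v => klr_tau (MP := MP') i (f v))).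
- by move=> u w; rewrite klr_tauD (linD _ _ fL).
- by move=> u w; rewrite (linD _ _ fL) klr_tauD.
by move=> nu {}v; rewrite klr_weE klr_tau_e !fM klr_tau_e.
Qed.

Lemma klr_hecke_equivariant :
  equivariant (klr_hecke_action q0 q1 I0 MP) (klr_hecke_action q0 q1 I0 MP') f.
Proof.
apply: act_eq_gen => // g v; rewrite !presented_action_gen.
case: g => [[a|a|i]|] //=; try exact: klr_morph_scale.
by rewrite /klr_T /hecke_op (linD _ _ fL) !klr_morph_scale klr_morph_tau.
Qed.

End KLRMorphisms.

Section HeckeMorphisms.

Variables (k : fieldType) (q : k) (I : {pred k}) (n : nat).
Hypotheses (q0 : q != 0) (q1 : q != 1) (I0 : 0 \notin I).
Local Notation L := {ffun 'I_n -> vert I}.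
Variables (V V' : lmodType k) (N : action (hecke q n) V) (N' : action (hecke q n) V').
Hypotheses (NP : CGamma_pred I (NUMod N)) (NP' : CGamma_pred I (NUMod N')).
Variable f : V -> V'.
Hypotheses (fL : linear f) (fN : equivariant N N' f).
Local Notation W := (hecke_weights I0 NP).
Local Notation W' := (hecke_weights I0 NP').

(** The support is a condition on the action of the [X_a], so morphisms respect
    the weight decomposition. *)
Lemma hecke_morph_supported (nu : L) v :
  supported_at N (fun a => val (nu a)) v -> supported_at N' (fun a => val (nu a)) (f v).
Proof.
move=> /supported_atP nil; apply/supported_atP => a; have [d dv] := nil a; exists d.
have fX b w : f (N (Xgen q b) w) = N' (Xgen q b) (f w) by exact: fN.
by rewrite -(poly_act_morph fL fX) dv (lin0 fL).
Qed.

Lemma hecke_morph_e (nu : L) v : f (we W nu v) = we W' nu (f v).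
Proof.
apply: (additive_we_ext (W := W) (F := fun v => f (we W nu v))
  (G := fun v => we W' nu (f v))).
- by move=> u w; rewrite weD (linD _ _ fL).
- by move=> u w; rewrite (linD _ _ fL) weD.
move=> mu {}v; have E : we W' mu (f (we W mu v)) = f (we W mu v).
  by apply: hecke_proj_id; apply: hecke_morph_supported; exact: hecke_proj_in.
rewrite -E !we_ortho; case: eqP => [->|_]; last by rewrite (lin0 fL).
exact: esym E.
Qed.

Lemma hecke_morph_x (nu : L) a v : f (wx W nu a v) = wx W' nu a (f v).
Proof.
rewrite /wx /we /= /hecke_x -!scaleN1r (linD _ _ fL) !(linZ _ _ fL) fN.
by have := hecke_morph_e nu v; rewrite /we /= => ->.
Qed.

Lemma hecke_morph_scale g (v : V) : f (g *: (v : wspace W)) = g *: (f v : wspace W').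
Proof.
by apply: weight_morph_scale => //; [exact: hecke_morph_e|exact: hecke_morph_x].
Qed.

Lemma hecke_morph_tau i v :
  f (hecke_tau q0 q1 (I0 := I0) (NP := NP) i v) = hecke_tau q0 q1 (I0 := I0) (NP := NP') i (f v).
Proof.
rewrite /hecke_tau /demazure_tau hecke_morph_scale.
set be := fbe _ _ _; suff -> : f (hecke_T (NP := NP) i v - be *: (v : wspace W)) =
    hecke_T (NP := NP') i (f v) - be *: (f v : wspace W') by [].
rewrite -hecke_morph_scale.
have fB (u w : V) : f (u - w) = f u - f w.
  by rewrite -scaleN1r (linD _ _ fL) (linZ _ _ fL) scaleN1r.
apply: etrans (fB _ _) _; congr (_ - _).
exact: fN.
Qed.

Lemma hecke_klr_equivariant :
  equivariant (hecke_klr_action q0 q1 I0 NP) (hecke_klr_action q0 q1 I0 NP') f.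
Proof.
apply: act_eq_gen => // g v; rewrite !presented_action_gen.
case: g => [nu|a nu|i nu]; [exact: hecke_morph_e|exact: hecke_morph_x|].
by rewrite [LHS]hecke_morph_tau hecke_morph_e.
Qed.

End HeckeMorphisms.

(** * The equivalence *)

Section SameSpaceEquivalence.

Variables (k : fieldType) (B C : nualg k) (P : numod B -> Prop) (P' : numod C -> Prop).

Lemma same_space_iso (F : change_of_action P P') (G : change_of_action P' P) :
  (forall (M : modcat P) a v, new_act G (same_space_functor F M) a v = mact (sval M) a v) ->
  naturally_isomorphic (comp_functor (same_space_functor G) (same_space_functor F))
    (id_functor (modcat P)).
Proof.
move=> GF.
pose GFM (M : modcat P) := NUMod (new_act G (same_space_functor F M)).
have idL (M : modcat P) : linear (id : sval M -> sval M) by [].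
have to M : equivariant (mact (GFM M)) (mact (sval M)) id by move=> a v; exact: GF.
have from M : equivariant (mact (sval M)) (mact (GFM M)) id by move=> a v; exact: esym (GF _ _ _).
exists (fun M => @ModHom k B (GFM M) (sval M) id (idL M) (to M)).
exists (fun M => @ModHom k B (sval M) (GFM M) id (idL M) (from M)).
by split=> [M|M|M M' f]; apply: modhom_eq.
Qed.

End SameSpaceEquivalence.

(** The two functors fix the spaces and the maps. If they also undo each other
    on the actions, the identity maps are natural isomorphisms. *)
Lemma same_space_equivalence (k : fieldType) (B C : nualg k)
    (P : numod B -> Prop) (P' : numod C -> Prop)
    (F : change_of_action P P') (G : change_of_action P' P) :
  (forall (M : modcat P) a v, new_act G (same_space_functor F M) a v = mact (sval M) a v) ->
  (forall (N : modcat P') a v, new_act F (same_space_functor G N) a v = mact (sval N) a v) ->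
  is_equivalence (same_space_functor F).
Proof.
by move=> GF FG; exists (same_space_functor G); split; exact: same_space_iso.
Qed.

Section KLRRoundTrip.

Variables (k : fieldType) (q : k) (I : {pred k}) (n : nat).
Hypotheses (q0 : q != 0) (q1 : q != 1) (I0 : 0 \notin I).
Local Notation L := {ffun 'I_n -> vert I}.
Variables (V : lmodType k) (M : action (Hgamma q I n) V).
Hypothesis MP : Mod0_pred (NUMod M).
Local Notation N := (klr_hecke_action q0 q1 I0 MP).
Local Notation W := (klr_weights MP).

Lemma klr_hecke_CGamma : CGamma_pred I (NUMod N).
Proof.
apply: (CGamma_of_weights (W := W)); first exact: klr_hecke_actionX.
exact: klr_hecke_action1.
Qed.

Variable NP : CGamma_pred I (NUMod N).
Local Notation W' := (hecke_weights I0 NP).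

Lemma klr_round_e (nu : L) v : we W' nu v = we W nu v.
Proof.
apply: (additive_we_ext (W := W) (F := fun v => we W' nu v) (G := fun v => we W nu v)).
- by move=> u w; rewrite weD.
- by move=> u w; rewrite weD.
move=> mu {}v.
have E : we W' mu (we W mu v) = we W mu v.
  apply: hecke_proj_id; apply/(supported_at_we (W := W)); last exact: we_idem.
  exact: klr_hecke_actionX.
by rewrite -E we_ortho E we_ortho; case: eqP => // ->.
Qed.

Lemma klr_round_x (nu : L) a v : wx W' nu a v = wx W nu a v.
Proof.
pose c := val (nu a).
have c0 : c != 0 by apply: contraNneq I0 => <-; exact: valP (nu a).
have -> : wx W' nu a v = c^-1 *: N (Xgen q a) (we W' nu v) - we W' nu v by [].
rewrite klr_round_e klr_hecke_actionX -(scale_we_xfun W a nu v).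
rewrite -(scale_we_eq W v (eigfun_local erefl c0)) scaleMB1.
by rewrite [X in _ = X - _]kfun_scale.
Qed.

(** Two sets of weight data with the same projections and the same operators
    give the same action of functions. *)
Lemma klr_round_scale g (v : V) : g *: (v : wspace W') = g *: (v : wspace W) :> V.
Proof.
apply: (weight_morph_scale (W := W') (W' := W) (f := id)) => //.
  exact: klr_round_e.
exact: klr_round_x.
Qed.

Lemma klr_round_tau i v :
  hecke_tau q0 q1 (I0 := I0) (NP := NP) i v = klr_tau (MP := MP) i v.
Proof.
rewrite /hecke_tau /demazure_tau [LHS]klr_round_scale [X in _ *: (_ - X)]klr_round_scale.
rewrite /hecke_T klr_hecke_actionT /klr_T /hecke_op.
set be := fbe _ _ _; set al := fal _ _ _; set t := klr_tau i v.
by rewrite addrK scalerA (alphafunV q1) scale1r.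
Qed.

Lemma klr_round_trip a v : hecke_klr_action q0 q1 I0 NP a v = M a v.
Proof.
apply: (@act_eq_gen _ _ _ _ _ (hecke_klr_action q0 q1 I0 NP) M id) => // g {}v.
rewrite presented_action_gen; case: g => [nu|b nu|i nu].
- exact: klr_round_e.
- exact: klr_round_x.
rewrite [LHS]klr_round_tau klr_round_e klr_weE klr_tau_e.
by [].
Qed.

End KLRRoundTrip.

Section HeckeRoundTrip.

Variables (k : fieldType) (q : k) (I : {pred k}) (n : nat).
Hypotheses (q0 : q != 0) (q1 : q != 1) (I0 : 0 \notin I).
Local Notation L := {ffun 'I_n -> vert I}.
Variables (V : lmodType k) (N : action (hecke q n) V).
Hypothesis NP : CGamma_pred I (NUMod N).
Local Notation M := (hecke_klr_action q0 q1 I0 NP).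
Variable MP : Mod0_pred (NUMod M).
Local Notation W := (hecke_weights I0 NP).
Local Notation W' := (klr_weights MP).

Lemma hecke_round_e (nu : L) v : we W' nu v = we W nu v.
Proof. exact: presented_action_gen. Qed.

Lemma hecke_round_scale g (v : V) : g *: (v : wspace W') = g *: (v : wspace W) :> V.
Proof.
apply: (weight_morph_scale (W := W') (W' := W) (f := id)) => //.
  exact: hecke_round_e.
by move=> nu a {}v; exact: presented_action_gen.
Qed.

Lemma hecke_round_tau i v :
  klr_tau (MP := MP) i v = hecke_tau q0 q1 (I0 := I0) (NP := NP) i v.
Proof.
apply: (additive_we_ext (W := W) (F := klr_tau (MP := MP) i)
  (G := hecke_tau q0 q1 (I0 := I0) (NP := NP) i)).
- exact: klr_tauD.
- exact: hecke_tauD.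
move=> nu {}v; rewrite -{1}hecke_round_e klr_weE klr_tau_e.
exact: presented_action_gen.
Qed.

Lemma hecke_round_trip a v : klr_hecke_action q0 q1 I0 MP a v = N a v.
Proof.
apply: (@act_eq_gen _ _ _ _ _ (klr_hecke_action q0 q1 I0 MP) N id) => // g {}v.
rewrite presented_action_gen; case: g => [[a0|a0|i]|].
- by rewrite [LHS]hecke_round_scale; exact: esym (hecke_X_eigfun I0 NP a0 v).
- rewrite [LHS]hecke_round_scale; have XV := act_rel N v (unital_given (hecke_XV q a0)).
  have N1 w : N (gen (unital_rel (@hecke_rel k q n)) None) w = w by case: NP => /(_ w).
  rewrite /= N1 in XV; rewrite -{1}XV.
  rewrite [X in _ *: X](hecke_X_eigfun I0 NP a0) scalerA eigfunV //.
  by rewrite scale1r.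
- rewrite [LHS](_ : _ = hecke_T (NP := NP) i v) // (hecke_tauK q0 q1).
  rewrite -[X in _ = X + _]hecke_round_scale -[X in _ = _ + X]hecke_round_scale.
  by rewrite -hecke_round_tau.
- by have [N1 _] := NP; exact: esym (N1 v).
Qed.

End HeckeRoundTrip.

Theorem theorem3p19 (k : fieldType) (q : k) (I : {pred k}) (n : nat)
    (hq0 : q != 0) (hq1 : q != 1) (hI : 0 \notin I) (hn : (1 <= n)%N) :
  exists F : change_of_action (@Mod0_pred k q I n) (@CGamma_pred k q I n),
    [/\ forall M : Mod0 q I n, X_formula (mact (sval M)) (new_act F M),
        forall M : Mod0 q I n, T_formula (mact (sval M)) (new_act F M)
      & is_equivalence (same_space_functor F)].
Proof.
pose F := @ChangeOfAction k _ _ (@Mod0_pred k q I n) (@CGamma_pred k q I n)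
  (fun M => klr_hecke_action hq0 hq1 hI (svalP M))
  (fun M => klr_hecke_CGamma hq0 hq1 hI (svalP M))
  (fun M M' f => klr_hecke_equivariant hq0 hq1 hI (svalP M) (svalP M') (mh_linear f) (mh_equiv f)).
pose G := @ChangeOfAction k _ _ (@CGamma_pred k q I n) (@Mod0_pred k q I n)
  (fun N => hecke_klr_action hq0 hq1 hI (svalP N))
  (fun N => hecke_klr_Mod0 hq0 hq1 hI (svalP N))
  (fun N N' f => hecke_klr_equivariant hq0 hq1 hI (svalP N) (svalP N') (mh_linear f) (mh_equiv f)).
exists F; split=> [M|M|].
- exact: klr_X_formula.
- exact: klr_T_formula.
apply: (@same_space_equivalence _ _ _ _ _ F G) => [M a v|N a v].
  exact: klr_round_trip.
exact: hecke_round_trip.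
Qed.
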